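(* If the radius of convergence of a constructible generating function is finite, then it is a computable real number, provided either that its defining constructive system does not contain the constructions $\mathrm{Cyc}$ or $\mathrm{Set}$, or that Schanuel's conjecture holds.
   Context: A specification is a system $\mathcal Y_i=\mathcal H_i(\mathcal Z,\mathcal Y_1,\dots,\mathcal Y_m)$, $i=1,\dots,m$, of labelled species, where each $\mathcal H_i$ is built from $1$ (single structure of size $0$), $\mathcal Z$ (single atom) and the $\mathcal Y_j$ using disjoint union, labelled product, and the constructions $\mathrm{Seq}$, $\mathrm{Cyc}$, $\mathrm{Set}$. It is well founded if the iteration $\mathcal Y^{[0]}=0$, $\mathcal Y^{[n+1]}=\mathcal H(\mathcal Z,\mathcal Y^{[n]})$ is well defined for every $n$ (finitely many structures of each size; in particular $\mathrm{Seq},\mathrm{Cyc},\mathrm{Set}$ are applied only to classes with no structure of size $0$) and converges (for each $p$, structures of size at most $p$ stabilize up to isomorphism); zero-free if some iterate has all coordinates nonempty. A constructive system is a well-founded zero-free specification; a constructible generating function is a coordinate of the vector of exponential generating functions $\sum_n y_nz^n/n!$ of its solution, which satisfies the system obtained by $1\mapsto1$, $\mathcal Z\mapsto z$, $+,\times$ unchanged, $\mathrm{Seq}(G)\mapsto1/(1-G)$, $\mathrm{Cyc}(G)\mapsto\ln(1/(1-G))$, $\mathrm{Set}(G)\mapsto\exp G$. Schanuel's conjecture: if $x_1,\dots,x_n$ are real numbers linearly independent over $\mathbb Q$, then $\mathbb Q(x_1,\dots,x_n,e^{x_1},\dots,e^{x_n})$ has transcendence degree at least $n$ over $\mathbb Q$.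 *)

(* Defs.v *)
From mathcomp Require Import all_boot all_order all_fingroup all_algebra.
From mathcomp Require Import boolp reals Rstruct.
From mathcomp Require Import mpoly.
From Stdlib Require Import Rdefinitions Rtrigo_def.
From Coquelicot Require Rbar PSeries.

Set Implicit Arguments.
Unset Strict Implicit.
Unset Printing Implicit Defensive.

Record bij (U V : Type) := Bij {
  fwd :> U -> V;
  bwd : V -> U;
  fwdK : cancel fwd bwd;
  bwdK : cancel bwd fwd }.

Lemma bij_eq (U V : Type) (f g : bij U V) : f =1 g -> f = g.
Proof.
case: f g => [f f' fK f'K] [g g' gK g'K] /= /funext efg.
subst g; have e : f' = g'.
  by apply: funext => v; rewrite -{1}(g'K v) fK.
by subst g'; congr Bij; apply: Prop_irrelevance.
Qed.

Definition bij_id (U : Type) : bij U U :=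
  @Bij U U id id (fun=> erefl) (fun=> erefl).

Definition bij_comp (U V W : Type) (g : bij V W) (f : bij U V) : bij U W :=
  Bij (can_comp (fwdK g) (fwdK f)) (can_comp (bwdK f) (bwdK g)).

Definition bij_inv (U V : Type) (f : bij U V) : bij V U :=
  Bij (bwdK f) (fwdK f).

Lemma bij_inj (U V : Type) (f : bij U V) : injective f.
Proof. exact: can_inj (fwdK f). Qed.

Lemma bij_card (U V : finType) (f : bij U V) : #|V| = #|U|.
Proof. by apply/esym/(@bij_eq_card _ _ f); exists (bwd f); [apply: fwdK|apply: bwdK]. Qed.

(* Functors from finite sets and bijections to finite sets. *)
Record species := Species {
  str :> finType -> finType;
  relabel : forall U V : finType, bij U V -> str U -> str V;
  relabel_id : forall (U : finType) (s : str U), relabel (bij_id U) s = s;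
  relabel_comp : forall (U V W : finType) (g : bij V W) (f : bij U V) (s : str U),
    relabel (bij_comp g f) s = relabel g (relabel f s) }.

(* Isomorphism between the restrictions of [F] and [G] to sizes at most [p]. *)
Definition contact (p : nat) (F G : species) : Prop :=
  exists phi : forall U : finType, (#|U| <= p)%N -> bij (F U) (G U),
    forall (U V : finType) (hU : (#|U| <= p)%N) (hV : (#|V| <= p)%N)
           (f : bij U V) (s : F U),
      phi V hV (relabel f s) = relabel f (phi U hU s).

Definition no_size0 (F : species) : Prop :=
  forall U : finType, #|U| = 0%N -> F U -> False.

Definition nonempty_species (F : species) : Prop :=
  exists U : finType, inhabited (F U).

Section Restriction.
Variables (U V : finType) (f : bij U V) (A : {set U}) (B : {set V}).
Hypothesis h : forall x, (f x \in B) = (x \in A).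

Lemma restr_bwd_proof (y : V) : y \in B -> bwd f y \in A.
Proof. by rewrite -h bwdK. Qed.

Lemma restr_fwd_proof (x : U) : x \in A -> f x \in B.
Proof. by rewrite h. Qed.

Definition restr_fwd (x : {x | x \in A}) : {y | y \in B} :=
  exist _ (f (val x)) (restr_fwd_proof (valP x)).
Definition restr_bwd (y : {y | y \in B}) : {x | x \in A} :=
  exist _ (bwd f (val y)) (restr_bwd_proof (valP y)).

Lemma restr_fwdK : cancel restr_fwd restr_bwd.
Proof. by move=> x; apply: val_inj; rewrite /= fwdK. Qed.
Lemma restr_bwdK : cancel restr_bwd restr_fwd.
Proof. by move=> x; apply: val_inj; rewrite /= bwdK. Qed.

Definition bij_restr : bij {x | x \in A} {y | y \in B} :=
  Bij restr_fwdK restr_bwdK.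
End Restriction.

Lemma bij_setK (U V : finType) (f : bij U V) :
  cancel (fun A : {set U} => f @: A) (fun B : {set V} => bwd f @: B).
Proof.
by move=> A; rewrite -imset_comp (eq_imset (g := id)) ?imset_id //; apply: fwdK.
Qed.

Definition bij_set (U V : finType) (f : bij U V) : bij {set U} {set V} :=
  Bij (bij_setK f) (bij_setK (bij_inv f)).

Lemma mem_bij_set (U V : finType) (f : bij U V) (A : {set U}) x :
  (f x \in bij_set f A) = (x \in A).
Proof. exact: mem_imset (@bij_inj _ _ f). Qed.

Lemma mem_bij_setC (U V : finType) (f : bij U V) (A : {set U}) x :
  (f x \in ~: bij_set f A) = (x \in ~: A).
Proof. by rewrite !in_setC mem_bij_set. Qed.

Lemma mem_bwd_bij_set (U V : finType) (f : bij U V) (B : {set V}) x :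
  (f x \in B) = (x \in bwd (bij_set f) B).
Proof. by rewrite -(mem_bij_set f) bwdK. Qed.

Lemma bij_set_id (U : finType) (A : {set U}) : bij_set (bij_id U) A = A.
Proof. exact: imset_id. Qed.

Lemma bij_set_comp (U V W : finType) (g : bij V W) (f : bij U V) (A : {set U}) :
  bij_set (bij_comp g f) A = bij_set g (bij_set f A).
Proof. exact: imset_comp. Qed.

Section Cast.
Variables (F : species) (U : finType).

(* Transport along an equality of subsets, written as a relabelling. *)
Definition setcast (A B : {set U}) (h : forall x, (x \in B) = (x \in A)) :
  F {x | x \in A} -> F {x | x \in B} :=
  relabel (@bij_restr U U (bij_id U) A B h).

Lemma setcast_id (A : {set U}) (h : forall x, (x \in A) = (x \in A)) a :
  setcast h a = a.
Proof.
rewrite -[RHS](relabel_id a); congr relabel; apply: bij_eq => x.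
exact: val_inj.
Qed.
End Cast.

Section Relabel.
Variable F : species.

Lemma relabel_restr_id (U : finType) (A B : {set U}) h h' (a : F {x | x \in A}) :
  relabel (@bij_restr U U (bij_id U) A B h) a = setcast h' a.
Proof. by congr relabel; apply: bij_eq => x; apply: val_inj. Qed.

Lemma relabel_eq (U V : finType) (f g : bij U V) (s : F U) :
  f =1 g -> relabel f s = relabel g s.
Proof. by move=> /bij_eq->. Qed.
End Relabel.

Definition zero_species : species.
Proof. by refine (@Species (fun=> void) (fun _ _ _ s => s) _ _). Defined.

Definition set_species : species.
Proof. by refine (@Species (fun=> unit) (fun _ _ _ s => s) _ _). Defined.

Section CardSpecies.
Variable n : nat.

Lemma card_relabel_proof (U V : finType) (f : bij U V) :
  #|U| == n -> #|V| == n.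
Proof. by rewrite (bij_card f). Qed.

(* One structure on each set of size [n], none on the other sets. *)
Definition card_species : species.
Proof.
refine (@Species (fun U => {_ : unit | #|U| == n})
  (fun U V f s => exist _ tt (card_relabel_proof f (valP s))) _ _).
- by move=> U [[] s]; apply: val_inj.
- by move=> U V W g f s; apply: val_inj.
Defined.
End CardSpecies.

Definition one_species : species := card_species 0.
Definition atom_species : species := card_species 1.

(* A linear order on [U] is the list of the elements of [U] in that order. *)
Section Linear.

Lemma lin_relabel_proof (U V : finType) (f : bij U V) (t : #|U|.-tuple U) :
  uniq t -> uniq (tcast (esym (bij_card f)) (map_tuple f t)).
Proof. by rewrite val_tcast map_inj_uniq //; apply: bij_inj. Qed.

Definition lin_relabel (U V : finType) (f : bij U V)
    (t : {t : #|U|.-tuple U | uniq t}) : {t : #|V|.-tuple V | uniq t} :=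
  exist (fun t : #|V|.-tuple V => uniq t) _ (lin_relabel_proof f (valP t)).

Definition lin_species : species.
Proof.
refine (@Species (fun U => {t : #|U|.-tuple U | uniq t}) lin_relabel _ _).
- by move=> U t; do 2![apply: val_inj]; rewrite /= val_tcast /= map_id.
- by move=> U V W g f t; do 2![apply: val_inj];
    rewrite /= !val_tcast /= val_tcast /= map_comp.
Defined.
End Linear.

Section Cyclic.
Local Open Scope group_scope.

Lemma conj_inj (U V : finType) (f : bij U V) (s : {perm U}) :
  injective (f \o s \o bwd f).
Proof.
exact: inj_comp (inj_comp (@bij_inj _ _ f) perm_inj) (@bij_inj _ _ (bij_inv f)).
Qed.

Definition conj_perm (U V : finType) (f : bij U V) (s : {perm U}) : {perm V} :=
  perm (@conj_inj U V f s).

Lemma conj_permX (U V : finType) (f : bij U V) (s : {perm U}) i x :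
  (conj_perm f s ^+ i) (f x) = f ((s ^+ i) x).
Proof.
elim: i => [|i IHi]; first by rewrite !expg0 !perm1.
by rewrite !expgSr !permM IHi permE /= fwdK.
Qed.

(* Cyclic permutations: a single orbit, so [U] is nonempty. *)
Definition cyclic_perm (U : finType) (s : {perm U}) : bool :=
  [exists x, porbit s x == [set: U]].

Lemma cyc_relabel_proof (U V : finType) (f : bij U V) (s : {perm U}) :
  cyclic_perm s -> cyclic_perm (conj_perm f s).
Proof.
case/existsP=> x /eqP sx; apply/existsP; exists (f x).
apply/eqP/setP => y; rewrite in_setT; apply/porbitP.
have : bwd f y \in porbit s x by rewrite sx.
by case/porbitP=> i e; exists i; rewrite conj_permX -e bwdK.
Qed.

Definition cyc_relabel (U V : finType) (f : bij U V)
    (s : {s : {perm U} | cyclic_perm s}) : {s : {perm V} | cyclic_perm s} :=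
  exist (fun s : {perm V} => cyclic_perm s) _ (cyc_relabel_proof f (valP s)).

Definition cyc_species : species.
Proof.
refine (@Species (fun U => {s : {perm U} | cyclic_perm s}) cyc_relabel _ _).
- by move=> U s; apply: val_inj; apply/permP => x; rewrite permE.
- by move=> U V W g f s; apply: val_inj; apply/permP => x; rewrite !permE /= permE.
Defined.
End Cyclic.

Section Sum.
Variables F G : species.

Definition sum_relabel (U V : finType) (f : bij U V) (s : F U + G U) : F V + G V :=
  match s with inl a => inl (relabel f a) | inr b => inr (relabel f b) end.

Definition sum_species : species.
Proof.
refine (@Species (fun U => (F U + G U)%type) sum_relabel _ _).
- by move=> U [a|b]; rewrite /= relabel_id.
- by move=> U V W g f [a|b]; rewrite /= relabel_comp.
Defined.
End Sum.

Section Product.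
Variables F G : species.

Definition prod_str (U : finType) : finType :=
  {A : {set U} & (F {x | x \in A} * G {x | x \in ~: A})%type}.

Definition prod_relabel (U V : finType) (f : bij U V) (s : prod_str U) :
    prod_str V :=
  let: existT A (a, b) := s in
  existT _ (bij_set f A) (relabel (bij_restr (mem_bij_set f A)) a,
                          relabel (bij_restr (mem_bij_setC f A)) b).

Lemma prod_str_eq (U : finType) (A A' : {set U}) a b a' b'
    (h : forall x, (x \in A') = (x \in A))
    (hC : forall x, (x \in ~: A') = (x \in ~: A)) :
  setcast h a = a' -> setcast hC b = b' ->
  existT _ A (a, b) = existT _ A' (a', b') :> prod_str U.
Proof.
have e : A = A' by apply/setP => x; rewrite h.
by subst A' => <- <-; rewrite !setcast_id.
Qed.

Definition prod_species : species.
Proof.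
refine (@Species prod_str prod_relabel _ _).
- move=> U [A [a b]] /=.
  have h x : (x \in A) = (x \in bij_set (bij_id U) A) by rewrite bij_set_id.
  have hC x : (x \in ~: A) = (x \in ~: bij_set (bij_id U) A) by rewrite bij_set_id.
  apply: (prod_str_eq (h := h) (hC := hC));
    rewrite /setcast -relabel_comp -[RHS]relabel_id;
    by apply: relabel_eq => x; apply: val_inj.
- move=> U V W g f [A [a b]] /=.
  have h x : (x \in bij_set g (bij_set f A)) = (x \in bij_set (bij_comp g f) A).
    by rewrite bij_set_comp.
  have hC x : (x \in ~: bij_set g (bij_set f A)) =
              (x \in ~: bij_set (bij_comp g f) A) by rewrite bij_set_comp.
  apply: (prod_str_eq (h := h) (hC := hC));
    rewrite /setcast -!relabel_comp;
    by apply: relabel_eq => x; apply: val_inj.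
Defined.
End Product.

Section Substitution.
Variables F G : species.

Definition subst_dec (U : finType) (P : {set {set U}}) : finType :=
  {dffun forall B : {B | B \in P}, G {x | x \in val B}}.

(* [partition] requires nonempty blocks: this is the usual definition of the
   substitution of [G] in [F], which is meaningful when [no_size0 G]. *)
Definition subst_str (U : finType) : finType :=
  {P : {P : {set {set U}} | partition P [set: U]} &
   (F {B | B \in val P} * subst_dec (val P))%type}.

Definition bij_part (U V : finType) (f : bij U V) :
  bij {set {set U}} {set {set V}} := bij_set (bij_set f).

Lemma bij_part_proof (U V : finType) (f : bij U V) (P : {set {set U}}) :
  partition P [set: U] -> partition (bij_part f P) [set: V].
Proof.
have -> : [set: V] = f @: [set: U].
  by apply/setP => y; rewrite !inE -(bwdK f y) mem_imset ?inE //; apply: bij_inj.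
by move=> ?; rewrite imset_partition //; apply: bij_inj.
Qed.

Definition subst_relabel (U V : finType) (f : bij U V) (s : subst_str U) :
    subst_str V :=
  let: existT P (a, d) := s in
  existT _ (exist (fun P : {set {set V}} => partition P [set: V])
              (bij_part f (val P)) (bij_part_proof f (valP P)))
    (relabel (bij_restr (mem_bij_set (bij_set f) (val P))) a,
     [ffun B : {B | B \in bij_part f (val P)} =>
       relabel (bij_restr (mem_bwd_bij_set f (val B)))
         (d (restr_bwd (mem_bij_set (bij_set f) (val P)) B))]).

Lemma subst_dec_eq (U : finType) (P : {set {set U}}) (d : subst_dec P)
    (B B' : {B | B \in P}) (h : forall x, (x \in val B') = (x \in val B)) :
  setcast h (d B) = d B'.
Proof.
have e : B = B' by apply: val_inj; apply/setP => x; rewrite h.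
by subst B'; rewrite setcast_id.
Qed.

Lemma subst_str_eq (U : finType) (P P' : {P : {set {set U}} | partition P [set: U]})
    (a : F {B | B \in val P}) (d : subst_dec (val P))
    (a' : F {B | B \in val P'}) (d' : subst_dec (val P'))
    (h : forall B, (B \in val P') = (B \in val P)) :
  setcast h a = a' ->
  (forall B (hB : B \in val P) (hB' : B \in val P'),
     d (exist _ B hB) = d' (exist _ B hB')) ->
  existT _ P (a, d) = existT _ P' (a', d') :> subst_str U.
Proof.
have e : P = P' by apply: val_inj; apply/setP => x; rewrite h.
subst P' => <- ed; rewrite setcast_id; suff -> : d = d' by [].
by apply/ffunP => -[B hB]; apply: ed.
Qed.

Definition subst_species : species.
Proof.
refine (@Species subst_str subst_relabel _ _).
- move=> U [[P hP] [a d]] /=.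
  have e : bij_part (bij_id U) P = P.
    by rewrite /bij_part -[RHS]bij_set_id; apply: eq_imset => B; apply: bij_set_id.
  have h B : (B \in P) = (B \in bij_part (bij_id U) P) by rewrite e.
  apply: (@subst_str_eq _ (exist _ _ _) (exist _ _ _) _ _ _ _ h).
    rewrite /setcast -relabel_comp -[RHS]relabel_id.
    by apply: relabel_eq => B; apply: val_inj; apply: bij_set_id.
  move=> B hB hB'; rewrite ffunE /=.
  set B1 := restr_bwd _ _.
  have h1 x : (x \in B) = (x \in val B1) by rewrite /= imset_id.
  rewrite -(@subst_dec_eq _ _ d B1 (exist _ B hB') h1).
  by apply: relabel_eq => x; apply: val_inj.
- move=> U V W g f [[P hP] [a d]] /=.
  have e : bij_part (bij_comp g f) P = bij_part g (bij_part f P).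
    rewrite /bij_part -bij_set_comp; apply: eq_imset => B; exact: bij_set_comp.
  have h B : (B \in bij_part g (bij_part f P)) =
             (B \in bij_part (bij_comp g f) P) by rewrite e.
  apply: (@subst_str_eq _ (exist _ _ _) (exist _ _ _) _ _ _ _ h).
    rewrite /setcast -!relabel_comp.
    by apply: relabel_eq => B; apply: val_inj; apply: bij_set_comp.
  move=> B hB hB'; rewrite !ffunE /=.
  set B1 := restr_bwd _ _; set B2 := restr_bwd _ _.
  have h1 x : (x \in val B2) = (x \in val B1).
    apply/esym/(etrans (esym (mem_bwd_bij_set (bij_comp g f) B x))).
    exact: etrans (mem_bwd_bij_set g B (f x)) (mem_bwd_bij_set f _ x).
  rewrite -(@subst_dec_eq _ _ d B1 B2 h1) /setcast -!relabel_comp.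
  by apply: relabel_eq => x; apply: val_inj.
Defined.
End Substitution.

Inductive expr (m : nat) : Type :=
  | EOne
  | EAtom
  | EVar of 'I_m
  | ESum of expr m & expr m
  | EProd of expr m & expr m
  | ESeq of expr m
  | ECyc of expr m
  | ESet of expr m.
Arguments EOne {m}.
Arguments EAtom {m}.

Definition specification (m : nat) : Type := 'I_m -> expr m.

Fixpoint eval (m : nat) (Y : 'I_m -> species) (e : expr m) : species :=
  match e with
  | EOne => one_species
  | EAtom => atom_species
  | EVar j => Y j
  | ESum a b => sum_species (eval Y a) (eval Y b)
  | EProd a b => prod_species (eval Y a) (eval Y b)
  | ESeq a => subst_species lin_species (eval Y a)
  | ECyc a => subst_species cyc_species (eval Y a)
  | ESet a => subst_species set_species (eval Y a)
  end.

(* Finiteness of the number of structures of each size is built into [species];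
   what remains is that Seq, Cyc and Set be applied only where they are
   meaningful. *)
Fixpoint eval_defined (m : nat) (Y : 'I_m -> species) (e : expr m) : Prop :=
  match e with
  | EOne | EAtom | EVar _ => True
  | ESum a b | EProd a b => eval_defined Y a /\ eval_defined Y b
  | ESeq a | ECyc a | ESet a => eval_defined Y a /\ no_size0 (eval Y a)
  end.

Fixpoint iterate (m : nat) (H : specification m) (n : nat) : 'I_m -> species :=
  match n with
  | 0 => fun=> zero_species
  | n'.+1 => fun i => eval (iterate H n') (H i)
  end.

Definition iteration_defined (m : nat) (H : specification m) : Prop :=
  forall (n : nat) (i : 'I_m), eval_defined (iterate H n) (H i).

Definition iteration_converges (m : nat) (H : specification m) : Prop :=
  forall p : nat, exists N : nat, forall (n : nat) (i : 'I_m),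
    (N <= n)%N -> contact p (iterate H N i) (iterate H n i).

Definition well_founded_spec (m : nat) (H : specification m) : Prop :=
  iteration_defined H /\ iteration_converges H.

Definition zero_free (m : nat) (H : specification m) : Prop :=
  exists n : nat, forall i : 'I_m, nonempty_species (iterate H n i).

Definition constructive (m : nat) (H : specification m) : Prop :=
  well_founded_spec H /\ zero_free H.

(* The solution of a well-founded specification is the limit of its iteration,
   determined up to isomorphism. *)
Definition is_solution (m : nat) (H : specification m) (S : 'I_m -> species) : Prop :=
  forall p : nat, exists N : nat, forall (n : nat) (i : 'I_m),
    (N <= n)%N -> contact p (iterate H n i) (S i).

Fixpoint cyc_set_free_expr (m : nat) (e : expr m) : bool :=
  match e with
  | EOne | EAtom | EVar _ => true
  | ESum a b | EProd a b => cyc_set_free_expr a && cyc_set_free_expr b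
  | ESeq a => cyc_set_free_expr a
  | ECyc _ | ESet _ => false
  end.

Definition cyc_set_free (m : nat) (H : specification m) : Prop :=
  forall i : 'I_m, cyc_set_free_expr (H i).

Local Open Scope ring_scope.

Definition egf_coef (F : species) (n : nat) : R := #|F 'I_n|%:R / n`!%:R.

(* Total recursive functions, with minimization restricted to regular functions:
   since the operand is total and has a zero for every argument, the result is
   total. *)
Inductive recursive : forall n : nat, (n.-tuple nat -> nat) -> Prop :=
  | recursive_zero : @recursive 0 (fun=> 0%N)
  | recursive_succ : @recursive 1 (fun v => (thead v).+1)
  | recursive_proj n (i : 'I_n) : recursive (fun v : n.-tuple nat => tnth v i)
  | recursive_comp k n (f : k.-tuple nat -> nat) (g : 'I_k -> n.-tuple nat -> nat) :
      recursive f -> (forall i, recursive (g i)) ->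
      recursive (fun v : n.-tuple nat => f [tuple g i v | i < k])
  | recursive_prec n (f : n.-tuple nat -> nat) (g : n.+2.-tuple nat -> nat) :
      recursive f -> recursive g ->
      recursive (fun v : n.+1.-tuple nat =>
        nat_rec (fun=> nat) (f [tuple of behead v])
          (fun y r => g [tuple of y :: r :: behead v]) (thead v))
  | recursive_mu n (f : n.+1.-tuple nat -> nat)
      (f_regular : forall v : n.-tuple nat, exists y, f [tuple of y :: v] == 0%N) :
      recursive f -> recursive (fun v : n.-tuple nat => ex_minn (f_regular v))
  | recursive_ext n (f g : n.-tuple nat -> nat) :
      f =1 g -> recursive f -> recursive g.

Definition recursive1 (f : nat -> nat) : Prop :=
  recursive (fun v : 1.-tuple nat => f (thead v)).

(* A recursive sequence of rationals [(a n - b n) / (c n + 1)] converges to [x]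
   with error at most [2 ^ -n]. *)
Definition computable_real (x : R) : Prop :=
  exists a b c : nat -> nat,
    [/\ recursive1 a, recursive1 b, recursive1 c &
        forall n : nat,
          `|x - ((a n)%:R - (b n)%:R) / (c n).+1%:R| <= 2 ^- n].

Definition lin_indep_Q (n : nat) (x : 'I_n -> R) : Prop :=
  forall c : 'I_n -> rat, \sum_(i < n) ratr (c i) * x i = 0 -> forall i, c i = 0.

Definition alg_indep_Q (n : nat) (z : 'I_n -> R) : Prop :=
  forall p : {mpoly rat[n]}, mmap ratr z p = 0 -> p = 0.

(* The subfield of [R] generated by [G]; it contains the rational numbers since
   every subfield does. *)
Definition generated_subfield (G : R -> Prop) (z : R) : Prop :=
  forall K : {pred R}, GRing.divring_closed K -> (forall g, G g -> g \in K) -> z \in K.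

Definition trdeg_Q_ge (K : R -> Prop) (n : nat) : Prop :=
  exists z : 'I_n -> R, (forall i, K (z i)) /\ alg_indep_Q z.

Definition schanuel_conjecture : Prop :=
  forall (n : nat) (x : 'I_n -> R), lin_indep_Q x ->
    trdeg_Q_ge (generated_subfield (fun y => exists i, y = x i \/ y = exp (x i))) n.

(* Main.v *)
(** The radius [rho] is approximated by searching for pairs of rationals
    [x <= rho] and [x'] slightly above [x] together with finite certificates.

    That [x <= rho] is certified by rational values [u], one for each
    subexpression reachable from the coordinate, such that the system maps [u]
    below itself: the generating functions then converge at [x], bounded by [u].
    Such a [u] exists for [x < rho]: start from the values at some
    [x < x' < rho] and average them repeatedly with their image; strict
    inequality spreads from the atom to all nonconstant subexpressions.

    For an upper bound on [rho], one needs a subexpression [e] of radius [rho]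
    whose value at [x < rho] is at most [C / (rho - x)]: once a finite
    iteration from [0] shows that the value of [e] at [x'] exceeds [C / eps],
    we know that [rho - x' < eps].  Any [Seq] or [Cyc] of radius [rho] is such
    an [e], since its argument is at most [x / rho] at [x].  Otherwise a strongly connected class of
    expressions of radius [rho], depending on no other such class, consists of
    sums, products and exponentials.  If it is nonlinear, its values are
    bounded, as [y >= d * y ^ 2]; if it is linear, comparing the values at
    [x < x'] yields a pole of order one.

    Only the existence of an algorithm is claimed, so [e] and [C] may be
    hardwired and none of the case distinctions needs to be decided. *)

Require Import Defs.
From Stdlib Require Import Rdefinitions.
From mathcomp Require Import all_boot all_order all_fingroup all_algebra.
From mathcomp Require Import boolp reals Rstruct.
From mathcomp Require Import ring lra zify.
From Coquelicot Require Rbar PSeries.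

Set Implicit Arguments.
Unset Strict Implicit.
Unset Printing Implicit Defensive.
Import Order.TTheory GRing.Theory Num.Theory.

(** * Recursive functions *)

Local Open Scope nat_scope.

Section Recursive.

(** Two obstacles shape the certificates. The search ranges over integers, so every inequality has
    to survive rounding to multiples of [1 / q]. For upper bounds the slack comes from strictness;
    subexpressions that do not reach the atom never become strict, but their values are natural
    numbers and need no rounding. For lower bounds each iteration is damped by a factor [r < 1], and
    an iterate that vanishes is kept at 0. Exponentials and logarithms are never evaluated. The
    inequalities [(1 + t / q) ^ q <= exp t <= (1 - t / q) ^ - q], with the common denominator as
    exponent, turn all conditions into integer arithmetic, and their loss tends to 0 as [q] grows.
    Coefficients are nonnegative throughout: convergence is boundedness of the partial sums, values
    are suprema, and monotonicity does the work of complex analysis. Lower bounds are found at a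
    point beyond [rho], where divergence makes them exceed any threshold; the pole bound is what
    turns a large finite value into an upper bound on [rho]. *)

Lemma recursive_comp1 n (h : nat -> nat) (f : n.-tuple nat -> nat) :
  recursive1 h -> recursive f -> recursive (fun v => h (f v)).
Proof.
move=> rh rf; have := recursive_comp rh (fun _ : 'I_1 => rf).
by apply: recursive_ext => v; rewrite /thead tnth_mktuple.
Qed.

Definition recursive2 (h : nat -> nat -> nat) : Prop :=
  recursive (fun v : 2.-tuple nat => h (tnth v ord0) (tnth v ord_max)).

Lemma recursive_comp2 n (h : nat -> nat -> nat) (f g : n.-tuple nat -> nat) :
  recursive2 h -> recursive f -> recursive g -> recursive (fun v => h (f v) (g v)).
Proof.
move=> rh rf rg.
have := @recursive_comp 2 n _ (fun i => if i == ord0 then f else g) rh _.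
have H (i : 'I_2) : recursive (if i == ord0 then f else g) by case: ifP.
by move=> /(_ H); apply: recursive_ext => v; rewrite !tnth_mktuple.
Qed.

Lemma recursive_const n c : recursive (fun _ : n.-tuple nat => c).
Proof.
elim: c => [|c IHc]; last exact: (recursive_comp1 recursive_succ IHc).
have g0 (i : 'I_0) : recursive (fun _ : n.-tuple nat => 0) by case: i.
exact: (recursive_comp recursive_zero g0).
Qed.

Lemma recursive_reindex k n (f : k.-tuple nat -> nat) (h : 'I_k -> 'I_n) :
  recursive f -> recursive (fun v : n.-tuple nat => f [tuple tnth v (h i) | i < k]).
Proof. by move=> rf; apply: recursive_comp => // i; apply: recursive_proj. Qed.

Lemma recursive_cons n (f : n.+1.-tuple nat -> nat) (b : n.-tuple nat -> nat) :
  recursive f -> recursive b -> recursive (fun v : n.-tuple nat => f [tuple of b v :: v]).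
Proof.
move=> rf rb.
have H (i : 'I_n.+1) :
    recursive (fun v : n.-tuple nat => tnth [tuple of b v :: v] i).
  case: (unliftP ord0 i) => [j|] ->; last exact: rb.
  by apply: recursive_ext (recursive_proj j) => v; rewrite tnthS.
apply: recursive_ext (recursive_comp rf H) => v; congr f.
by apply: eq_from_tnth => i; rewrite tnth_mktuple.
Qed.

Lemma recursive_rec n (F : n.-tuple nat -> nat) (G : n.+2.-tuple nat -> nat)
    (b : n.-tuple nat -> nat) :
  recursive F -> recursive G -> recursive b ->
  recursive (fun v => nat_rec (fun=> nat) (F v)
    (fun y r => G [tuple of y :: r :: v]) (b v)).
Proof.
move=> rF rG rb; have := recursive_cons (recursive_prec rF rG) rb.
apply: recursive_ext => v; rewrite theadE.
have -> : [tuple of behead [tuple of b v :: v]] = v by apply: val_inj.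
set f1 := (f in nat_rec _ _ f _ = _); set f2 := (f in _ = nat_rec _ _ f _).
have e y r : f1 y r = f2 y r by congr G; apply: val_inj.
by elim: (b v) => //= k ->.
Qed.

Lemma recursive_succn n (f : n.-tuple nat -> nat) :
  recursive f -> recursive (fun v => (f v).+1).
Proof. exact: (recursive_comp1 recursive_succ). Qed.

Lemma recursive_add : recursive2 addn.
Proof.
have := recursive_rec (recursive_proj (@ord_max 1))
  (recursive_succn (recursive_proj (lift ord0 (@ord0 2)))) (recursive_proj (@ord0 1)).
apply: recursive_ext => v; elim: (tnth v ord0) => //= y IH.
by rewrite addSn -IH tnthS.
Qed.

Lemma recursive_mul : recursive2 muln.
Proof.
have := recursive_rec (recursive_const 2 0)
  (recursive_comp2 recursive_add (recursive_proj (@ord_max 3))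
     (recursive_proj (lift ord0 (@ord0 2)))) (recursive_proj (@ord0 1)).
apply: recursive_ext => v; elim: (tnth v ord0) => //= y IH.
rewrite mulSn -IH tnthS; congr (_ + _).
by rewrite !(tnth_nth 0).
Qed.

Lemma recursive_exp : recursive2 expn.
Proof.
have := recursive_rec (recursive_const 2 1)
  (recursive_comp2 recursive_mul (recursive_proj (lift ord0 (lift ord0 (@ord0 1))))
     (recursive_proj (lift ord0 (@ord0 2)))) (recursive_proj (@ord_max 1)).
apply: recursive_ext => v; elim: (tnth v ord_max) => //= y IH.
by rewrite expnS -IH !tnthS.
Qed.

Lemma recursive_pred : recursive1 predn.
Proof.
have := recursive_rec (recursive_const 1 0) (recursive_proj (@ord0 2))
   (recursive_proj (@ord0 0)).
by apply: recursive_ext => v; rewrite /thead; case: (tnth v ord0).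
Qed.

Lemma recursive_sub : recursive2 subn.
Proof.
have := recursive_rec (recursive_proj (@ord0 1))
  (recursive_comp1 recursive_pred (recursive_proj (lift ord0 (@ord0 2))))
  (recursive_proj (@ord_max 1)).
apply: recursive_ext => v; elim: (tnth v ord_max) => [|y IH]; first by rewrite subn0.
by rewrite subnS -IH /= tnthS.
Qed.

Definition decidable_rec n (P : n.-tuple nat -> bool) : Prop :=
  recursive (fun v => P v : nat).

Lemma decidable_leq n (f g : n.-tuple nat -> nat) :
  recursive f -> recursive g -> decidable_rec (fun v => f v <= g v).
Proof.
move=> rf rg.
have := recursive_comp2 recursive_sub (recursive_const n 1)
  (recursive_comp2 recursive_sub rf rg).
by apply: recursive_ext => v /=; case: leqP; lia.
Qed.

Lemma decidable_and n (P Q : n.-tuple nat -> bool) :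
  decidable_rec P -> decidable_rec Q -> decidable_rec (fun v => P v && Q v).
Proof.
move=> rP rQ; apply: recursive_ext (recursive_comp2 recursive_mul rP rQ) => v /=.
by rewrite mulnb.
Qed.

Lemma decidable_not n (P : n.-tuple nat -> bool) :
  decidable_rec P -> decidable_rec (fun v => ~~ P v).
Proof.
move=> rP.
apply: recursive_ext (recursive_comp2 recursive_sub (recursive_const n 1) rP) => v /=.
by case: (P v).
Qed.

Lemma decidable_all (I : Type) (s : seq I) n (P : I -> n.-tuple nat -> bool) :
  (forall i, decidable_rec (P i)) -> decidable_rec (fun v => all (P^~ v) s).
Proof.
move=> rP; elim: s => [|i s IHs]; first exact: (recursive_const n 1).
exact: decidable_and.
Qed.

Lemma decidable_iota n (P : nat -> n.-tuple nat -> bool) (b : n.-tuple nat -> nat) :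
  decidable_rec (fun v : n.+1.-tuple nat => P (thead v) [tuple of behead v]) ->
  recursive b -> decidable_rec (fun v => all (P^~ v) (iota 0 (b v))).
Proof.
move=> rP rb.
have rG : recursive (fun w : n.+2.-tuple nat =>
    tnth w (lift ord0 ord0) * P (thead w) [tuple tnth w (lift ord0 (lift ord0 i)) | i < n]).
  apply: (recursive_comp2 recursive_mul); first exact: recursive_proj.
  (* In [w = y :: r :: v] the reindexing [h] skips the accumulator [r]. *)
  pose h (i : 'I_n.+1) : 'I_n.+2 :=
    if unlift ord0 i is Some j then lift ord0 (lift ord0 j) else ord0.
  apply: recursive_ext (recursive_reindex h rP) => w.
  rewrite /thead tnth_mktuple /h unlift_none; congr (nat_of_bool (P _ _)).
  apply: eq_from_tnth => i; rewrite tnth_mktuple (tnth_nth 0) /= nth_behead.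
  have -> : i.+1 = lift ord0 i by rewrite /= /bump.
  by rewrite (nth_map ord0) ?size_enum_ord // nth_ord_enum liftK.
have := recursive_rec (recursive_const n 1) rG rb.
apply: recursive_ext => v; elim: (b v) => // y IHy.
rewrite [LHS]/= IHy -(addn1 y) iotaD all_cat /= andbT add0n tnthS theadE mulnb.
congr (nat_of_bool (_ && P _ _)).
by apply: eq_from_tnth => i; rewrite tnth_mktuple !tnthS.
Qed.

Lemma decidable_has_iota n (P : nat -> n.-tuple nat -> bool) (b : n.-tuple nat -> nat) :
  decidable_rec (fun v : n.+1.-tuple nat => P (thead v) [tuple of behead v]) ->
  recursive b -> decidable_rec (fun v => has (P^~ v) (iota 0 (b v))).
Proof.
move=> rP rb; have := decidable_not (decidable_iota (P := fun y v => ~~ P y v)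
  (decidable_not rP) rb).
by apply: recursive_ext => v; rewrite -has_predC; congr nat_of_bool; apply: eq_has => y /=; rewrite negbK.
Qed.

Lemma recursive_div : recursive2 divn.
Proof.
have rP : recursive (fun w : 4.-tuple nat =>
    tnth w (lift ord0 ord0) +
    ((tnth w ord0).+1 * tnth w ord_max <= tnth w (lift ord0 (lift ord0 ord0)))).
  apply: (recursive_comp2 recursive_add); first exact: recursive_proj.
  apply: decidable_leq; last exact: recursive_proj.
  apply: (recursive_comp2 recursive_mul); last exact: recursive_proj.
  by apply: recursive_succn; apply: recursive_proj.
(* The quotient counts the [z < x] with [z.+1 * y <= x]; the factor [1 <= y] yields the default
   value 0 of a division by 0. *)
have := recursive_comp2 recursive_mul
  (decidable_leq (recursive_const 2 1) (recursive_proj ord_max))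
  (recursive_rec (recursive_const 2 0) rP (recursive_proj ord0)).
apply: recursive_ext => v.
set x := tnth v ord0; set y := tnth v ord_max.
have E (k : nat) : nat_rec (fun=> nat) 0 (fun z r =>
   tnth [tuple of z :: r :: v] (lift ord0 ord0) + 
   ((tnth [tuple of z :: r :: v] ord0).+1 * tnth [tuple of z :: r :: v] ord_max <=
     tnth [tuple of z :: r :: v] (lift ord0 (lift ord0 ord0)))) k =
   nat_rec (fun=> nat) 0 (fun z r => r + (z.+1 * y <= x)) k.
  elim: k => //= k ->; rewrite !tnthS !tnth0.
  by congr (_ + (_ * _ <= _)); rewrite /y !(tnth_nth 0).
rewrite {}E; case: posnP => [->|y0]; first by rewrite divn0.
rewrite mul1n.
suff E k : nat_rec (fun=> nat) 0 (fun z r => r + (z.+1 * y <= x)) k = minn k (x %/ y).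
  by rewrite E; apply/minn_idPr/leq_div.
elim: k => [|k IHk]; first by rewrite min0n.
rewrite [LHS]/= IHk -leq_divRL //; move: (x %/ y) => z.
by case: (ltnP k z) => h; rewrite ?addn1 ?addn0; lia.
Qed.

Lemma recursive_mod : recursive2 modn.
Proof.
have := recursive_comp2 recursive_sub (recursive_proj (@ord0 1))
  (recursive_comp2 recursive_mul recursive_div (recursive_proj (@ord_max 1))).
by apply: recursive_ext => v; rewrite {1}(divn_eq (tnth v ord0) (tnth v ord_max)) addKn.
Qed.

Lemma recursive_search n (P : n.+1.-tuple nat -> bool) :
  decidable_rec P -> (forall v : n.-tuple nat, exists y, P [tuple of y :: v]) ->
  exists2 f : n.-tuple nat -> nat, recursive f & forall v, P [tuple of f v :: v].
Proof.
move=> rP exP.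
have reg (v : n.-tuple nat) : exists y, (~~ P [tuple of y :: v] : nat) == 0%N.
  by have [y Py] := exP v; exists y; rewrite Py.
exists (fun v => ex_minn (reg v)).
  exact: (recursive_mu reg (decidable_not rP)).
by move=> v; case: ex_minnP => y; case: (P _).
Qed.

(** Minimization searches for one number only, so a common bound [k] on [x] and [y] is found first.
    Then [x] and after it [y] are recovered by two further searches that are known to succeed. *)
Lemma recursive_search2 (P : nat -> nat -> nat -> bool) :
  decidable_rec (fun v : 3.-tuple nat =>
    P (tnth v ord_max) (tnth v (lift ord0 ord0)) (tnth v ord0)) ->
  (forall n, exists x y, P n x y) ->
  exists f g, [/\ recursive1 f, recursive1 g & forall n, P n (f n) (g n)].
Proof.
move=> rP exP.
pose Q n k x := has (fun y => P n x y) (iota 0 k).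
have rQ : decidable_rec (fun v : 3.-tuple nat =>
    Q (tnth v ord_max) (tnth v (lift ord0 ord0)) (tnth v ord0)).
  apply: (@decidable_has_iota 3 (fun y v => P (tnth v ord_max) (tnth v ord0) y)
     (fun v => tnth v (lift ord0 ord0))); last exact: recursive_proj.
  pose h (i : 'I_3) : 'I_4 := if val i == 0 then ord0 else if val i == 1 then lift ord0 ord0 else ord_max.
  apply: recursive_ext (recursive_reindex h rP) => w; rewrite !tnth_mktuple /h /=.
  by congr (nat_of_bool (P _ _ _)); rewrite !(tnth_nth 0) //= nth_behead.
have rQ' : decidable_rec (fun v : 2.-tuple nat =>
    has (Q (tnth v ord_max) (tnth v ord0)) (iota 0 (tnth v ord0))).
  apply: (@decidable_has_iota 2 (fun x v => Q (tnth v ord_max) (tnth v ord0) x)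
     (fun v => tnth v ord0)); last exact: recursive_proj.
  apply: recursive_ext rQ => w; congr (nat_of_bool (Q _ _ _));
  by rewrite !(tnth_nth 0) //= nth_behead.
have [|k rk hk] := recursive_search rQ'.
  move=> v; have [x [y Pxy]] := exP (thead v); exists (maxn x y).+1.
  apply/hasP; exists x; first by rewrite mem_iota tnth0; lia.
  apply/hasP; exists y; first by rewrite mem_iota tnth0; lia.
  by rewrite (tnth_nth 0) /= -[nth _ _ _](tnth_nth 0 v ord0).
pose kk n := k [tuple n].
have rkk : recursive1 kk.
  by apply: recursive_ext rk => v; rewrite /kk; congr k; apply: eq_from_tnth => i; rewrite (ord1 i).
have rB : decidable_rec (fun v : 2.-tuple nat => Q (tnth v ord_max) (kk (tnth v ord_max)) (tnth v ord0)).
  pose h (i : 'I_3) (v : 2.-tuple nat) : nat := 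
    if val i == 0 then tnth v ord0 else if val i == 1 then kk (tnth v ord_max) else tnth v ord_max.
  have rh i : recursive (h i).
    rewrite /h; case: (val i == 0); first exact: recursive_proj.
    case: (val i == 1); last exact: recursive_proj.
    exact: (recursive_comp1 rkk (recursive_proj ord_max)).
  by apply: recursive_ext (recursive_comp rQ rh) => v; rewrite !tnth_mktuple /h.
have hkk n : has (Q n (kk n)) (iota 0 (kk n)) by have := hk [tuple n]; rewrite !(tnth_nth 0).
have eT (v : 1.-tuple nat) : [tuple thead v] = v.
  by apply: eq_from_tnth => i; rewrite (ord1 i).
have [|f rf hf] := recursive_search rB.
  move=> v; have /hasP[x _ hx] := hkk (thead v); exists x.
  by rewrite -(eT v) !(tnth_nth 0).
pose ff n := f [tuple n].
have rff : recursive1 ff.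
  by apply: recursive_ext rf => v; rewrite /ff; congr f; apply: eq_from_tnth => i; rewrite (ord1 i).
have rC : decidable_rec (fun v : 2.-tuple nat => P (tnth v ord_max) (ff (tnth v ord_max)) (tnth v ord0)).
  pose h (i : 'I_3) (v : 2.-tuple nat) : nat := 
    if val i == 0 then tnth v ord0 else if val i == 1 then ff (tnth v ord_max) else tnth v ord_max.
  have rh i : recursive (h i).
    rewrite /h; case: (val i == 0); first exact: recursive_proj.
    case: (val i == 1); last exact: recursive_proj.
    exact: (recursive_comp1 rff (recursive_proj ord_max)).
  by apply: recursive_ext (recursive_comp rP rh) => v; rewrite !tnth_mktuple /h.
have hff n : has (P n (ff n)) (iota 0 (kk n)).
  by have := hf [tuple n]; rewrite !(tnth_nth 0).
have [|g rg hg] := recursive_search rC.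
  move=> v; have /hasP[y _ hy] := hff (thead v); exists y.
  by rewrite -(eT v) !(tnth_nth 0).
exists ff, (fun n => g [tuple n]); split=> //.
  by apply: recursive_ext rg => v; rewrite eT.
by move=> n; have := hg [tuple n]; rewrite !(tnth_nth 0).
Qed.

End Recursive.

(** * Composition of coefficient sequences *)

Local Open Scope ring_scope.

Section Coefficients.
Variable K : numFieldType.
Implicit Types a b : nat -> K.

Definition delta0 (n : nat) : K := (n == 0)%:R.

Definition seqmul a b (n : nat) : K := \sum_(k < n.+1) a k * b (n - k)%N.

Definition cpow a (k : nat) : nat -> K := iter k (seqmul a) delta0.

(** This is composition of power series when [a 0 = 0]: the powers cut off, those with [k > n], then
    have no coefficient of index [n]. *)
Definition csub (phi : nat -> K) a (n : nat) : K := \sum_(k < n.+1) phi k * cpow a k n.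

Definition seq_coef (k : nat) : K := 1.
(* Since [0^-1 = 0], there is no term for [k = 0]. *)
Definition cyc_coef (k : nat) : K := k%:R^-1.
Definition set_coef (k : nat) : K := k`!%:R^-1.

Lemma eq_seqmul a a' b b' n :
  (forall k, (k <= n)%N -> a k = a' k) -> (forall k, (k <= n)%N -> b k = b' k) ->
  seqmul a b n = seqmul a' b' n.
Proof.
move=> ea eb; apply: eq_bigr => k _.
by rewrite ea ?eb ?leq_subr // -ltnS.
Qed.

Lemma eq_cpow a a' k n :
  (forall k, (k <= n)%N -> a k = a' k) -> cpow a k n = cpow a' k n.
Proof.
elim: k n => //= k IHk n ea; apply: eq_seqmul => // j jn.
by apply: IHk => i ij; apply: ea; apply: leq_trans jn.
Qed.

Lemma eq_csub phi a a' n :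
  (forall k, (k <= n)%N -> a k = a' k) -> csub phi a n = csub phi a' n.
Proof. by move=> ea; apply: eq_bigr => k _; rewrite (eq_cpow _ ea). Qed.

Lemma fact_neq0 n : (n`!%:R : K) != 0.
Proof. by rewrite pnatr_eq0 -lt0n fact_gt0. Qed.

Lemma binomial_seqmul (f g : nat -> K) n :
  (\sum_(k < n.+1) 'C(n, k)%:R * (f k * g (n - k)%N)) / n`!%:R =
  seqmul (fun k => f k / k`!%:R) (fun k => g k / k`!%:R) n :> K.
Proof.
rewrite big_distrl; apply: eq_bigr => k _ /=.
have kn : (k <= n)%N by rewrite -ltnS.
have := bin_fact kn; move/(congr1 (fun m : nat => m%:R : K)).
rewrite !natrM => <-; have : ('C(n, k)%:R : K) != 0 by rewrite pnatr_eq0 -lt0n bin_gt0.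
by move: (fact_neq0 k) (fact_neq0 (n - k)%N) => h1 h2 h3; field; rewrite h1 h2 h3.
Qed.

Lemma sum_card_subset (T : finType) (F : {set T} -> K) (f : nat -> K) (D : {set T}) :
  (forall B : {set T}, B \subset D -> F B = f #|B|) ->
  \sum_(B : {set T} | B \subset D) F B = \sum_(k < #|D|.+1) 'C(#|D|, k)%:R * f k.
Proof.
move=> Ff.
rewrite (partition_big (fun B : {set T} => inord #|B| : 'I_#|D|.+1) xpredT) //=.
apply: eq_bigr => k _.
rewrite (eq_bigl (mem [set B : {set T} | B \subset D & #|B| == k])); last first.
  move=> B; rewrite /= !inE; case BD: (B \subset D) => //=.
  by rewrite -val_eqE /= inordK // ltnS subset_leq_card.
rewrite (eq_bigr (fun=> f k)) ?sumr_const ?cards_draws ?mulr_natl //.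
by move=> B; rewrite /= inE => /andP[/Ff -> /eqP ->].
Qed.

(** * Sums over set partitions *)

Section Partitions.
Variables (T : finType) (g : nat -> nat).
Hypothesis g0 : g 0 = 0.

(** The partial Bell polynomial with indices [#|D|] and [k], evaluated at the sequence [g]. *)
Definition part_sum (k : nat) (D : {set T}) : nat :=
  \sum_(P : {set {set T}} | partition P D && (#|P| == k)) \prod_(B in P) g #|B|.

(* Double counting of the partitions with a distinguished block [B]. *)
Lemma part_sumS k (D : {set T}) :
  (k.+1 * part_sum k.+1 D = \sum_(B : {set T} | B \subset D) g #|B| * part_sum k (D :\: B))%N.
Proof.
rewrite /part_sum big_distrr /=.
transitivity (\sum_(P : {set {set T}} | partition P D && (#|P| == k.+1))
    \sum_(B in P) g #|B| * \prod_(A in P :\ B) g #|A|)%N.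
  apply: eq_bigr => P /andP[_ /eqP Pk].
  rewrite [RHS](eq_bigr (fun=> (\prod_(A in P) g #|A|)%N)) ?sum_nat_const ?Pk //.
  by move=> B BP; rewrite [RHS](big_setD1 B).
rewrite (exchange_big_dep xpredT) //= [RHS]big_mkcond /=; apply: eq_bigr => B _.
case: ifPn => [BD|nBD]; last first.
  apply: big1 => P /andP[/andP[pP _] BP]; case/negP: nBD.
  by rewrite -(cover_partition pP); apply: bigcup_sup BP.
(* The empty set is a subset of [D] but never a block; [g0] makes its term vanish. *)
have [->|B0] := eqVneq B set0.
  by rewrite cards0 g0 mul0n; apply: big1 => P _; rewrite mul0n.
rewrite big_distrr /= (reindex_onto (fun P => B |: P) (fun P => P :\ B)) /=; last first.
  by move=> P /andP[_ BP]; rewrite setD1K.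
apply: eq_big => [P|P /andP[_ /eqP->] //].
rewrite setU11 andbT; apply/idP/idP.
  case/andP=> /andP[pP kP] /eqP e; have BP : B \notin P by rewrite -e !inE eqxx.
  have := partitionD1 pP (setU11 _ _); rewrite e => ->.
  by move: kP; rewrite cardsU1 BP add1n eqSS.
case/andP=> pP kP.
have BP : B \notin P.
  apply/negP => BP; have := bigcup_sup B BP (F := id).
  rewrite -/(cover P) (cover_partition pP) => /subsetP sB.
  by case/set0Pn: B0 => x xB; have := sB _ xB; rewrite !inE xB.
rewrite cardsU1 BP add1n eqSS kP setU1K // eqxx !andbT.
have -> : D = B :|: (D :\: B) by rewrite setDE setUIr setUCr setIT; apply/esym/setUidPr.
by apply: partitionU1 => //; rewrite disjoints_subset setCD subsetUr.
Qed.

(** Each use of [part_sumS] splits off one factor of the convolution power, and the multiplicities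
    [k.+1] accumulate to the factorial. *)
Lemma part_sumE k (D : {set T}) :
  (part_sum k D)%:R / #|D|`!%:R =
  cpow (fun n => (g n)%:R / n`!%:R) k #|D| / k`!%:R :> K.
Proof.
elim: k D => [|k IHk] D.
  rewrite fact0 divr1 /= /delta0 /part_sum.
  have [->|D0] := eqVneq D set0.
    rewrite cards0 fact0 divr1 eqxx (big_pred1 set0) ?big_set0 // => P.
    by rewrite /= partition_set0 cards_eq0 andbb.
  rewrite cards_eq0 (negPf D0) big1 ?mul0r // => P /andP[pP].
  rewrite cards_eq0 => /eqP P0; case/eqP: D0.
  by rewrite -(cover_partition pP) P0 /cover big_set0.
have k0 : (k.+1%:R : K) != 0 by rewrite pnatr_eq0.
apply: (mulfI k0); rewrite factS natrM invfM [RHS]mulrCA mulVKf //.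
rewrite mulrA -natrM part_sumS natr_sum.
pose h j : K := j`!%:R * (cpow (fun n => (g n)%:R / n`!%:R) k j / k`!%:R).
rewrite (sum_card_subset (f := fun j => (g j)%:R * h (#|D| - j)%N)); last first.
  move=> B BD; rewrite natrM /h; congr (_ * _).
  have := IHk (D :\: B); rewrite cardsD (setIidPr BD) => <-.
  by rewrite mulrC divfK ?fact_neq0.
rewrite (binomial_seqmul (fun j => (g j)%:R) h) /= /seqmul big_distrl /=; apply: eq_bigr => j _.
by rewrite /h [_`!%:R * _]mulrC mulfK ?fact_neq0 // mulrA.
Qed.
End Partitions.
End Coefficients.

(** * Counting structures *)

Section Counting.

Lemma bij_of_card (U V : finType) : #|U| = #|V| -> exists f : bij U V, True.
Proof.
move=> e; unshelve eexists; last by [].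
refine (@Bij U V (fun x => enum_val (cast_ord e (enum_rank x)))
  (fun y => enum_val (cast_ord (esym e) (enum_rank y))) _ _).
- by move=> x; rewrite enum_valK cast_ordK enum_rankK.
- by move=> y; rewrite enum_valK cast_ordKV enum_rankK.
Qed.

Lemma relabel_bij (F : species) (U V : finType) (f : bij U V) :
  bijective (@relabel F U V f).
Proof.
exists (relabel (bij_inv f)) => s; rewrite -relabel_comp -[RHS]relabel_id;
  by apply: relabel_eq => x /=; rewrite ?fwdK ?bwdK.
Qed.

Definition scount (F : species) (n : nat) : nat := #|F 'I_n|.

Lemma card_str (F : species) (U : finType) : #|F U| = scount F #|U|.
Proof.
have [f _] := @bij_of_card U 'I_#|U| (esym (card_ord _)).
exact: bij_eq_card (relabel_bij F f).
Qed.

(* The quotient in [egf_coef] is parsed in [R_scope]: it is [Rdiv]. *)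
Lemma egf_coefE (F : species) n : egf_coef F n = (scount F n)%:R / n`!%:R.
Proof. exact: RdivE. Qed.

Lemma egf_coef_ge0 (F : species) n : 0 <= egf_coef F n.
Proof. by rewrite egf_coefE divr_ge0. Qed.

Lemma contact_egf p F G : contact p F G -> forall n, (n <= p)%N -> egf_coef F n = egf_coef G n.
Proof.
move=> [phi _] n np; rewrite !egf_coefE /scount; congr (_%:R / _).
by rewrite (bij_card (phi 'I_n _)) // card_ord.
Qed.

Lemma egf_zero n : egf_coef zero_species n = 0.
Proof. by rewrite egf_coefE /scount card_void mul0r. Qed.

Lemma egf_card k n : egf_coef (card_species k) n = (n == k)%:R / k`!%:R.
Proof.
rewrite !egf_coefE /scount /= card_sig card_ord.
case: eqP => [->|nk]; last by rewrite [X in X%:R]eq_card0 // !mul0r.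
by rewrite (_ : #|_| = 1%N) // -card_unit; apply: eq_card.
Qed.

Lemma egf_sum F G n : egf_coef (sum_species F G) n = egf_coef F n + egf_coef G n.
Proof. by rewrite !egf_coefE /scount /= card_sum natrD mulrDl. Qed.

Lemma card_setsub (T : finType) (A : {set T}) : #|{: {x | x \in A}}| = #|A|.
Proof. by rewrite card_sig; apply: eq_card => x; rewrite !inE. Qed.

Lemma card_tagged_sum (I : finType) (T_ : I -> finType) :
  #|{: {i : I & T_ i}}| = \sum_i #|T_ i|.
Proof. by rewrite card_tagged sumnE big_map big_enum. Qed.

Lemma egf_prod F G n : egf_coef (prod_species F G) n = seqmul (egf_coef F) (egf_coef G) n.
Proof.
rewrite !egf_coefE -(binomial_seqmul (fun k => (scount F k)%:R) (fun k => (scount G k)%:R)).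
congr (_ / _); rewrite [in LHS]/scount [in LHS]/= /prod_str card_tagged_sum natr_sum.
transitivity (\sum_(A : {set 'I_n} | A \subset [set: 'I_n]) (#|F {x | x \in A}| * #|G {x | x \in ~: A}|)%N%:R : R).
  by apply: eq_big => [A|A _]; rewrite ?subsetT // card_prod.
rewrite (sum_card_subset (f := fun k => (scount F k)%:R * (scount G (n - k))%:R)).
  by rewrite cardsT card_ord.
move=> A _; rewrite natrM !card_str !card_setsub; congr (_ * (scount G _)%:R).
by rewrite cardsCs setCK card_ord.
Qed.

Lemma card_subst F G (U : finType) :
  #|subst_species F G U| =
  (\sum_(P : {set {set U}} | partition P [set: U]) scount F #|P| * \prod_(B in P) scount G #|B|)%N.
Proof.
rewrite /= /subst_str card_tagged_sum.
rewrite (big_sub (fun P : {set {set U}} => partition P [set: U])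
  (fun P => (scount F #|P| * \prod_(B in P) scount G #|B|)%N)).
apply: eq_bigr => P _; rewrite card_prod card_str card_setsub; congr (_ * _)%N.
rewrite card_dep_ffun foldrE big_map big_enum /=.
rewrite (big_sub (mem (val P)) (fun B : {set U} => scount G #|B|)).
by apply: eq_bigr => B _; rewrite card_str card_setsub.
Qed.

(** Partitions are grouped by their number [k] of blocks, to which [part_sumE] applies; [no_size0 G]
    gives the weight 0 that it requires of empty blocks. *)
Lemma egf_subst F G n : no_size0 G ->
  egf_coef (subst_species F G) n = csub (egf_coef F) (egf_coef G) n.
Proof.
move=> G0; have g0 : scount G 0 = 0%N.
  by apply: eq_card0 => s; case: (G0 'I_0 _ s); rewrite card_ord.
rewrite !egf_coefE {1}/scount card_subst natr_sum.
have pn (P : {set {set 'I_n}}) : partition P [set: 'I_n] -> (#|P| <= n)%N.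
  move=> pP; rewrite -[X in (_ <= X)%N]card_ord -cardsT (card_partition pP) -sum1_card.
  by apply: leq_sum => B BP; rewrite card_gt0; apply/eqP => B0; move: BP pP; rewrite B0 => sP /and3P[_ _]; rewrite sP.
rewrite (partition_big (fun P : {set {set 'I_n}} => inord #|P| : 'I_n.+1) xpredT) //=.
rewrite big_distrl /=; apply: eq_bigr => k _.
have := part_sumE R g0 k [set: 'I_n]; rewrite cardsT card_ord => e.
rewrite (eq_bigl (fun P : {set {set 'I_n}} => partition P [set: 'I_n] && (#|P| == k))); last first.
  move=> P; case pP: (partition P _) => //=.
  by rewrite -val_eqE /= inordK // ltnS pn.
rewrite (eq_bigr (fun P : {set {set 'I_n}} =>
  (scount F k)%:R * (\prod_(B in P) scount G #|B|)%N%:R)); last first.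
  by move=> P /andP[_ /eqP->]; rewrite natrM.
rewrite -big_distrr -mulrA /= -natr_sum [_ / _]e.
by rewrite mulrCA [LHS]mulrC mulrAC.
Qed.

Lemma scount_lin n : scount lin_species n = n`!.
Proof.
rewrite /scount /= card_sig.
transitivity (#|@predT 'I_n| ^_ #|'I_n|)%N; last first.
  by rewrite (_ : #|predT| = #|'I_n|) ?card_ord ?ffactnn //; apply: eq_card.
rewrite -card_uniq_tuples.
by apply: eq_card => t; rewrite !inE all_predT.
Qed.

Lemma scount_set n : scount set_species n = 1%N.
Proof. exact: card_unit. Qed.

Section Cyclic.
Variables (U : finType) (x0 : U) (n : nat).
Hypothesis cardU : #|U| = n.+1.

Definition cyc_tuple (s : {perm U}) : n.-tuple U := 
  Tuple (introT eqP (size_traject s (s x0) n)).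

Lemma porbit_cyclic (s : {perm U}) : cyclic_perm s -> porbit s x0 = [set: U].
Proof.
case/existsP=> x /eqP e; rewrite -e; apply/eqP; rewrite eq_porbit_mem.
by rewrite e inE.
Qed.

Lemma traject_cyclic (s : {perm U}) : cyclic_perm s ->
  [/\ uniq (traject s x0 n.+1), traject s x0 n.+1 =i U & fcycle s (traject s x0 n.+1)].
Proof.
move=> /porbit_cyclic e; have c : #|porbit s x0| = n.+1 by rewrite e cardsT.
have u := uniq_traject_porbit s x0; rewrite c in u; split=> //.
  by move=> y; rewrite -c -porbit_traject e inE.
have it := iter_porbit s x0; rewrite c in it.
have -> : traject s x0 n.+1 = x0 :: traject s (s x0) n by [].
rewrite /= (_ : rcons _ _ = traject s (s x0) n.+1) ?fpath_traject //.
by rewrite trajectSr -iterSr it.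
Qed.

(* A cyclic permutation is the successor function of the cycle it describes,
   read from the starting point [x0]. *)
Lemma cyclic_next (t : n.-tuple U) : uniq (x0 :: t) ->
  exists2 s : {perm U}, cyclic_perm s & cyc_tuple s = t.
Proof.
move=> ut; have inj : injective (next (x0 :: t)) := can_inj (prev_next ut).
pose s := perm inj; have ct : fcycle s (x0 :: t).
  rewrite (eq_cycle (e' := frel (next (x0 :: t)))) ?cycle_next //.
  by move=> x y /=; rewrite permE.
move: (ct); rewrite /= rcons_path => /andP[/fpathE pt _].
exists s; last by apply: val_inj; rewrite /= [RHS]pt size_tuple.
apply/existsP; exists x0; apply/eqP/setP => y; rewrite inE.
have : y \in x0 :: t.
  suff /eqP/setP/(_ y) : [set x in x0 :: t] == [set: U] by rewrite !inE.
  by rewrite eqEcard subsetT cardsT cardU cardsE (card_uniqP ut) /= size_tuple.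
have -> : x0 :: t = traject s x0 n.+1 by rewrite /= [X in _ :: X]pt size_tuple.
by case/trajectP => i _ ->; rewrite -permX mem_porbit.
Qed.

(** A cycle is determined by the order in which it visits the points other than [x0]. *)
Lemma card_cyclic : #|[pred s : {perm U} | cyclic_perm s]| = n`!.
Proof.
transitivity (#|predC1 x0| ^_ n)%N; last by rewrite cardC1 cardU ffactnn.
rewrite -card_uniq_tuples -[LHS]cardsE.
rewrite -(card_in_imset (f := cyc_tuple)).
  apply: eq_card => t; rewrite !inE; apply/imsetP/idP.
    case=> s; rewrite inE => /traject_cyclic[us _ _ ->]; move: us; rewrite /=.
    case/andP=> n0 ->; rewrite andbT; apply/allP => y yt /=.
    by apply/negP => /eqP y0; move: n0; rewrite -{1}y0 yt.
  case/andP=> /allP n0 ut; have [|s cs st] := @cyclic_next t.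
    by rewrite /= ut andbT; apply/negP => /n0 /=; rewrite eqxx.
  by exists s; rewrite ?inE.
move=> s s'; rewrite !inE => cs cs' /(congr1 val) /= e; apply/permP => y.
have [us as_ fs] := traject_cyclic cs; have [us' as' fs'] := traject_cyclic cs'.
have y1 : y \in traject s x0 n.+1 by rewrite as_.
have y2 : y \in traject s' x0 n.+1 by rewrite as'.
have /eqP := next_cycle fs y1; have /eqP := next_cycle fs' y2.
by rewrite /= e => -> ->.
Qed.
End Cyclic.

Lemma scount_cyc n : scount cyc_species n = if n is m.+1 then m`! else 0%N.
Proof.
rewrite /scount /= card_sig; case: n => [|n]; last by apply: (@card_cyclic _ ord0); rewrite card_ord.
by apply: eq_card0 => s; rewrite !inE; apply/existsP => -[[]].
Qed.

Lemma egf_lin : egf_coef lin_species =1 @seq_coef R.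
Proof. by move=> k; rewrite egf_coefE scount_lin divff ?fact_neq0. Qed.

Lemma egf_set : egf_coef set_species =1 @set_coef R.
Proof. by move=> k; rewrite egf_coefE scount_set mul1r. Qed.

Lemma egf_cyc : egf_coef cyc_species =1 @cyc_coef R.
Proof.
move=> [|k]; rewrite egf_coefE scount_cyc /cyc_coef ?mul0r ?invr0 //.
by rewrite factS natrM invfM mulrCA mulfV ?mulr1 ?fact_neq0.
Qed.

End Counting.

From HB Require Import structures.
From mathcomp Require Import all_classical all_reals all_analysis.
Import numFieldNormedType.Exports.

(** * Partial sums with nonnegative coefficients *)

Section PartialSums.
Variable R : realType.
Implicit Types (a b phi : nat -> R) (x y t : R).

Definition nonneg a : Prop := forall n, 0 <= a n.

Definition psum a (M : nat) x : R := \sum_(n < M) a n * x ^+ n.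

Lemma psumS a M x : psum a M.+1 x = psum a M x + a M * x ^+ M.
Proof. by rewrite /psum big_ord_recr. Qed.

Lemma psum_ge0 a M x : nonneg a -> 0 <= x -> 0 <= psum a M x.
Proof. by move=> a0 x0; apply: sumr_ge0 => n _; rewrite mulr_ge0 ?exprn_ge0. Qed.

Lemma psum_leM a M N x : nonneg a -> 0 <= x -> (M <= N)%N -> psum a M x <= psum a N x.
Proof.
move=> a0 x0 /subnK <-; elim: (N - M)%N => // k IHk.
by rewrite addSn psumS; apply: le_trans IHk _; rewrite lerDl mulr_ge0 ?exprn_ge0.
Qed.

Lemma psum_le a M x y : nonneg a -> 0 <= x -> x <= y -> psum a M x <= psum a M y.
Proof.
move=> a0 x0 xy; apply: ler_sum => n _; apply: ler_wpM2l => //.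
by apply: lerXn2r => //; rewrite nnegrE //; apply: le_trans xy.
Qed.

Lemma psum_le_coef a b M x : 0 <= x -> (forall n, (n < M)%N -> a n <= b n) ->
  psum a M x <= psum b M x.
Proof. by move=> x0 ab; apply: ler_sum => n _; rewrite ler_wpM2r ?exprn_ge0 ?ab. Qed.

Lemma eq_psum a b M x : (forall n, (n < M)%N -> a n = b n) -> psum a M x = psum b M x.
Proof. by move=> ab; apply: eq_bigr => n _; rewrite ab. Qed.

Lemma seqmul_ge0 a b : nonneg a -> nonneg b -> nonneg (seqmul a b).
Proof. by move=> a0 b0 n; apply: sumr_ge0 => k _; rewrite mulr_ge0. Qed.

Lemma delta0_ge0 : nonneg (@delta0 R).
Proof. by move=> n; rewrite /delta0. Qed.

Lemma cpow_ge0 a k : nonneg a -> nonneg (cpow a k).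
Proof. by move=> a0; elim: k => [|k IHk] /=; [apply: delta0_ge0|apply: seqmul_ge0]. Qed.

Lemma csub_ge0 phi a : nonneg phi -> nonneg a -> nonneg (csub phi a).
Proof. by move=> p0 a0 n; apply: sumr_ge0 => k _; rewrite mulr_ge0 //; apply: cpow_ge0. Qed.

Lemma seqmul_le a a' b b' n : nonneg a -> nonneg b ->
  (forall k, a k <= a' k) -> (forall k, b k <= b' k) -> seqmul a b n <= seqmul a' b' n.
Proof. by move=> a0 b0 aa bb; apply: ler_sum => k _; apply: ler_pM. Qed.

Lemma cpow_le a a' k n : nonneg a -> (forall k, a k <= a' k) -> cpow a k n <= cpow a' k n.
Proof.
by move=> a0 aa; elim: k n => //= k IHk n; apply: seqmul_le => //; apply: cpow_ge0.
Qed.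

Lemma csub_le phi a a' n : nonneg phi -> nonneg a -> (forall k, a k <= a' k) ->
  csub phi a n <= csub phi a' n.
Proof. by move=> p0 a0 aa; apply: ler_sum => k _; rewrite ler_wpM2l ?cpow_le. Qed.

Lemma cpow1 a : cpow a 1 =1 a.
Proof.
move=> n; rewrite /= /seqmul big_ord_recr /= subnn mulr1 big1 ?add0r // => k _.
by rewrite /delta0 subn_eq0 leqNgt ltn_ord mulr0.
Qed.

Lemma cpow_small a k n : a 0%N = 0 -> (n < k)%N -> cpow a k n = 0.
Proof.
move=> a0; elim: k n => //= k IHk n nk; apply: big1 => -[[|j] /= jn] _.
  by rewrite a0 mul0r.
by rewrite IHk ?mulr0 //; apply: leq_ltn_trans (leq_sub2l _ (ltn0Sn j)) _; lia.
Qed.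

Let trunc a M := \poly_(n < M) a n.

Let trunc_horner a M x : (trunc a M).[x] = psum a M x.
Proof. exact: horner_poly. Qed.

Let truncM_horner a b M N x :
  psum a M x * psum b N x = \sum_(n < M + N) (trunc a M * trunc b N)`_n * x ^+ n.
Proof.
rewrite -!trunc_horner -hornerM; apply: horner_coef_wide.
apply: leq_trans (size_mul_leq _ _) (leq_trans (leq_pred _) _).
by apply: leq_add; apply: size_poly.
Qed.

(** The product of the truncated polynomials has degree below [M + N], and each of its coefficients
    is a part of the full convolution. *)
Lemma psum_seqmul_ge a b M N x : nonneg a -> nonneg b -> 0 <= x ->
  psum a M x * psum b N x <= psum (seqmul a b) (M + N) x.
Proof.
move=> a0 b0 x0; rewrite truncM_horner; apply: ler_sum => n _.
rewrite ler_wpM2r ?exprn_ge0 // coefM; apply: ler_sum => k _.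
by rewrite !coef_poly; apply: ler_pM; case: ifP.
Qed.

Lemma psum_seqmul_le a b M x : nonneg a -> nonneg b -> 0 <= x ->
  psum (seqmul a b) M x <= psum a M x * psum b M x.
Proof.
move=> a0 b0 x0; rewrite truncM_horner big_split_ord /= -[leLHS]addr0.
apply: lerD.
  apply: ler_sum => n _; rewrite ler_wpM2r ?exprn_ge0 // coefM.
  apply: ler_sum => k _; have kn : (k <= n)%N by rewrite -ltnS.
  by rewrite !coef_poly !ifT // (leq_ltn_trans _ (ltn_ord n)) // leq_subr.
apply: sumr_ge0 => n _; rewrite mulr_ge0 ?exprn_ge0 // coefM.
by apply: sumr_ge0 => k _; rewrite !coef_poly mulr_ge0 //; case: ifP.
Qed.

Lemma psum_cpow_le a k M x : nonneg a -> 0 <= x -> psum (cpow a k) M x <= psum a M x ^+ k.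
Proof.
move=> a0 x0; elim: k => [|k IHk].
  case: M => [|M]; first by rewrite /psum big_ord0.
  by rewrite /psum big_ord_recl /= mulr1 big1 ?addr0 // => i _; rewrite mul0r.
rewrite exprS; apply: le_trans (psum_seqmul_le _ _ _ _) _ => //; first exact: cpow_ge0.
by rewrite ler_wpM2l // psum_ge0.
Qed.

Lemma psum_csub_le phi a M x : nonneg phi -> nonneg a -> 0 <= x ->
  psum (csub phi a) M x <= psum phi M (psum a M x).
Proof.
move=> p0 a0 x0.
have : psum (csub phi a) M x <= \sum_(k < M) phi k * psum (cpow a k) M x.
  rewrite /psum; under [leRHS]eq_bigr do rewrite big_distrr.
  rewrite exchange_big; apply: ler_sum => n _ /=.
  rewrite /csub big_distrl /= (big_ord_widen _ (fun k => phi k * cpow a k n * x ^+ n) (ltn_ord n)).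
  rewrite big_mkcond; apply: ler_sum => k _; rewrite mulrA; case: ifP => // _.
  by rewrite !mulr_ge0 ?exprn_ge0 //; apply: cpow_ge0.
move=> h; apply: le_trans h _; apply: ler_sum => k _.
by rewrite ler_wpM2l // psum_cpow_le.
Qed.

(** [K] and [M] are independent: the terms with [k > n], which [csub] leaves out, vanish because
    [a 0 = 0]. *)
Lemma psum_csub_ge phi a K M x : nonneg phi -> nonneg a -> a 0%N = 0 -> 0 <= x ->
  \sum_(k < K) phi k * psum (cpow a k) M x <= psum (csub phi a) M x.
Proof.
move=> p0 a0 a00 x0; rewrite /psum; under eq_bigr do rewrite big_distrr.
rewrite exchange_big; apply: ler_sum => n _ /=.
under eq_bigr do rewrite mulrA; rewrite -big_distrl ler_wpM2r ?exprn_ge0 //=.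
have h k : 0 <= phi k * cpow a k n by rewrite mulr_ge0 //; apply: cpow_ge0.
have := big_ord_widen_cond _ xpredT (fun k => phi k * cpow a k n) (leq_maxl K n.+1).
move=> ->; have := big_ord_widen_cond _ xpredT (fun k => phi k * cpow a k n) (leq_maxr K n.+1).
rewrite /csub => ->; rewrite big_mkcond [leRHS]big_mkcond; apply: ler_sum => k _ /=.
have [kn|nk] := ltnP k n.+1; first by case: ifP.
by rewrite cpow_small // mulr0; case: ifP.
Qed.

Lemma csub_ge_arg phi a n : nonneg phi -> phi 1%N = 1 -> nonneg a -> a 0%N = 0 ->
  a n <= csub phi a n.
Proof.
move=> p0 p1 a0 a00; case: n => [|n]; first by rewrite a00; apply: csub_ge0.
rewrite /csub (bigD1 (Ordinal (isT : (1 < n.+2)%N))) //= p1 mul1r.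
rewrite [X in X + _](_ : _ = a n.+1) ?lerDl; last exact: cpow1.
by apply: sumr_ge0 => k _; rewrite mulr_ge0 //; apply: cpow_ge0.
Qed.

Section Value.
Local Open Scope classical_set_scope.

Definition pfin a x : Prop := exists y, forall M, psum a M x <= y.

(** For nonnegative terms this is the sum of the series; it is meaningful only under [pfin], as the
    supremum of an unbounded set is a default value. *)
Definition psup a x : R := sup [set y | exists M, y = psum a M x].

Lemma psup_le a x y : (forall M, psum a M x <= y) -> psup a x <= y.
Proof.
move=> h; apply: ge_sup; first by exists (psum a 0 x); exists 0%N.
by move=> _ [M ->].
Qed.

Lemma psup_ub a M x : pfin a x -> psum a M x <= psup a x.
Proof.
move=> [y h]; apply: ub_le_sup; last by exists M.
by exists y => _ [N ->].
Qed.
End Value.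

Lemma psup_ge0 a x : pfin a x -> 0 <= psup a x.
Proof. by move=> /(psup_ub 0); rewrite /psum big_ord0. Qed.

Lemma eq_psup a b x : a =1 b -> psup a x = psup b x.
Proof. by move/funext->. Qed.

Lemma pfin_le a b x : 0 <= x -> (forall n, a n <= b n) -> pfin b x -> pfin a x.
Proof.
move=> x0 ab [y h]; exists y => M; apply: le_trans (h M).
exact: psum_le_coef.
Qed.

Lemma pfin_lex a x y : nonneg a -> 0 <= x -> x <= y -> pfin a y -> pfin a x.
Proof. by move=> a0 x0 xy [z h]; exists z => M; apply: le_trans (h M); apply: psum_le. Qed.

Lemma psup_lex a x y : nonneg a -> 0 <= x -> x <= y -> pfin a y -> psup a x <= psup a y.
Proof.
move=> a0 x0 xy fy; apply: psup_le => M; apply: le_trans (psup_ub M fy).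
exact: psum_le.
Qed.

Lemma le_sup_mul a x c y : 0 <= c -> 0 <= y -> (forall M, psum a M x * c <= y) ->
  psup a x * c <= y.
Proof.
rewrite le_eqVlt => /predU1P[<-|c0] y0 h; first by rewrite mulr0.
by rewrite -ler_pdivlMr //; apply: psup_le => M; rewrite ler_pdivlMr.
Qed.

Lemma pfin_seqmul a b x : nonneg a -> nonneg b -> 0 <= x -> pfin a x -> pfin b x -> pfin (seqmul a b) x.
Proof.
move=> a0 b0 x0 fa fb; exists (psup a x * psup b x) => M.
apply: le_trans (psum_seqmul_le _ _ _ _) _ => //.
by apply: ler_pM; rewrite ?psum_ge0 ?psup_ub.
Qed.

Lemma psup_seqmul a b x : nonneg a -> nonneg b -> 0 <= x -> pfin a x -> pfin b x ->
  psup (seqmul a b) x = psup a x * psup b x.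
Proof.
move=> a0 b0 x0 fa fb; apply/eqP; rewrite eq_le; apply/andP; split.
  apply: psup_le => M; apply: le_trans (psum_seqmul_le _ _ _ _) _ => //.
  by apply: ler_pM; rewrite ?psum_ge0 ?psup_ub.
have fc := pfin_seqmul a0 b0 x0 fa fb.
apply: le_sup_mul => [||M]; rewrite ?psup_ge0 //.
rewrite mulrC; apply: le_sup_mul => [||N]; rewrite ?psum_ge0 ?psup_ge0 //.
by rewrite mulrC; apply: le_trans (psum_seqmul_ge _ _ _ _ _) (psup_ub _ fc).
Qed.

Lemma psum_gt0 b n x : nonneg b -> 0 < b n -> 0 < x -> 0 < psum b n.+1 x.
Proof.
move=> b0 bn x0; rewrite psumS ltr_wpDl ?psum_ge0 ?(ltW x0) //.
by rewrite mulr_gt0 ?exprn_gt0.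
Qed.

(** A positive coefficient gives the other factor a positive partial sum, by which the bound on the
    product can be divided. *)
Lemma pfin_seqmul_l a b n x : nonneg a -> nonneg b -> 0 < b n -> 0 < x ->
  pfin (seqmul a b) x -> pfin a x.
Proof.
move=> a0 b0 bn x0 [y h]; have p0 := psum_gt0 b0 bn x0.
exists (y / psum b n.+1 x) => M; rewrite ler_pdivlMr //.
by apply: le_trans (h (M + n.+1)%N); apply: psum_seqmul_ge => //; apply: ltW.
Qed.

Lemma pfin_seqmul_r a b n x : nonneg a -> nonneg b -> 0 < a n -> 0 < x ->
  pfin (seqmul a b) x -> pfin b x.
Proof.
move=> a0 b0 an x0 [y h]; have p0 := psum_gt0 a0 an x0.
exists (y / psum a n.+1 x) => M; rewrite ler_pdivlMr // mulrC.
by apply: le_trans (h (n.+1 + M)%N); apply: psum_seqmul_ge => //; apply: ltW.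
Qed.

Lemma psumD a b M x : psum (fun n => a n + b n) M x = psum a M x + psum b M x.
Proof. by rewrite /psum -big_split; apply: eq_bigr => n _; rewrite mulrDl. Qed.

Lemma pfinD a b x : pfin a x -> pfin b x -> pfin (fun n => a n + b n) x.
Proof. by move=> [y h] [z k]; exists (y + z) => M; rewrite psumD lerD. Qed.

Lemma psupD a b x : nonneg a -> nonneg b -> 0 <= x -> pfin a x -> pfin b x ->
  psup (fun n => a n + b n) x = psup a x + psup b x.
Proof.
move=> a0 b0 x0 fa fb; have fc := pfinD fa fb.
apply/eqP; rewrite eq_le; apply/andP; split.
  by apply: psup_le => M; rewrite psumD lerD ?psup_ub.
rewrite -lerBrDr; apply: psup_le => M; rewrite lerBrDr addrC -lerBrDr.
apply: psup_le => N; rewrite lerBrDr.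
apply: le_trans (psup_ub (maxn M N) fc); rewrite psumD addrC.
by apply: lerD; apply: psum_leM; rewrite ?leq_maxl ?leq_maxr.
Qed.

Lemma psup_gt0 b n x : nonneg b -> 0 < b n -> 0 < x -> pfin b x -> 0 < psup b x.
Proof. by move=> b0 bn x0 fb; apply: lt_le_trans (psum_gt0 b0 bn x0) (psup_ub _ fb). Qed.

Lemma psup_cpow a k x : nonneg a -> 0 <= x -> pfin a x ->
  pfin (cpow a k) x /\ psup (cpow a k) x = psup a x ^+ k.
Proof.
move=> a0 x0 fa; elim: k => [|k [fk vk]].
  have d M : psum (cpow a 0) M.+1 x = 1.
    by rewrite /psum big_ord_recl /= mulr1 big1 ?addr0 // => i _; rewrite mul0r.
  have d' M : psum (cpow a 0) M x <= 1 by case: M => [|M]; rewrite ?d // /psum big_ord0.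
  have f : pfin (cpow a 0) x by exists 1.
  split=> //; apply/eqP; rewrite eq_le psup_le //=.
  by have := psup_ub 1 f; rewrite d.
have c0 := cpow_ge0 k a0; split; first exact: pfin_seqmul.
by rewrite exprS -vk; apply: psup_seqmul.
Qed.

(** For fixed [K] the inner series is summed completely first, since a finite combination of powers
    of [a] has the expected value. Hence a convergent composition bounds the partial sums of [phi]
    at the full value of [a]; for [Seq] and [Cyc] this forces that value below 1. *)
Lemma psum_csub_psup phi a K x y : nonneg phi -> nonneg a -> a 0%N = 0 -> 0 <= x ->
  pfin a x -> (forall M, psum (csub phi a) M x <= y) -> psum phi K (psup a x) <= y.
Proof.
move=> p0 a0 a00 x0 fa h.
have [fb vb] : pfin (fun n => \sum_(k < K) phi k * cpow a k n) x /\
    psup (fun n => \sum_(k < K) phi k * cpow a k n) x = psum phi K (psup a x).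
  elim: K => [|K [fK vK]].
    have -> : (fun n => \sum_(k < 0) phi k * cpow a k n) = fun=> 0 by apply: funext => n; rewrite big_ord0.
    have z M : psum (fun=> 0) M x = 0 by rewrite /psum big1 // => i _; rewrite mul0r.
    split; first by exists 0 => M; rewrite z.
    rewrite [RHS]big_ord0; apply/eqP; rewrite eq_le psup_ge0 ?andbT.
      by apply: psup_le => M; rewrite z.
    by exists 0 => M; rewrite z.
  have -> : (fun n => \sum_(k < K.+1) phi k * cpow a k n) =
      fun n => \sum_(k < K) phi k * cpow a k n + phi K * cpow a K n.
    by apply: funext => n; rewrite big_ord_recr.
  have [fc vc] := psup_cpow K a0 x0 fa.
  have sc M : psum (fun n => phi K * cpow a K n) M x = phi K * psum (cpow a K) M x.
    by rewrite /psum big_distrr; apply: eq_bigr => n _; rewrite /= mulrA.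
  have fs : pfin (fun n => phi K * cpow a K n) x.
    by exists (phi K * psup (cpow a K) x) => M; rewrite sc ler_wpM2l ?psup_ub.
  split; first exact: pfinD.
  rewrite psupD //; last first.
  - by move=> n; rewrite mulr_ge0 //; apply: cpow_ge0.
  - by move=> n; apply: sumr_ge0 => k _; rewrite mulr_ge0 //; apply: cpow_ge0.
  rewrite vK psumS -vc; congr (_ + _); apply/eqP; rewrite eq_le; apply/andP; split.
    by apply: psup_le => M; rewrite sc ler_wpM2l ?psup_ub.
  rewrite mulrC; apply: le_sup_mul; rewrite ?psup_ge0 // => M.
  by rewrite mulrC -sc psup_ub.
rewrite -vb; apply: psup_le => M; apply: le_trans (h M).
apply: le_trans (psum_csub_ge K M p0 a0 a00 x0).
rewrite /psum; under [leRHS]eq_bigr do rewrite big_distrr.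
rewrite exchange_big; apply: ler_sum => n _ /=; rewrite big_distrl.
by apply: ler_sum => k _; rewrite mulrA.
Qed.

Lemma psup_csub_le phi a x : nonneg phi -> nonneg a -> 0 <= x -> pfin a x ->
  forall M, psum (csub phi a) M x <= psum phi M (psup a x).
Proof.
move=> p0 a0 x0 fa M; apply: le_trans (psum_csub_le _ _ _ _) _ => //.
by apply: psum_le; rewrite ?psum_ge0 ?psup_ub.
Qed.

End PartialSums.

(** * Exponential and logarithm *)

Section ExpLog.
Variable R : realType.
Implicit Types (t x y z : R).

Lemma seq_coef_ge0 : nonneg (@seq_coef R). Proof. by []. Qed.
Lemma cyc_coef_ge0 : nonneg (@cyc_coef R). Proof. by move=> n; rewrite invr_ge0. Qed.
Lemma set_coef_ge0 : nonneg (@set_coef R). Proof. by move=> n; rewrite invr_ge0. Qed.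

Lemma psum_seqE K t : psum (@seq_coef R) K t * (1 - t) = 1 - t ^+ K.
Proof.
elim: K => [|K IHK]; first by rewrite /psum big_ord0 mul0r subrr.
by rewrite psumS mulrDl IHK /seq_coef exprS; ring.
Qed.

Lemma psum_seq_le K t : 0 <= t -> t < 1 -> psum (@seq_coef R) K t * (1 - t) <= 1.
Proof. by move=> t0 t1; rewrite psum_seqE gerBl exprn_ge0. Qed.

Lemma archi_le x y : (forall n : nat, n%:R * x <= y) -> x <= 0.
Proof.
move=> h; rewrite leNgt; apply/negP => x0.
have y0 : 0 <= y by have := h 0%N; rewrite mul0r.
have := archi_boundP (divr_ge0 y0 (ltW x0)).
by rewrite ltr_pdivrMr // ltNge h.
Qed.

(** As [n * t ^+ n] is at most a geometric sum, [n * x] stays below [y / (1 - t)] for all [n]. *)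
Lemma le_expr_bound x y t : 0 <= t -> t < 1 -> (forall K : nat, x <= y * t ^+ K) -> x <= 0.
Proof.
move=> t0 t1 h.
have y0 : 0 <= y \/ x <= 0.
  by have := h 0%N; rewrite mulr1; case: (lerP 0 y) => [|yn]; [left|right; lra].
case: y0 => // y0; apply: (@archi_le _ (y / (1 - t))) => n.
rewrite ler_pdivlMr ?subr_gt0 //.
have ht : n%:R * t ^+ n <= psum (@seq_coef R) n t.
  rewrite -[X in X%:R]card_ord -sumr_const mulr_suml /psum; apply: ler_sum => i _.
  by rewrite /seq_coef ler_wpM2l // ler_wiXn2l // ?(ltW t1) // ltnW.
have hs := psum_seq_le n t0 t1; have hn := h n.
apply: (@le_trans _ _ (n%:R * (y * t ^+ n) * (1 - t))).
  by rewrite ler_wpM2r ?subr_ge0 ?(ltW t1) // ler_wpM2l.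
rewrite mulrCA -mulrA -[leRHS]mulr1 ler_wpM2l // (le_trans _ hs) //.
by rewrite ler_wpM2r ?subr_ge0 ?(ltW t1).
Qed.

Lemma psum_seq_bound t y : 0 <= t -> (forall K, psum (@seq_coef R) K t <= y) ->
  t < 1 /\ 1 <= y * (1 - t).
Proof.
move=> t0 h; have t1 : t < 1.
  rewrite ltNge; apply/negP => t1.
  suff : (1 : R) <= 0 by rewrite ler10.
  apply: (@archi_le _ y) => n; rewrite mulr1; apply: le_trans (h n).
  rewrite -[X in X%:R]card_ord -sumr_const /psum; apply: ler_sum => i _.
  by rewrite mul1r exprn_ege1.
split=> //; rewrite -subr_le0; apply: (@le_expr_bound _ 1 t) => // K; rewrite mul1r.
have := h K; rewrite -(ler_pM2r (_ : 0 < 1 - t)) ?subr_gt0 // psum_seqE; lra.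
Qed.

Lemma psum_set_le K t : 0 <= t -> psum (@set_coef R) K t <= expR t.
Proof.
move=> t0; have -> : psum (@set_coef R) K t = series (exp_coeff t) K.
  by rewrite /psum /series /= big_mkord; apply: eq_bigr => i _; rewrite /set_coef /exp_coeff mulrC.
rewrite /expR; apply: (nondecreasing_cvgn_le _ (is_cvg_series_exp_coeff t)).
by apply: nondecreasing_series => n _ _; apply: exp_coeff_ge0.
Qed.

Lemma psum_set_bound t y : (forall K, psum (@set_coef R) K t <= y) -> expR t <= y.
Proof.
move=> h; apply: (limr_le (is_cvg_series_exp_coeff t)); near=> K.
apply: le_trans (h K).
by rewrite /psum /series /= big_mkord; apply: ler_sum => i _; rewrite /set_coef /exp_coeff mulrC.
Unshelve. all: by end_near. Qed.

Lemma is_derive_psum_cyc K x :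
  is_derive x 1 (psum (@cyc_coef R) K.+1) (psum (@seq_coef R) K x).
Proof.
elim: K => [|K IHK].
  rewrite {2}/psum big_ord0; have -> : psum (@cyc_coef R) 1 = cst 0.
    by apply: funext => y; rewrite psumS /psum big_ord0 /cyc_coef invr0 mul0r addr0.
  exact: is_derive_cst.
have -> : psum (@cyc_coef R) K.+2 =
    (fun y => psum (@cyc_coef R) K.+1 y + cyc_coef R K.+1 * y ^+ K.+1).
  by apply: funext => y; rewrite psumS.
have d : is_derive x 1 (fun y : R => y ^+ K.+1) (K.+1%:R * x ^+ K).
  by apply: DeriveDef; [exact: exprn_derivable|rewrite exp_derive -[_ *: 1]/(_ * 1) mulr1].
have := is_deriveD IHK (is_deriveZ (cyc_coef R K.+1) d).
rewrite psumS (_ : seq_coef R K * _ = cyc_coef R K.+1 *: (K.+1%:R * x ^+ K)) //.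
by rewrite /cyc_coef /seq_coef /GRing.scale /= mulrA mulVf ?pnatr_eq0.
Qed.

(** With [S] the truncated logarithmic series, [exp(S(s)) * (1 - s)] is 1 at 0 and has derivative
    [- exp(S(s)) * s ^ K]. The mean value theorem then gives both bounds. *)
Lemma psum_cyc_exp K t : 0 <= t -> t < 1 ->
  1 - expR (psum (@cyc_coef R) K.+1 t) * t ^+ K <= expR (psum (@cyc_coef R) K.+1 t) * (1 - t) <= 1.
Proof.
move=> t0 t1.
pose f s := expR (psum (@cyc_coef R) K.+1 s) * (1 - s).
pose df s := - (expR (psum (@cyc_coef R) K.+1 s) * s ^+ K).
have dfE (s : R) : is_derive s 1 f (df s).
  have d1 := is_derive_psum_cyc K s.
  have d2 := is_derive1_comp (is_derive_expR (psum (@cyc_coef R) K.+1 s)) d1.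
  have d3 : is_derive s 1 (fun s : R => 1 - s) (- 1) 
    by have := is_deriveB (is_derive_cst (1 : R) s (1 : R)) (is_derive_id s (1 : R)); rewrite sub0r.
  have := is_deriveM d2 d3; rewrite /GRing.scale /=.
  rewrite (_ : _ + _ = df s) // /df.
  have := psum_seqE K s; set A := psum (@seq_coef R) K s; set E := expR _ => e.
  by rewrite -[s ^+ K]opprK -[- s ^+ K](addKr 1) -e; ring.
have [|c] := @MVT_segment R f df 0 t t0 (fun s _ => dfE s).
  by apply: derivable_within_continuous => s _; apply: ex_derive.
rewrite in_itv /= => /andP[c0 ct].
have -> : f 0 = 1.
  rewrite /f /psum big1 ?expR0 ?subr0 ?mulr1 // => -[[|i] hi] _ /=.
    by rewrite /cyc_coef invr0 mul0r.
  by rewrite expr0n mulr0.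
rewrite subr0 -/(f t) /df => e.
have E0 := expR_gt0 (psum (@cyc_coef R) K.+1 c).
have cK : 0 <= c ^+ K by rewrite exprn_ge0.
have h : expR (psum (@cyc_coef R) K.+1 c) * c ^+ K * t <= expR (psum (@cyc_coef R) K.+1 t) * t ^+ K.
  rewrite -[leRHS]mulr1; apply: ler_pM => //; rewrite ?(ltW t1) ?mulr_ge0 ?(ltW E0) //.
  apply: ler_pM; rewrite ?expR_ge0 //.
    by rewrite ler_expR; apply: psum_le => //; apply: cyc_coef_ge0.
  by apply: lerXn2r => //; rewrite nnegrE.
have h0 : 0 <= expR (psum (@cyc_coef R) K.+1 c) * c ^+ K * t by rewrite !mulr_ge0 // ltW.
by apply/andP; split; lra.
Qed.

Lemma psum_cyc_le K t : 0 <= t -> t < 1 -> expR (psum (@cyc_coef R) K t) * (1 - t) <= 1.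
Proof.
move=> t0 t1; case: K => [|K]; last by have /andP[] := psum_cyc_exp K t0 t1.
by rewrite /psum big_ord0 expR0 mul1r; lra.
Qed.

Lemma psum_cyc_bound t y : 0 <= t -> (forall K, psum (@cyc_coef R) K t <= y) ->
  t < 1 /\ 1 <= expR y * (1 - t).
Proof.
move=> t0 h; have y0 : 0 <= y by have := h 0%N; rewrite /psum big_ord0.
have key s : 0 <= s -> s < 1 -> s <= t -> 1 <= expR y * (1 - s).
  move=> s0 s1 st; rewrite -subr_le0; apply: (@le_expr_bound _ (expR y) s) => // K.
  have /andP[h1 _] := psum_cyc_exp K s0 s1.
  have h2 : expR (psum (@cyc_coef R) K.+1 s) <= expR y.
    rewrite ler_expR; apply: le_trans (h K.+1); apply: psum_le => //; exact: cyc_coef_ge0.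
  have h3 : expR (psum (@cyc_coef R) K.+1 s) * (s ^+ K) <= expR y * s ^+ K.
    by rewrite ler_wpM2r ?exprn_ge0.
  have h4 : expR (psum (@cyc_coef R) K.+1 s) * (1 - s) <= expR y * (1 - s).
    by rewrite ler_wpM2r // subr_ge0 ltW.
  lra.
suff t1 : t < 1 by split=> //; apply: key.
rewrite ltNge; apply/negP => t1.
have e0 := expR_gt0 (- y); have e1 : expR (- y) <= 1 by rewrite expR_le1; lra.
(* At this point, just below 1, the bound [key] would read [1 <= 1 / 2]. *)
have := key (1 - expR (- y) / 2); rewrite opprB addrCA subrr addr0 mulrA -expRD subrr expR0.
by move=> /(_ _ _ _); lra.
Qed.

Lemma expo_le z (q : nat) : (0 < q)%N -> 0 <= 1 + z / q%:R -> (1 + z / q%:R) ^+ q <= expR z.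
Proof.
move=> q0 h; have -> : expR z = expR (z / q%:R) ^+ q.
  by rewrite -expRM_natl mulrC divfK // pnatr_eq0 -lt0n.
by apply: lerXn2r; rewrite ?nnegrE ?expR_ge0 ?expR_ge1Dx.
Qed.

(** Since [1 + z / q >= exp(z / (q + z))], the power is at least [exp z * (1 - z ^ 2 / (q + z))].
    Any strict inequality with an exponential can thus be certified with exponent [q] once [q] is
    large. *)
Lemma expo_lim c z : c < expR z ->
  exists Q : nat, forall q, (Q <= q)%N -> [/\ (0 < q)%N, 0 < 1 + z / q%:R & c <= (1 + z / q%:R) ^+ q].
Proof.
move=> cz; have d0 : 0 < expR z - c by rewrite subr_gt0.
(* [B < q] makes [q + z] positive and larger than [expR z * z ^+ 2 / (expR z - c)]. *)
pose B := `|z| + 1 + expR z * z ^+ 2 / (expR z - c).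
have e0 := expR_gt0 z.
have s0 : 0 <= expR z * z ^+ 2 / (expR z - c).
  by rewrite divr_ge0 ?(ltW d0) // mulr_ge0 ?sqr_ge0 ?(ltW e0).
have B0 : 0 <= B by rewrite /B !addr_ge0.
exists (Num.bound B) => q qB.
have hq : B < q%:R by apply: lt_le_trans (archi_boundP B0) _; rewrite ler_nat.
have q0 : 0 < q%:R :> R by apply: le_lt_trans hq.
have nz := ler_norm z; have nz' := ler_norm (- z); rewrite normrN in nz'.
have qz : 0 < q%:R + z by rewrite /B in hq; lra.
have e1 : 1 + z / q%:R = (q%:R + z) / q%:R by field; rewrite gt_eqF.
have p1 : 0 < 1 + z / q%:R by rewrite e1 divr_gt0.
split=> //; first by rewrite -(ltr0n R).
have h1 : expR (z / (q%:R + z)) <= 1 + z / q%:R.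
  have h := expR_ge1Dx (- (z / (q%:R + z))).
  have e2 : 1 - z / (q%:R + z) = q%:R / (q%:R + z) by field; rewrite gt_eqF.
  have : expR (z / (q%:R + z)) * (q%:R / (q%:R + z)) <= 1.
    by rewrite -[leRHS](expRxMexpNx_1 (z / (q%:R + z))) -e2 ler_wpM2l ?expR_ge0.
  by rewrite mulrA ler_pdivrMr // mul1r e1 ler_pdivlMr.
have h2 : expR (z - z ^+ 2 / (q%:R + z)) <= (1 + z / q%:R) ^+ q.
  have -> : z - z ^+ 2 / (q%:R + z) = q%:R * (z / (q%:R + z)) by field; rewrite gt_eqF.
  by rewrite expRM_natl; apply: lerXn2r; rewrite ?nnegrE ?expR_ge0 ?(ltW p1).
apply: le_trans h2; rewrite expRD.
have h3 := expR_ge1Dx (- (z ^+ 2 / (q%:R + z))).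
apply: (@le_trans _ _ (expR z * (1 - z ^+ 2 / (q%:R + z)))); last by rewrite ler_wpM2l ?expR_ge0.
rewrite mulrBr mulr1 lerBrDr -lerBrDl mulrA ler_pdivrMr // [leRHS]mulrC -ler_pdivrMr //.
by rewrite /B in hq; lra.
Qed.

End ExpLog.

(** * The system on subexpressions *)

HB.instance Definition _ (m : nat) := gen_eqMixin (expr m).

Section Nodes.
Variables (m : nat) (H : specification m).
Implicit Types e f g : expr m.

Definition arg e f : Prop :=
  match e with
  | EOne | EAtom => False
  | EVar j => f = H j
  | ESum a b | EProd a b => f = a \/ f = b
  | ESeq a | ECyc a | ESet a => f = a
  end.

Inductive reach e : expr m -> Prop :=
  | reach_refl : reach e e
  | reach_step f g : reach e f -> arg f g -> reach e g.

Lemma reach_trans e f g : reach e f -> reach f g -> reach e g.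
Proof. by move=> ef; elim=> // h k _ eh; apply: reach_step. Qed.

Lemma reach_closed (Q : expr m -> Prop) f g :
  (forall f h, arg f h -> Q h -> Q f) -> reach f g -> Q g -> Q f.
Proof. by move=> step; elim=> // h k _ IH hk Qk; apply: IH; apply: step hk Qk. Qed.

Fixpoint subs e : seq (expr m) :=
  e :: match e with
       | EOne | EAtom | EVar _ => [::]
       | ESum a b | EProd a b => subs a ++ subs b
       | ESeq a | ECyc a | ESet a => subs a
       end.

(** Paths of [reach] unfold variables while [subs] does not; collecting the variables and the
    subexpressions of all right-hand sides gives a finite list closed under [arg]. *)
Definition nodes : seq (expr m) :=
  [seq EVar j | j <- enum 'I_m] ++ flatten [seq subs (H j) | j <- enum 'I_m].

Lemma subs_refl e : e \in subs e.
Proof. by case: e => *; rewrite inE eqxx. Qed.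

Lemma subs_trans e f g : f \in subs e -> g \in subs f -> g \in subs e.
Proof.
elim: e => [||j|a IHa b IHb|a IHa b IHb|a IHa|a IHa|a IHa]; rewrite /= in_cons;
  case/predU1P=> [-> //|] //=; rewrite ?mem_cat => hf hg.
- rewrite inE mem_cat; case/orP: hf => hf; first by rewrite (IHa hf hg) orbT.
  by rewrite (IHb hf hg) !orbT.
- rewrite inE mem_cat; case/orP: hf => hf; first by rewrite (IHa hf hg) orbT.
  by rewrite (IHb hf hg) !orbT.
- by rewrite inE (IHa hf hg) orbT.
- by rewrite inE (IHa hf hg) orbT.
- by rewrite inE (IHa hf hg) orbT.
Qed.

Lemma nodes_var j : EVar j \in nodes.
Proof. by rewrite mem_cat map_f ?mem_enum. Qed.

Lemma nodes_subs j e : e \in subs (H j) -> e \in nodes.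
Proof.
move=> ej; rewrite mem_cat; apply/orP; right; apply/flattenP; exists (subs (H j)) => //.
by apply/mapP; exists j; rewrite ?mem_enum.
Qed.

Lemma nodesP e : e \in nodes -> (exists j, e = EVar j) \/ (exists j, e \in subs (H j)).
Proof.
rewrite mem_cat => /orP[/mapP[j _ ->]|/flattenP[s /mapP[j _ ->] es]]; first by left; exists j.
by right; exists j.
Qed.

Lemma nodes_arg e f : e \in nodes -> arg e f -> f \in nodes.
Proof.
move=> /nodesP[[j ->] -> |[j ej] ef]; first exact/nodes_subs/subs_refl.
case: e ej ef => [||k|a b|a b|a|a|a] //= ej.
- by move=> ->; apply/nodes_subs/subs_refl.
- by case=> ->; apply: (nodes_subs (subs_trans ej _)); rewrite inE mem_cat subs_refl ?orbT.
- by case=> ->; apply: (nodes_subs (subs_trans ej _)); rewrite inE mem_cat subs_refl ?orbT.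
- by move=> ->; apply: (nodes_subs (subs_trans ej _)); rewrite inE subs_refl orbT.
- by move=> ->; apply: (nodes_subs (subs_trans ej _)); rewrite inE subs_refl orbT.
- by move=> ->; apply: (nodes_subs (subs_trans ej _)); rewrite inE subs_refl orbT.
Qed.

Lemma nodes_reach e f : e \in nodes -> reach e f -> f \in nodes.
Proof. by move=> en; elim=> // g h _ gn gh; apply: nodes_arg gh. Qed.

Section Evaluation.
Variable R : realType.

Fixpoint cexpr (c : 'I_m -> nat -> R) e : nat -> R :=
  match e with
  | EOne => @delta0 R
  | EAtom => fun n => (n == 1)%N%:R
  | EVar j => c j
  | ESum a b => fun n => cexpr c a n + cexpr c b n
  | EProd a b => seqmul (cexpr c a) (cexpr c b)
  | ESeq a => csub (@seq_coef R) (cexpr c a)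
  | ECyc a => csub (@cyc_coef R) (cexpr c a)
  | ESet a => csub (@set_coef R) (cexpr c a)
  end.

Fixpoint citer (N : nat) : 'I_m -> nat -> R :=
  if N is N'.+1 then fun j => cexpr (citer N') (H j) else fun _ _ => 0.

Lemma eq_cexpr c c' p : (forall j k, (k <= p)%N -> c j k = c' j k) ->
  forall e k, (k <= p)%N -> cexpr c e k = cexpr c' e k.
Proof.
move=> cc; elim=> [||j|a IHa b IHb|a IHa b IHb|a IHa|a IHa|a IHa] k kp //=.
- exact: cc.
- by rewrite IHa ?IHb.
- by apply: eq_seqmul => n nk; rewrite ?IHa ?IHb // (leq_trans nk).
- by apply: eq_csub => n nk; rewrite IHa // (leq_trans nk).
- by apply: eq_csub => n nk; rewrite IHa // (leq_trans nk).
- by apply: eq_csub => n nk; rewrite IHa // (leq_trans nk).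
Qed.

Lemma cexpr_ge0 c e : (forall j, nonneg (c j)) -> nonneg (cexpr c e).
Proof.
move=> c0; elim: e => [||j|a IHa b IHb|a IHa b IHb|a IHa|a IHa|a IHa] //=.
- by move=> n; rewrite addr_ge0.
- exact: seqmul_ge0.
- exact: csub_ge0.
- by apply: csub_ge0 => //; apply: cyc_coef_ge0.
- by apply: csub_ge0 => //; apply: set_coef_ge0.
Qed.

Lemma citer_ge0 N j : nonneg (citer N j).
Proof. by elim: N j => [|N IHN] j //=; apply: cexpr_ge0. Qed.

(** Outside this domain the inverse and the logarithm in [opval] do not represent the sums of the
    series, so bounds on [opval] come together with [opdom]. *)
Definition opdom (u : expr m -> R) e : Prop :=
  match e with ESeq a | ECyc a => u a < 1 | _ => True end.

Definition opval (x : R) (u : expr m -> R) e : R :=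
  match e with
  | EOne => 1
  | EAtom => x
  | EVar j => u (H j)
  | ESum a b => u a + u b
  | EProd a b => u a * u b
  | ESeq a => (1 - u a)^-1
  | ECyc a => - ln (1 - u a)
  | ESet a => expR (u a)
  end.

Lemma ln_ler (x y : R) : 0 < x -> x <= y -> ln x <= ln y.
Proof. by move=> x0 xy; rewrite ler_ln ?posrE // (lt_le_trans x0). Qed.

Lemma opval_le x x' u u' e : x <= x' ->
  (forall f, arg e f -> 0 <= u f <= u' f) -> opdom u' e ->
  opdom u e /\ opval x u e <= opval x' u' e.
Proof.
move=> xx; case: e => [||j|a b|a b|a|a|a] //= h.
- by move=> _; split=> //; have /andP[] := h _ erefl.
- by move=> _; split=> //; have /andP[] := h _ (or_introl erefl);
    have /andP[] := h _ (or_intror erefl) => *; apply: lerD.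
- by move=> _; split=> //; have /andP[] := h _ (or_introl erefl);
    have /andP[] := h _ (or_intror erefl) => *; apply: ler_pM.
- have /andP[a0 aa] := h _ erefl; move=> a1; split; first exact: le_lt_trans a1.
  by rewrite lef_pV2 ?posrE; lra.
- have /andP[a0 aa] := h _ erefl; move=> a1; split; first exact: le_lt_trans a1.
  by rewrite lerN2 ln_ler; lra.
- by move=> _; have /andP[a0 aa] := h _ erefl; rewrite ler_expR.
Qed.

Lemma opval_lt x u u' e f :
  (forall f, arg e f -> 0 < u f <= u' f) -> opdom u' e -> arg e f -> u f < u' f ->
  opval x u e < opval x u' e.
Proof.
case: e => [||j|a b|a b|a|a|a] //= h.
- by move=> _ ->.
- have /andP[_ aa] := h _ (or_introl erefl); have /andP[_ bb] := h _ (or_intror erefl).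
  by move=> _ [->|->] hf; lra.
- have /andP[a0 aa] := h _ (or_introl erefl); have /andP[b0 bb] := h _ (or_intror erefl).
  by move=> _ [->|->] hf; nra.
- by move=> d -> hf; rewrite ltf_pV2 ?posrE; lra.
- by move=> d -> hf; rewrite ltrN2 ltr_ln ?posrE; lra.
- by move=> _ -> hf; rewrite ltr_expR.
Qed.

Lemma opval_gt0 x u e : 0 < x -> (forall f, arg e f -> 0 < u f) -> opdom u e -> 0 < opval x u e.
Proof.
move=> x0; case: e => [||j|a b|a b|a|a|a] //= h.
- by move=> _; apply: h.
- by move=> _; rewrite addr_gt0 ?h //; [left|right].
- by move=> _; rewrite mulr_gt0 ?h //; [left|right].
- by move=> d; rewrite invr_gt0 subr_gt0.
- move=> d; rewrite oppr_gt0 ln_lt0 //; have := h _ erefl; lra.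
- by move=> _; rewrite expR_gt0.
Qed.

Lemma eq_opval x u u' e : (forall f, arg e f -> u f = u' f) -> opval x u e = opval x u' e.
Proof.
case: e => [||j|a b|a b|a|a|a] //= h; rewrite ?h //; by [left|right].
Qed.

Lemma psum_delta k M x : 0 <= x -> psum (fun n => (n == k)%N%:R : R) M x <= x ^+ k.
Proof.
move=> x0; rewrite /psum; have [kM|Mk] := ltnP k M.
  rewrite (bigD1 (Ordinal kM)) //= eqxx mul1r big1 ?addr0 // => i.
  by rewrite -val_eqE => /negPf -> ; rewrite mul0r.
by rewrite big1 ?exprn_ge0 // => i _; rewrite (ltn_eqF (leq_trans (ltn_ord i) Mk)) mul0r.
Qed.

Lemma psum0 M x : psum (fun _ => 0 : R) M x = 0.
Proof. by rewrite /psum big1 // => i _; rewrite mul0r. Qed.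

Lemma psum_cyc_ln K t : 0 <= t -> t < 1 -> psum (@cyc_coef R) K t <= - ln (1 - t).
Proof.
move=> t0 t1; have u0 : 0 < 1 - t by rewrite subr_gt0.
rewrite -ler_expR expRN lnK ?posrE // -[_^-1]mul1r ler_pdivlMr //.
exact: psum_cyc_le.
Qed.

Lemma psum_cexpr_le (c : 'I_m -> nat -> R) (P : expr m -> Prop) x (u : expr m -> R) :
  (forall j, nonneg (c j)) -> 0 <= x -> (forall e f, P e -> arg e f -> P f) ->
  (forall e, P e -> opdom u e /\ opval x u e <= u e) ->
  (forall j M, P (EVar j) -> psum (c j) M x <= u (EVar j)) ->
  forall e M, P e -> psum (cexpr c e) M x <= u e.
Proof.
move=> c0 x0 Parg Pu Pc.
have A0 e := cexpr_ge0 e c0.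
elim=> [||j|a IHa b IHb|a IHa b IHb|a IHa|a IHa|a IHa] M Pe; have [du vu] := Pu _ Pe;
  try exact: Pc; apply: le_trans vu; rewrite /=; rewrite /= in du.
- exact: (psum_delta 0%N M x0).
- exact: (psum_delta 1%N M x0).
- have Pa := Parg _ _ Pe (or_introl erefl); have Pb := Parg _ _ Pe (or_intror erefl).
  by rewrite psumD lerD ?IHa ?IHb.
- have Pa := Parg _ _ Pe (or_introl erefl); have Pb := Parg _ _ Pe (or_intror erefl).
  apply: le_trans (psum_seqmul_le M _ _ x0) _ => //.
  by apply: ler_pM; rewrite ?psum_ge0 ?IHa ?IHb.
all: have Pa := Parg _ _ Pe erefl; have ha := IHa M Pa.
all: have a0 : 0 <= psum (cexpr c a) M x by apply: psum_ge0.
- apply: le_trans (psum_csub_le M _ _ x0) _ => //.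
  have h : psum (cexpr c a) M x < 1 by apply: le_lt_trans du.
  apply: (@le_trans _ _ (1 - psum (cexpr c a) M x)^-1); last by rewrite lef_pV2 ?posrE; lra.
  by rewrite -[leRHS]mul1r ler_pdivlMr ?psum_seq_le // subr_gt0.
- apply: le_trans (psum_csub_le M (@cyc_coef_ge0 R) _ x0) _ => //.
  have h : psum (cexpr c a) M x < 1 by apply: le_lt_trans du.
  by apply: le_trans (psum_cyc_ln _ _ _) _ => //; rewrite lerN2 ln_ler; lra.
- apply: le_trans (psum_csub_le M (@set_coef_ge0 R) _ x0) _ => //.
  by apply: le_trans (psum_set_le _ _) _ => //; rewrite ler_expR.
Qed.

(** A point that the monotone operator maps below itself bounds all iterates from 0: induction on
    [N] handles the variables, and [psum_cexpr_le] extends the bound to compound expressions. *)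
Lemma psum_citer_le (P : expr m -> Prop) x (u : expr m -> R) :
  0 <= x -> (forall e f, P e -> arg e f -> P f) ->
  (forall e, P e -> [/\ 0 <= u e, opdom u e & opval x u e <= u e]) ->
  forall N e M, P e -> psum (cexpr (citer N) e) M x <= u e.
Proof.
move=> x0 Parg Pu.
have Pu' e : P e -> opdom u e /\ opval x u e <= u e by case/Pu.
elim=> [|N IHN] e M Pe; apply: (psum_cexpr_le (P := P)) => //.
- by move=> j n; apply: citer_ge0.
- by move=> j K /Pu[u0 _ _]; rewrite psum0.
- by move=> j; apply: cexpr_ge0 => k; apply: citer_ge0.
- move=> j K Pj; have [_ _ /=] := Pu _ Pj; apply: le_trans.
  by apply: IHN; apply: Parg Pj _.
Qed.

Section Limit.
Variable c : 'I_m -> nat -> R.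
Hypothesis citer_lim : forall p, exists N, forall N', (N <= N')%N ->
  forall j k, (k <= p)%N -> citer N' j k = c j k.
Hypothesis no_size0_arg : forall e, e \in nodes ->
  match e with ESeq a | ECyc a | ESet a => cexpr c a 0%N = 0 | _ => True end.
Hypothesis c_neq0 : forall j, exists n, 0 < c j n.

Local Notation A := (cexpr c).

Lemma cexpr_lim p : exists N, forall N', (N <= N')%N ->
  forall e k, (k <= p)%N -> cexpr (citer N') e k = A e k.
Proof. by have [N hN] := citer_lim p; exists N => N' NN' e k kp; apply: eq_cexpr (hN N' NN') _ _ kp. Qed.

Lemma c_ge0 j : nonneg (c j).
Proof. by move=> n; have [N /(_ N (leqnn N) j n (leqnn n)) <-] := citer_lim n; apply: citer_ge0. Qed.

Lemma limit_ge0 e : nonneg (A e). Proof. exact: cexpr_ge0 c_ge0. Qed.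

Lemma limit_var j : A (EVar j) =1 A (H j).
Proof.
move=> n; have [N hN] := cexpr_lim n.
by rewrite -(hN N (leqnn N) (H j)) // -(hN N.+1 (leqnSn N) (EVar j)).
Qed.

Lemma psum_lim e M x : exists N, psum (A e) M x = psum (cexpr (citer N) e) M x.
Proof.
have [N hN] := cexpr_lim M; exists N; apply: eq_psum => n nM.
by rewrite hN // ltnW.
Qed.

Lemma limit_neq0 e : e \in nodes -> exists n, 0 < A e n.
Proof.
have h0 phi a : nonneg phi -> nonneg a -> phi 0%N = 1 -> 0 < csub phi a 0%N :> R.
  by move=> _ _ p0; rewrite /csub big_ord_recl big_ord0 p0 mulr1 addr0.
elim: e => [||j|a IHa b IHb|a IHa b IHb|a IHa|a IHa|a IHa] en.
- by exists 0%N.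
- by exists 1%N.
- exact: c_neq0.
- have [|n an] := IHa; first by apply: nodes_arg en _; left.
  by exists n; rewrite /= ltr_pwDl // limit_ge0.
- have [|i ai] := IHa; first by apply: nodes_arg en _; left.
  have [|j bj] := IHb; first by apply: nodes_arg en _; right.
  exists (i + j)%N; rewrite /= /seqmul.
  have ij : (i < (i + j).+1)%N by rewrite ltnS leq_addr.
  rewrite (bigD1 (Ordinal ij)) //= addKn ltr_pwDl ?mulr_gt0 //.
  by apply: sumr_ge0 => k _; rewrite mulr_ge0 ?limit_ge0.
- by exists 0%N; apply: h0 => //; apply: limit_ge0.
- have [|n an] := IHa; first exact: nodes_arg en _.
  exists n; apply: lt_le_trans an _.
  apply: (csub_ge_arg n (@cyc_coef_ge0 R) _ (limit_ge0 a) (no_size0_arg en)).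
  by rewrite /cyc_coef invr1.
- by exists 0%N; apply: h0; [apply: set_coef_ge0|apply: limit_ge0|rewrite /set_coef invr1].
Qed.

Definition finite_value e x : Prop := pfin (A e) x.
Definition value x e : R := psup (A e) x.
Local Notation F := finite_value.
Local Notation V := value.

(** For a product this rests on zero-freeness: a vanishing factor could hide the divergence of the
    other one. *)
Lemma finite_arg e f x : 0 < x -> e \in nodes -> arg e f -> F e x -> F f x.
Proof.
move=> x0 en; have nf := nodes_arg en; have ns := no_size0_arg en.
have x0' := ltW x0.
case: e en nf ns => [||j|a b|a b|a|a|a] //= en nf ns.
- by move=> ->; apply: pfin_le => // n; rewrite -limit_var.
- by case=> ->; apply: pfin_le => // n /=; rewrite ?lerDl ?lerDr limit_ge0.
- case=> ->.
    by have [n bn] := limit_neq0 (nf b (or_intror erefl)); apply: pfin_seqmul_l bn x0; apply: limit_ge0.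
  by have [n an] := limit_neq0 (nf a (or_introl erefl)); apply: pfin_seqmul_r an x0; apply: limit_ge0.
all: move=> ->; apply: pfin_le => // n.
- exact: (csub_ge_arg n (@seq_coef_ge0 R) erefl (limit_ge0 a) ns).
- by apply: (csub_ge_arg n (@cyc_coef_ge0 R) _ (limit_ge0 a) ns); rewrite /cyc_coef invr1.
- by apply: (csub_ge_arg n (@set_coef_ge0 R) _ (limit_ge0 a) ns); rewrite /set_coef invr1.
Qed.

Lemma finite_reach e f x : 0 < x -> e \in nodes -> reach e f -> F e x -> F f x.
Proof.
move=> x0 en; elim=> // g h eg IH gh Fe; apply: finite_arg gh (IH Fe) => //.
exact: nodes_reach eg.
Qed.

Lemma finite_one x : 0 <= x -> F EOne x.
Proof. by move=> x0; exists 1 => M; exact: (psum_delta 0%N M x0). Qed.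

Lemma finite_atom x : 0 <= x -> F EAtom x.
Proof. by move=> x0; exists x => M; exact: (psum_delta 1%N M x0). Qed.

(** The exponential series is entire, so only [Seq] and [Cyc] can diverge where their arguments
    converge. *)
Lemma finite_op e x : 0 <= x -> (forall f, arg e f -> F f x) ->
  match e with ESeq _ | ECyc _ => False | _ => True end -> F e x.
Proof.
move=> x0; case: e => [||j|a b|a b|a|a|a] //= h _.
- exact: finite_one.
- exact: finite_atom.
- by apply: pfin_le (h _ erefl) => // n; rewrite limit_var.
- by apply: pfinD; apply: h; [left|right].
- by apply: pfin_seqmul => //; try exact: limit_ge0; apply: h; [left|right].
- exists (expR (V x a)) => M; have Fa := h _ erefl.
  apply: le_trans (psup_csub_le (@set_coef_ge0 R) (limit_ge0 a) x0 Fa M) _.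
  by apply: psum_set_le; apply: psup_ge0.
Qed.

Lemma value_ge0 e x : F e x -> 0 <= V x e.
Proof. exact: psup_ge0. Qed.

Lemma value_gt0 e x : e \in nodes -> 0 < x -> F e x -> 0 < V x e.
Proof. by move=> /limit_neq0[n an] x0; apply: psup_gt0 an x0; apply: limit_ge0. Qed.

(** The domain condition is a conclusion: bounded partial sums of [Seq] or [Cyc] force the argument
    strictly below 1, by [psum_csub_psup]. *)
Lemma value_eq e x : e \in nodes -> 0 < x -> F e x -> opdom (V x) e /\ V x e = opval x (V x) e.
Proof.
move=> en x0 Fe; have Fa f (ef : arg e f) : F f x by apply: finite_arg ef Fe.
have x0' := ltW x0; have ns := no_size0_arg en.
case: e en Fe Fa ns => [||j|a b|a b|a|a|a] //= en Fe Fa ns.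
- split=> //; apply/eqP; rewrite eq_le psup_le => [/=|M]; last exact: (psum_delta 0%N M x0').
  by apply: le_trans (psup_ub 1 Fe); rewrite /psum big_ord1 mulr1.
- split=> //; apply/eqP; rewrite eq_le psup_le => [/=|M]; last exact: (psum_delta 1%N M x0').
  apply: le_trans (psup_ub 2 Fe); rewrite /psum !big_ord_recl big_ord0 /= /bump /=.
  by rewrite mul0r add0r addr0 mul1r expr1.
- by split=> //; apply: eq_psup; apply: limit_var.
- by split=> //; apply: psupD => //; try exact: limit_ge0; apply: Fa; [left|right].
- by split=> //; apply: psup_seqmul => //; try exact: limit_ge0; apply: Fa; [left|right].
all: have fa := Fa _ erefl; have a0 := value_ge0 fa.
- have h K := psum_csub_psup K (@seq_coef_ge0 R) (limit_ge0 a) ns x0' fa (fun M => psup_ub M Fe).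
  have [d hd] := psum_seq_bound a0 h; split=> //; have d' : 0 < 1 - V x a by rewrite subr_gt0.
  apply/eqP; rewrite eq_le; apply/andP; split.
    apply: psup_le => M; apply: le_trans (psup_csub_le (@seq_coef_ge0 R) (limit_ge0 a) x0' fa M) _.
    by rewrite -[leRHS]mul1r ler_pdivlMr ?psum_seq_le.
  by rewrite -[leLHS]mul1r ler_pdivrMr.
- have h K := psum_csub_psup K (@cyc_coef_ge0 R) (limit_ge0 a) ns x0' fa (fun M => psup_ub M Fe).
  have [d hd] := psum_cyc_bound a0 h; split=> //; have d' : 0 < 1 - V x a by rewrite subr_gt0.
  apply/eqP; rewrite eq_le; apply/andP; split.
    apply: psup_le => M; apply: le_trans (psup_csub_le (@cyc_coef_ge0 R) (limit_ge0 a) x0' fa M) _.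
    exact: psum_cyc_ln.
  by rewrite -ler_expR expRN lnK ?posrE // -[leLHS]mul1r ler_pdivrMr.
- have h K := psum_csub_psup K (@set_coef_ge0 R) (limit_ge0 a) ns x0' fa (fun M => psup_ub M Fe).
  split=> //; apply/eqP; rewrite eq_le (psum_set_bound h) andbT.
  apply: psup_le => M; apply: le_trans (psup_csub_le (@set_coef_ge0 R) (limit_ge0 a) x0' fa M) _.
  exact: psum_set_le.
Qed.

Lemma finite_super (P : expr m -> Prop) x (u : expr m -> R) :
  0 <= x -> (forall e f, P e -> arg e f -> P f) ->
  (forall e, P e -> [/\ 0 <= u e, opdom u e & opval x u e <= u e]) ->
  forall e, P e -> F e x /\ V x e <= u e.
Proof.
move=> x0 Parg Pu e Pe.
have h M : psum (A e) M x <= u e.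
  by have [N ->] := psum_lim e M x; apply: psum_citer_le Pe.
by split; [exists (u e)|apply: psup_le].
Qed.

Lemma value_le e x y : 0 <= x -> x <= y -> F e y -> V x e <= V y e.
Proof. by move=> x0 xy Fy; apply: psup_lex => //; apply: limit_ge0. Qed.

Lemma finite_le e x y : 0 <= x -> x <= y -> F e y -> F e x.
Proof. by move=> x0 xy; apply: pfin_lex => //; apply: limit_ge0. Qed.

End Limit.
End Evaluation.
End Nodes.

(** * Growth at the dominant singularity *)

Section Uniform.
Variables (R : realType) (T : eqType).

Lemma uniform_seq (s : seq T) (P : T -> Prop) (Q : T -> R -> Prop) :
  (forall e, e \in s -> P e -> exists2 c, 0 < c & Q e c) ->
  (forall e c c', 0 < c' -> c' <= c -> Q e c -> Q e c') ->
  exists2 c, 0 < c & forall e, e \in s -> P e -> Q e c.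
Proof.
move=> PQ mono; elim: s PQ => [|e s IHs] PQ; first by exists 1.
have [|c c0 hc] := IHs; first by move=> f fs; apply: PQ; rewrite inE fs orbT.
have [Pe|nPe] := pselect (P e).
  have [d d0 hd] := PQ e (mem_head _ _) Pe.
  have m0 : 0 < Num.min c d by rewrite lt_min c0.
  exists (Num.min c d) => // f; rewrite inE => /predU1P[->|fs] Pf.
    by apply: mono hd => //; rewrite ge_min lexx orbT.
  by apply: mono (hc f fs Pf) => //; rewrite ge_min lexx.
by exists c => // f; rewrite inE => /predU1P[->|fs] // Pf; apply: hc.
Qed.

Lemma exists_max (s : seq T) (P : T -> Prop) (h : T -> R) e :
  e \in s -> P e -> exists2 f, P f & forall g, g \in s -> P g -> h g <= h f.
Proof.
elim: s e => // a s IHs e; rewrite inE => es Pe.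
have [[f fs Pf]|n] := pselect (exists2 f, f \in s & P f).
  have [k Pk hk] := IHs f fs Pf.
  have [Pa|nPa] := pselect (P a); last first.
    by exists k => // g; rewrite inE => /predU1P[->|gs] // Pg; apply: hk.
  have [ak|ka] := lerP (h a) (h k).
    by exists k => // g; rewrite inE => /predU1P[->|gs] // Pg; apply: hk.
  exists a => // g; rewrite inE => /predU1P[->|gs] // Pg.
  by apply: le_trans (hk _ gs Pg) (ltW ka).
exists e => // g; rewrite inE => gs Pg.
case/predU1P: es => [ea|es]; last by case: n; exists e.
by case/predU1P: gs => [->|gs]; [rewrite ea|case: n; exists g].
Qed.

Lemma count_lt (s : seq T) (P Q : pred T) e :
  (forall f, P f -> Q f) -> e \in s -> Q e -> ~~ P e -> (count P s < count Q s)%N.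
Proof.
move=> PQ; elim: s => // a s IHs; rewrite inE => /predU1P[<-|es] Qe nPe /=.
  by rewrite Qe (negPf nPe) add0n add1n ltnS; apply: sub_count.
have h : (P a <= Q a)%N by case: (P a) (PQ a) => // ->.
by rewrite -addnS leq_add // IHs.
Qed.

Lemma le_lt_lim (x r v w : R) : x < r -> (forall y, x < y -> y < r -> v * y <= w) -> v * r <= w.
Proof.
move=> xr h; rewrite leNgt; apply/negP => wv.
have [v0|v0] := lerP v 0.
  have := h ((x + r) / 2); rewrite midf_lt // => h'; have := h' _ _.
  have : v * r <= v * ((x + r) / 2) by apply: ler_wnM2l => //; lra.
  by have := h' ltac:(lra) ltac:(lra); lra.
have wr : w / v < r by rewrite ltr_pdivrMr // mulrC.
pose y := Num.max ((x + r) / 2) ((w / v + r) / 2).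
have yr : y < r by rewrite gt_max; apply/andP; split; lra.
have xy : x < y by rewrite lt_max; apply/orP; left; lra.
have wy : w / v < y by rewrite lt_max; apply/orP; right; lra.
by have := h y xy yr; rewrite leNgt mulrC -ltr_pdivrMr // wy.
Qed.

End Uniform.

Section PowerSeries.
Variable R : realType.
Implicit Types (a : nat -> R) (x y : R).

Lemma psup_scale a x y : nonneg a -> a 0%N = 0 -> 0 < x -> x <= y -> pfin a y ->
  psup a x * y <= x * psup a y.
Proof.
move=> a0 a00 x0 xy fy; have y0 : 0 < y by apply: lt_le_trans xy.
rewrite -ler_pdivlMr //; apply: psup_le => M; rewrite ler_pdivlMr //.
apply: (@le_trans _ _ (x * psum a M y)); last by rewrite ler_wpM2l ?(ltW x0) ?psup_ub.
rewrite /psum mulr_suml mulr_sumr; apply: ler_sum => -[[|n] /= _] _.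
  by rewrite a00 !mul0r mulr0.
have h1 : x ^+ n <= y ^+ n by apply: lerXn2r => //; rewrite nnegrE ltW.
have h2 : a n.+1 * x * y * x ^+ n <= a n.+1 * x * y * y ^+ n.
  by rewrite ler_wpM2l // !mulr_ge0 // ltW.
by rewrite !exprS; lra.
Qed.

(** The term of index [n.+1] alone grows by at least [a n.+1 * x0 ^+ n * (y - x)], and the other
    terms do not decrease. *)
Lemma psup_incr a n x0 : nonneg a -> 0 < a n.+1 -> 0 < x0 ->
  exists2 c, 0 < c & forall x y, x0 <= x -> x <= y -> pfin a y ->
    c * (y - x) <= psup a y - psup a x.
Proof.
move=> a0 an x00; exists (a n.+1 * x0 ^+ n); first by rewrite mulr_gt0 ?exprn_gt0.
move=> x y xx xy fy; have hx : 0 <= x by apply: le_trans xx; apply: ltW.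
rewrite lerBrDr addrC -lerBrDr; apply: psup_le => M; rewrite lerBrDr.
apply: le_trans (psup_ub (M + n.+2) fy).
apply: (@le_trans _ _ (psum a (M + n.+2) x + a n.+1 * x0 ^+ n * (y - x))).
  by rewrite lerD2r psum_leM // leq_addr.
rewrite addrC -lerBrDr /psum -sumrB.
have nM : (n.+1 < M + n.+2)%N by lia.
rewrite (bigD1 (Ordinal nM)) //= -[leLHS]addr0 lerD //; last first.
  apply: sumr_ge0 => k _; rewrite -mulrBr mulr_ge0 // subr_ge0.
  by apply: lerXn2r => //; rewrite nnegrE // (le_trans hx).
rewrite -mulrBr -mulrA ler_wpM2l // !exprS.
have h1 : x0 ^+ n <= x ^+ n by apply: lerXn2r => //; rewrite nnegrE // ltW.
have h2 : x ^+ n <= y ^+ n by apply: lerXn2r => //; rewrite nnegrE // (le_trans hx).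
have h3 : 0 <= x0 ^+ n by rewrite exprn_ge0 // ltW.
have y0 : 0 <= y by lra.
have h4 : y * x ^+ n <= y * y ^+ n by rewrite ler_wpM2l.
have h5 : (y - x) * x0 ^+ n <= (y - x) * x ^+ n by rewrite ler_wpM2l // subr_ge0.
by rewrite mulrBl in h5; lra.
Qed.

Lemma psup_const a x : nonneg a -> 0 <= x -> (forall n, a n.+1 = 0) -> psup a x = a 0%N.
Proof.
move=> a0 x0 an; have e M : psum a M.+1 x = a 0%N.
  rewrite /psum big_ord_recl /= mulr1 big1 ?addr0 // => i _.
  by rewrite an mul0r.
have h M : psum a M x <= a 0%N by case: M => [|M]; rewrite ?e // /psum big_ord0.
apply/eqP; rewrite eq_le psup_le //= -(e 0%N); apply: psup_ub; by exists (a 0%N).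
Qed.
End PowerSeries.

Section Growth.
Variables (m : nat) (H : specification m) (R : realType) (c : 'I_m -> nat -> R).
Hypothesis citer_lim : forall p, exists N, forall N', (N <= N')%N ->
  forall j k, (k <= p)%N -> citer H R N' j k = c j k.
Hypothesis no_size0_arg : forall e, e \in nodes H ->
  match e with ESeq a | ECyc a | ESet a => cexpr c a 0%N = 0 | _ => True end.
Hypothesis c_neq0 : forall j, exists n, 0 < c j n.
Hypothesis c_nat : forall j, exists k : nat, c j 0%N = k%:R.
Variables (i : 'I_m) (rho : R).
Hypothesis rho0 : 0 < rho.
Hypothesis F_lt : forall x, 0 < x -> x < rho -> finite_value c (EVar i) x.
Hypothesis F_gt : forall x, rho < x -> ~ finite_value c (EVar i) x.

Local Notation A := (cexpr c).
Local Notation F := (finite_value c).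
Local Notation V := (value c).
Local Notation arg := (arg H).
Local Notation reach := (reach H).
Local Notation nodes := (nodes H).
Local Notation W := (reach (EVar i)).

Let A0 e : nonneg (A e) := limit_ge0 citer_lim e.

(** Integrality serves twice: a positive constant factor is at least 1, and the value of an
    expression without atoms is an exact multiple of [1 / q]. *)
Lemma limit0_nat e : e \in nodes -> exists k : nat, A e 0%N = k%:R.
Proof.
have sub0 phi e' : csub phi e' 0%N = phi 0%N :> R.
  by rewrite /csub big_ord_recl big_ord0 addr0 mulr1.
elim: e => [||j|a IHa b IHb|a IHa b IHb|a _|a _|a _] en.
- by exists 1%N.
- by exists 0%N.
- exact: c_nat.
- have [k ka] := IHa (nodes_arg en (or_introl erefl)).
  have [l lb] := IHb (nodes_arg en (or_intror erefl)).
  by exists (k + l)%N; rewrite /= ka lb natrD.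
- have [k ka] := IHa (nodes_arg en (or_introl erefl)).
  have [l lb] := IHb (nodes_arg en (or_intror erefl)).
  by exists (k * l)%N; rewrite /= /seqmul big_ord_recl big_ord0 addr0 /= ka lb natrM.
- by exists 1%N; rewrite /= sub0.
- by exists 0%N; rewrite /= sub0 /cyc_coef invr0.
- by exists 1%N; rewrite /= sub0 /set_coef invr1.
Qed.

Let W_node e : W e -> e \in nodes. Proof. exact/nodes_reach/nodes_var. Qed.

Let W_arg e f : W e -> arg e f -> W f. Proof. exact: reach_step. Qed.

Let W_F e x : W e -> 0 < x -> x < rho -> F e x.
Proof.
move=> We x0 xr; apply: (finite_reach citer_lim no_size0_arg c_neq0 x0 _ We); first exact: nodes_var.
exact: F_lt.
Qed.

Let Veq e x : W e -> 0 < x -> x < rho -> opdom (V x) e /\ V x e = opval H x (V x) e.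
Proof. by move=> We x0 xr; apply: value_eq => //; [apply: W_node|apply: W_F]. Qed.

Let Vgt0 e x : W e -> 0 < x -> x < rho -> 0 < V x e.
Proof. by move=> We x0 xr; apply: (value_gt0 citer_lim no_size0_arg c_neq0) => //; [apply: W_node|apply: W_F]. Qed.

Let Vle e x y : W e -> 0 < x -> x <= y -> y < rho -> V x e <= V y e.
Proof.
move=> We x0 xy yr; apply: (value_le citer_lim) => //; first exact: ltW.
by apply: W_F => //; apply: lt_le_trans xy.
Qed.

(** By [W_F] every reachable expression converges below [rho], so these are the ones of radius
    exactly [rho]. *)
Definition diverging e : Prop := W e /\ forall x, rho < x -> ~ F e x.
Local Notation D := diverging.

Lemma diverging_parent e f : W e -> arg e f -> D f -> D e.
Proof.
move=> We ef [_ nF]; split=> // x rx Fe; apply: (nF x rx).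
by apply: (finite_arg citer_lim no_size0_arg c_neq0 _ (W_node We) ef Fe); apply: lt_trans rx.
Qed.

Definition pole_bound e : Prop :=
  exists C, forall x, 0 < x -> x < rho -> V x e * (rho - x) <= C.

(* As [A a 0 = 0], the quotient [V x a / x] increases with [x], and it is at most
   [1 / y] for each [y < rho]. *)
Lemma arg_bound_inv a x : W (ESeq a) \/ W (ECyc a) -> 0 < x -> x < rho ->
  V x a < 1 /\ rho - x <= rho * (1 - V x a).
Proof.
move=> We x0 xr.
have [Wa ns] : W a /\ A a 0%N = 0.
  by case: We => We; split; try exact: W_arg We _; apply: (no_size0_arg (W_node We)).
have lt1 y : 0 < y -> y < rho -> V y a < 1.
  by move=> y0 yr; case: We => We; have [] := Veq We y0 yr.
split; first exact: lt1.
suff : V x a * rho <= x by lra.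
apply: (le_lt_lim xr) => y xy yr; have y0 : 0 < y by apply: lt_trans xy.
apply: le_trans (psup_scale (A0 a) ns x0 (ltW xy) (W_F Wa y0 yr)) _.
by rewrite -[leRHS]mulr1 ler_wpM2l ?(ltW x0) // ltW // lt1.
Qed.

Lemma pole_bound_seq a : W (ESeq a) -> pole_bound (ESeq a).
Proof.
move=> We; exists rho => x x0 xr; have [d1 d2] := arg_bound_inv (or_introl We) x0 xr.
have [_ ->] := Veq We x0 xr; rewrite /= mulrC ler_pdivrMr //; lra.
Qed.

Lemma lnN_le (u : R) : 0 < u -> - ln u <= u^-1.
Proof.
move=> u0; rewrite -lnV ?posrE //; have u1 : 0 < u^-1 by rewrite invr_gt0.
rewrite -ler_expR lnK ?posrE //; have := expR_ge1Dx (u^-1); lra.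
Qed.

(** The crude bound [- ln u <= u^-1] reduces the logarithm to the case of [Seq]. *)
Lemma pole_bound_cyc a : W (ECyc a) -> pole_bound (ECyc a).
Proof.
move=> We; exists rho => x x0 xr; have [d1 d2] := arg_bound_inv (or_intror We) x0 xr.
have [_ ->] := Veq We x0 xr; rewrite /=.
have d3 : 0 < 1 - V x a by lra.
apply: (@le_trans _ _ ((1 - V x a)^-1 * (rho - x))); last by rewrite mulrC ler_pdivrMr.
by rewrite ler_wpM2r ?lnN_le //; lra.
Qed.

(** Any fixed point between 0 and [rho] would do: on its right, positive values are bounded below by
    their value at [x0]. *)
Let x0 := rho / 2.
Let x00 : 0 < x0. Proof. by rewrite divr_gt0. Qed.
Let x0r : x0 < rho. Proof. by rewrite ltr_pdivrMr // ltr_pMr // ltr1n. Qed.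

(** Every operator dominates its arguments up to a constant; for a product this constant is the
    value at [x0] of the other factor. Along paths the constants multiply, so the values within a
    strongly connected class are all comparable. *)
Lemma arg_ge e f : W e -> arg e f ->
  exists2 d, 0 < d & forall x, x0 <= x -> x < rho -> d * V x f <= V x e.
Proof.
move=> We ef; have Wf := W_arg We ef.
have E x : x0 <= x -> x < rho -> opdom (V x) e /\ V x e = opval H x (V x) e.
  by move=> xx xr; apply: Veq => //; apply: lt_le_trans xx.
have P g x : W g -> x0 <= x -> x < rho -> 0 < V x g.
  by move=> Wg xx xr; apply: Vgt0 => //; apply: lt_le_trans xx.
case: e We ef E => [||j|a b|a b|a|a|a] //= We ef E.
- by exists 1 => // x xx xr; have [_ ->] := E x xx xr; rewrite mul1r ef.
- have Wa := W_arg We (or_introl erefl); have Wb := W_arg We (or_intror erefl).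
  exists 1 => // x xx xr; have [_ ->] := E x xx xr; rewrite mul1r.
  by have := P _ _ Wa xx xr; have := P _ _ Wb xx xr; case: ef => ->; lra.
- have Wa := W_arg We (or_introl erefl); have Wb := W_arg We (or_intror erefl).
  case: ef => ->.
    exists (V x0 b) => [|x xx xr]; first exact: Vgt0.
    have [_ ->] := E x xx xr; rewrite mulrC ler_wpM2l ?(ltW (P _ _ _ _ _)) //.
    exact: Vle.
  exists (V x0 a) => [|x xx xr]; first exact: Vgt0.
  have [_ ->] := E x xx xr; rewrite ler_wpM2r ?(ltW (P _ _ _ _ _)) //.
  exact: Vle.
all: subst f; exists 1 => // x xx xr; have [d ->] := E x xx xr; rewrite mul1r;
  have a0 := P _ _ Wf xx xr.
- have d' : 0 < 1 - V x a by rewrite subr_gt0.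
  by rewrite -[leRHS]mul1r ler_pdivlMr //; nra.
- have d' : 0 < 1 - V x a by rewrite subr_gt0.
  rewrite lerNr -ler_expR lnK ?posrE //; have := expR_ge1Dx (- V x a); lra.
- have := expR_ge1Dx (V x a); lra.
Qed.

Lemma reach_ge e f : W e -> reach e f ->
  exists2 d, 0 < d & forall x, x0 <= x -> x < rho -> d * V x f <= V x e.
Proof.
move=> We; elim=> [|g h eg [d d0 hd] gh]; first by exists 1 => // x _ _; rewrite mul1r.
have [d' d'0 hd'] := arg_ge (reach_trans We eg) gh.
exists (d * d'); first exact: mulr_gt0.
move=> x xx xr; apply: le_trans (hd x xx xr).
by rewrite -mulrA ler_wpM2l ?(ltW d0) ?hd'.
Qed.

Lemma pole_bound_bounded e B : W e -> (forall x, x0 <= x -> x < rho -> V x e <= B) -> pole_bound e.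
Proof.
move=> We h; exists (B * rho) => x xp xr.
have hB : V x e <= B.
  have [xx|xx] := lerP x0 x; first exact: h.
  by apply: le_trans (h x0 _ _) => //; apply: Vle => //; apply: ltW.
have := Vgt0 We xp xr => v0.
apply: (@le_trans _ _ (B * (rho - x))); first by rewrite ler_wpM2r // subr_ge0 ltW.
by rewrite ler_wpM2l; lra.
Qed.


(** * No [Seq] or [Cyc] of radius [rho] *)

Section NoPole.
Hypothesis no_seq : forall a, ~ D (ESeq a).
Hypothesis no_cyc : forall a, ~ D (ECyc a).

(** Each expression in question converges at some point beyond [rho], and there are only finitely
    many, so one point serves for all. Their values below [rho] are then bounded by those at [X]. *)
Lemma regular_beyond : exists2 X, rho < X & forall e, W e -> ~ D e -> F e X.
Proof.
have [||d d0 hd] := @uniform_seq R (expr m) nodes (fun e => W e /\ ~ D e) (fun e d => F e (rho + d)).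
- move=> e en [We nD]; have [x rx Fe] : exists2 x, rho < x & F e x.
    by apply: contrapT => h; apply: nD; split=> // x rx Fe; apply: h; exists x.
  by exists (x - rho); rewrite ?subr_gt0 // addrC subrK.
- move=> e d d' d0 dd; apply: (finite_le citer_lim); first by rewrite addr_ge0 ?ltW.
  by rewrite lerD2l.
exists (rho + d) => [|e We nD]; first by rewrite ltrDl.
by apply: hd => //; apply: W_node.
Qed.

(** Otherwise all arguments would converge at the common point [X], and by [finite_op] so would
    [e]. *)
Lemma diverging_arg e : D e -> exists2 f, arg e f & D f.
Proof.
move=> De; have [We nF] := De; apply: contrapT => h.
have [X rX hX] := regular_beyond; apply: (nF X rX).
apply: (finite_op citer_lim); first by rewrite ltW // (lt_trans rho0).
  move=> f ef; apply: hX; first exact: W_arg ef.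
  by move=> Df; apply: h; exists f.
by case: e De {We nF h}.
Qed.

Lemma diverging_var : D (EVar i).
Proof. by split; [apply: reach_refl|apply: F_gt]. Qed.

(** [e0] reaches as few diverging nodes as possible. A diverging [f] below it that could not return
    to [e0] would reach strictly fewer. *)
Lemma terminal_class : exists2 e0, D e0 &
  forall f, reach e0 f -> D f -> reach f e0.
Proof.
pose n e := count (fun f => `[< reach e f /\ D f >]) nodes.
have ex : exists k, `[< exists2 e, D e & n e = k >].
  by exists (n (EVar i)); apply/asboolP; exists (EVar i) => //; apply: diverging_var.
case: (ex_minnP ex) => k /asboolP[e0 De0 <-] kmin.
exists e0 => // f ef Df; apply: contrapT => nfe.
have : (n f < n e0)%N.
  apply: (@count_lt _ _ _ _ e0).
  - by move=> g /asboolP[fg Dg]; apply/asboolP; split=> //; apply: reach_trans fg.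
  - by apply: W_node; case: De0.
  - by apply/asboolP; split=> //; apply: reach_refl.
  - by apply/asboolP => -[].
rewrite ltnNge => /negP; apply; apply: kmin; apply/asboolP; by exists f.
Qed.

(** * A terminal class of diverging expressions *)

Section Terminal.
Variable e0 : expr m.
Hypothesis De0 : D e0.
Hypothesis e0_terminal : forall f, reach e0 f -> D f -> reach f e0.

Local Notation C := (fun f => reach e0 f /\ D f).

Let C_W f : reach e0 f -> W f.
Proof. by apply: reach_trans; case: De0. Qed.

Let C_arg f g : reach e0 f -> arg f g -> D g -> C g.
Proof. by move=> ef fg Dg; split=> //; apply: reach_step fg. Qed.

Let C_reach f g : C f -> C g -> reach f g.
Proof. by move=> [ef Df] [eg Dg]; apply: reach_trans (e0_terminal ef Df) eg. Qed.

Let C_ge f g : C f -> C g -> exists2 d, 0 < d & forall x, x0 <= x -> x < rho -> d * V x g <= V x f.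
Proof. by move=> Cf Cg; apply: reach_ge; [apply: C_W; case: Cf|apply: C_reach]. Qed.

Let Vpos f x : reach e0 f -> x0 <= x -> x < rho -> 0 < V x f.
Proof. by move=> /C_W Wf xx xr; apply: Vgt0 => //; apply: lt_le_trans xx. Qed.

Let VE f x : reach e0 f -> x0 <= x -> x < rho -> V x f = opval H x (V x) f.
Proof. by move=> /C_W Wf xx xr; have [] := Veq Wf (lt_le_trans x00 xx) xr. Qed.

Lemma bounded_of_square f d : 0 < d -> reach e0 f ->
  (forall x, x0 <= x -> x < rho -> d * V x f ^+ 2 <= V x f) -> pole_bound f.
Proof.
move=> d0 ef h; apply: (@pole_bound_bounded _ d^-1); first exact: C_W.
move=> x xx xr; have v0 := Vpos ef xx xr.
have := h x xx xr; rewrite expr2 mulrA -[X in _ <= X]mul1r ler_pM2r // => h'.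
by rewrite -[leRHS]mul1r ler_pdivlMr // mulrC.
Qed.

(** The argument lies in the same class, so it is at least [d] times the exponential; with
    [expR v >= v ^+ 2 / 2] the exponential dominates a multiple of its own square and is bounded. *)
Lemma pole_bound_set a : C (ESet a) -> pole_bound (ESet a).
Proof.
move=> Cf; have [ef Df] := Cf; have [g /= -> Da] := diverging_arg Df.
have Ca : C a by apply: C_arg ef _ Da.
have [d d0 hd] := C_ge Ca Cf.
apply: (@bounded_of_square _ (d ^+ 2 / 2)) => //; first by rewrite divr_gt0 ?exprn_gt0.
move=> x xx xr; have a0 := Vpos (proj1 Ca) xx xr; have f0 := Vpos ef xx xr.
have h1 := expR_ge1Dxn 1 (ltW a0).
have h2 : (d * V x (ESet a)) ^+ 2 <= V x a ^+ 2.
  by apply: lerXn2r; rewrite ?nnegrE ?hd // ?(ltW a0) // mulr_ge0 // ltW.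
have h3 : V x (ESet a) = expR (V x a) by rewrite [LHS]VE.
by rewrite exprMn in h2; rewrite [leRHS]h3; rewrite (_ : 2`! = 2)%N // in h1; lra.
Qed.

Lemma pole_bound_prod a b : C (EProd a b) -> D a -> D b -> pole_bound (EProd a b).
Proof.
move=> Cf Da Db; have [ef Df] := Cf.
have Ca : C a by apply: C_arg ef _ Da; left.
have Cb : C b by apply: C_arg ef _ Db; right.
have [d d0 hd] := C_ge Ca Cf; have [d' d'0 hd'] := C_ge Cb Cf.
apply: (@bounded_of_square _ (d * d')) => //; first exact: mulr_gt0.
move=> x xx xr; have f0 := Vpos ef xx xr.
rewrite [leRHS](VE ef xx xr) /=.
apply: (@le_trans _ _ ((d * V x (EProd a b)) * (d' * V x (EProd a b)))); first by lra.
by apply: ler_pM; rewrite ?hd ?hd' // mulr_ge0 // ltW.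
Qed.

(** * Linear classes *)

Section Linear.
Hypothesis no_set : forall a, ~ C (ESet a).
Hypothesis linear_prod : forall a b, C (EProd a b) -> D a -> D b -> False.

(** Strong connectedness gives a path from [f] to [g]. It stays in the class: its nodes are
    reachable from [e0], and parents of diverging expressions diverge. *)
Lemma class_ind (Q : expr m -> Prop) g : C g -> Q g ->
  (forall f h, C f -> C h -> arg f h -> Q h -> Q f) -> forall f, C f -> Q f.
Proof.
move=> Cg Qg step f Cf.
suff : reach e0 f -> D f /\ Q f by case=> //; case: Cf.
apply: (@reach_closed m H (fun f => reach e0 f -> D f /\ Q f) f g).
- move=> {f}{Cf} f h fh IH ef.
  have [Dh Qh] := IH (reach_step ef fh).
  have Df := diverging_parent (C_W ef) fh Dh.
  by split=> //; apply: (step f h) => //; split=> //; apply: reach_step fh.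
- exact: C_reach.
- by move=> _; split=> //; case: Cg.
Qed.

Lemma class_cases f g : C f -> arg f g -> D g ->
  [\/ exists j, f = EVar j,
      exists h, f = ESum g h \/ f = ESum h g |
      exists2 h, f = EProd g h \/ f = EProd h g & ~ D h].
Proof.
move=> Cf; have [_ Df] := Cf; case: f Cf Df => [||j|a b|a b|a|a|a] //= Cf Df.
- by move=> _ _; apply: Or31; exists j.
- by case=> -> _; apply: Or32; [exists b; left|exists a; right].
- case=> -> Dg; apply: Or33.
    by exists b; [left|apply: (linear_prod Cf Dg)].
  by exists a; [right|move=> Da; apply: (linear_prod Cf Da Dg)].
- by case: (no_seq Df).
- by case: (no_cyc Df).
- by case: (no_set Cf).
Qed.

(* Without a nonconstant coefficient, going around the class shows that all its
   values are equal, so it contains no sum, and then its iterates from [0] vanish. *)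
Lemma constant_class :
  (forall f h b n, C f -> (f = EProd h b \/ f = EProd b h) -> D h -> A b n.+1 = 0) -> False.
Proof.
move=> cst; pose v := V x0.
have vE f : C f -> v f = opval H x0 v f by case=> ef _; apply: VE.
have vpos f : reach e0 f -> 0 < v f by move=> ef; apply: Vpos.
(* A constant factor has a positive natural number as value, hence at least 1. *)
have vb f h b : C f -> (f = EProd h b \/ f = EProd b h) -> D h -> 1 <= v b.
  move=> Cf fE Dh; have Wb : W b.
    have [ef _] := Cf; apply: (W_arg (C_W ef)).
    by case: fE => ->; [right|left].
  have -> : v b = A b 0%N.
    by apply: psup_const => //; [apply: ltW|move=> n; apply: cst Cf fE Dh].
  have [k hk] := limit0_nat (W_node Wb).
  have : 0 < v b by apply: Vgt0.
  have -> : v b = A b 0%N.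
    by apply: psup_const => //; [apply: ltW|move=> n; apply: cst Cf fE Dh].
  by rewrite hk ltr0n ler1n.
have mono g : C g -> forall f, C f -> v g <= v f.
  move=> Cg; apply: (class_ind Cg) => // f h Cf Ch fh gh; apply: (le_trans gh).
  have Cf' := Cf; have [eh Dh] := Ch; rewrite (vE f Cf).
  case: (class_cases Cf fh Dh) => [[j fE]|[b [fE|fE]]|[b fE nDb]].
  - by move: fh; rewrite fE /= => ->.
  - rewrite fE /= lerDl ltW // vpos //; apply: (reach_step (proj1 Cf')).
    by rewrite fE; right.
  - rewrite fE /= lerDr ltW // vpos //; apply: (reach_step (proj1 Cf')).
    by rewrite fE; left.
  - have h1 := vb _ _ _ Cf fE Dh; have h0 := vpos h eh.
    by case: fE => -> /=; rewrite ?ler_peMr ?ler_peMl // ltW.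
have no_sum a b : ~ C (ESum a b).
  move=> Cf; have [ef Df] := Cf; have [g fg Dg] := diverging_arg Df.
  have h := mono _ Cf g (C_arg ef fg Dg).
  have ha := vpos a (reach_step ef (or_introl erefl)).
  have hb := vpos b (reach_step ef (or_intror erefl)).
  rewrite (vE _ Cf) /= in h; by case: fg => e; rewrite e in h; lra.
(* Every member has an argument in the class, and in the absence of sums a vanishing argument
   annihilates it. *)
have zero N f : C f -> cexpr (citer H R N) f =1 fun=> 0.
  have main (c' : 'I_m -> nat -> R) : (forall j, C (EVar j) -> c' j =1 fun=> 0) ->
      forall f, C f -> cexpr c' f =1 fun=> 0.
    move=> hc; elim=> [||j|a IHa b IHb|a IHa b IHb|a IHa|a IHa|a IHa] Cf n; have [ef Df] := Cf.
    - by have [] := diverging_arg Df.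
    - by have [] := diverging_arg Df.
    - exact: hc.
    - by case: (no_sum _ _ Cf).
    - have [g fg Dg] := diverging_arg Df; have Cg := C_arg ef fg Dg.
      rewrite /= /seqmul; apply: big1 => k _; case: fg => gE; rewrite gE in Cg.
        by rewrite (IHa Cg) mul0r.
      by rewrite (IHb Cg) mulr0.
    - by case: (no_seq Df).
    - by case: (no_cyc Df).
    - by case: (no_set Cf).
  elim: N f => [|N IHN] f; apply: main => // j Cj n /=.
  apply: IHN; have [ej Dj] := Cj; have [g /= gE Dg] := diverging_arg Dj.
  by rewrite -gE; apply: C_arg ej _ Dg.
have Ce0 : C e0 by split=> //; apply: reach_refl.
have [n] := limit_neq0 citer_lim no_size0_arg c_neq0 (W_node (C_W (reach_refl H e0))).
have [N /(_ N (leqnn N) e0 n (leqnn n)) <-] := cexpr_lim citer_lim n.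
by rewrite zero // ltxx.
Qed.

(* [l] is the largest ratio of the values at [x] and at [y] over the class.  At
   an expression where it is attained, the left side is [l * V y f], whence
   [d * (y - x) * V x f <= d^-1]. *)
Definition contracting f (d : R) : Prop := d * rho <= 1 /\ forall x y l,
  x0 <= x -> x < y -> y < rho -> 0 <= l -> (forall g, C g -> V x g <= l * V y g) ->
  V x f <= l * (1 - d * (y - x)) * V y f + d^-1.

Lemma contracting_le f d d' : reach e0 f -> 0 < d' -> d' <= d -> contracting f d -> contracting f d'.
Proof.
move=> ef d'0 dd [dr h]; split.
  by apply: le_trans dr; rewrite ler_wpM2r // ltW.
move=> x y l xx xy yr l0 hl; apply: le_trans (h x y l xx xy yr l0 hl) _.
have d0 : 0 < d by apply: lt_le_trans dd.
have v0 := Vpos ef (le_trans xx (ltW xy)) yr.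
apply: lerD; last by rewrite lef_pV2 ?posrE.
rewrite ler_wpM2r ?(ltW v0) // ler_wpM2l // lerD2l lerN2 ler_wpM2r //.
by rewrite subr_ge0 ltW.
Qed.

(** The contraction originates at the product [f0], whose factor [b0] increases strictly from [x] to
    [y]. It is passed on from arguments to parents around the class; the additive term [d^-1]
    absorbs the contributions of convergent summands. *)
Lemma contracting_class f0 h0 b0 n0 : C f0 -> (f0 = EProd h0 b0 \/ f0 = EProd b0 h0) ->
  D h0 -> 0 < A b0 n0.+1 -> forall f, C f -> exists2 d, 0 < d & contracting f d.
Proof.
move=> Cf0 f0E Dh0 bn.
have [X rX hX] := regular_beyond.
have VX b y : W b -> ~ D b -> 0 < y -> y < rho -> V y b <= V X b.
  move=> Wb nDb y0 yr; apply: (value_le citer_lim); rewrite ?ltW ?(lt_trans yr) //.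
  exact: hX.
have bound_prod f h b : C f -> (f = EProd h b \/ f = EProd b h) -> W h /\ W b.
  move=> [ef _] fE; have Wf := C_W ef.
  by split; apply: (W_arg Wf); case: fE => ->; [left|right|right|left].
have prodE f h b x : C f -> (f = EProd h b \/ f = EProd b h) -> x0 <= x -> x < rho ->
    V x f = V x h * V x b.
  by move=> [ef _] fE xx xr; rewrite (VE ef xx xr); case: fE => -> //=; rewrite mulrC.
apply: (class_ind Cf0).
  have Ch0 : C h0 by apply: (C_arg (proj1 Cf0)) => //; case: f0E => ->; [left|right].
  have [_ Wb] := bound_prod _ _ _ Cf0 f0E.
  have nDb : ~ D b0 by move=> Db; case: f0E => e; subst f0; [apply: (linear_prod Cf0)|apply: (linear_prod Cf0 Db)].
  have [d d0 hd] := psup_incr (A0 b0) bn x00.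
  have M0 : 0 < V X b0.
    by apply: lt_le_trans (VX b0 x0 Wb nDb x00 x0r); apply: Vgt0.
  (* [d / V X b0] turns the absolute increase [d * (y - x)] of [b0] into a relative one, as
     [V y b0 <= V X b0]; [rho^-1] ensures [d' * rho <= 1]. *)
  exists (Num.min (d / V X b0) rho^-1); first by rewrite lt_min divr_gt0 //= invr_gt0.
  set d' := Num.min _ _; have d'0 : 0 < d' by rewrite lt_min divr_gt0 //= invr_gt0.
  have d'1 : d' <= d / V X b0 by rewrite ge_min lexx.
  have d'2 : d' <= rho^-1 by rewrite ge_min lexx orbT.
  split; first by rewrite -ler_pdivlMr // mul1r.
  move=> x y l xx xy yr l0 hl; rewrite -[leLHS]addr0 lerD ?invr_ge0 ?(ltW d'0) //.
  have yx : x0 <= y by apply: le_trans xx (ltW xy).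
  have xr : x < rho by apply: lt_trans yr.
  rewrite (prodE _ _ _ x Cf0 f0E) // (prodE _ _ _ y Cf0 f0E) //.
  have y0 : 0 < y by apply: lt_le_trans yx.
  have h1 : V x b0 <= (1 - d' * (y - x)) * V y b0.
    have := hd x y xx (ltW xy) (W_F Wb y0 yr).
    have : d' * (y - x) * V y b0 <= d * (y - x).
      apply: (@le_trans _ _ (d' * (y - x) * V X b0)).
        by rewrite ler_wpM2l ?VX // mulr_ge0 ?(ltW d'0) // subr_ge0 ltW.
      by rewrite mulrAC ler_wpM2r ?subr_ge0 ?(ltW xy) // -ler_pdivlMr.
    rewrite -/(V x b0) -/(V y b0); lra.
  have h2 := hl h0 Ch0.
  have h3 := Vpos (proj1 Ch0) xx xr.
  have h4 := Vgt0 Wb (lt_le_trans x00 xx) xr.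
  apply: le_trans (ler_pM (ltW h3) (ltW h4) h2 h1) _; lra.
move=> f g Cf Cg fg [d d0 [dr hd]].
have [ef Df] := Cf; have [eg Dg] := Cg.
(* The condition [d * rho <= 1] is part of [contracting] to make this factor nonnegative. *)
have dxy x y : x0 <= x -> x < y -> y < rho -> 0 <= 1 - d * (y - x).
  move=> xx xy yr; rewrite subr_ge0; apply: le_trans dr; rewrite ler_wpM2l ?(ltW d0) //.
  by have := x00; lra.
case: (class_cases Cf fg Dg) => [[j fE]|[b fE]|[b fE nDb]].
- exists d => //; split=> // x y l xx xy yr l0 hl.
  have yx : x0 <= y by apply: le_trans xx (ltW xy).
  rewrite (VE ef xx (lt_trans xy yr)) (VE ef yx yr); move: fg; rewrite fE /= => <-.
  exact: hd.
- have fb : arg f b by case: fE => ->; [right|left].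
  have eb : reach e0 b := reach_step ef fb; have Wb := C_W eb.
  have sumE x : x0 <= x -> x < rho -> V x f = V x g + V x b.
    by move=> xx xr; rewrite (VE ef xx xr); case: fE => -> //=; rewrite addrC.
  have [Db|nDb] := pselect (D b).
    have [d1 d10 hd1] := C_ge Cg Cf.
    (* Only the summand [g] is known to contract; since it makes up at least the fraction [d1] of
       [f], the sum contracts at rate [d * d1]. *)
    exists (Num.min (d * d1) d); first by rewrite lt_min mulr_gt0.
    set d' := Num.min _ _; have d'0 : 0 < d' by rewrite lt_min mulr_gt0.
    have d'1 : d' <= d * d1 by rewrite ge_min lexx.
    have d'2 : d' <= d by rewrite ge_min lexx orbT.
    split; first by apply: le_trans dr; rewrite ler_wpM2r // ltW.
    move=> x y l xx xy yr l0 hl; have yx : x0 <= y by apply: le_trans xx (ltW xy).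
    have h1 := hd x y l xx xy yr l0 hl.
    have h2 := hl b (conj eb Db); have h3 := hd1 y yx yr.
    have h4 : d^-1 <= d'^-1 by rewrite lef_pV2.
    have h5 : d' * V y f <= d * V y g.
      apply: (@le_trans _ _ (d * (d1 * V y f))); last by rewrite ler_wpM2l // ltW.
      by rewrite mulrA ler_wpM2r // ltW // Vpos.
    have h6 : l * (y - x) * (d' * V y f) <= l * (y - x) * (d * V y g).
      by rewrite ler_wpM2l // mulr_ge0 // subr_ge0 ltW.
    have h7 : V y f = V y g + V y b by apply: sumE.
    rewrite (sumE x) ?(lt_trans xy yr) //.
    have h8 : l * V y f = l * V y g + l * V y b by rewrite h7 mulrDr.
    lra.
  have Vb0 : 0 < V X b by apply: lt_le_trans (VX b x0 Wb nDb x00 x0r); apply: Vgt0.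
  (* The convergent summand is at most [V X b] and moves into the additive term. *)
  exists ((d^-1 + V X b)^-1); first by rewrite invr_gt0 addr_gt0 ?invr_gt0.
  set d' := (_)^-1; have d'0 : 0 < d' by rewrite invr_gt0 addr_gt0 ?invr_gt0.
  have d'1 : d' <= d by rewrite -[leRHS]invrK lef_pV2 ?posrE ?addr_gt0 ?invr_gt0 // lerDl ltW.
  split; first by apply: le_trans dr; rewrite ler_wpM2r // ltW.
  move=> x y l xx xy yr l0 hl; have yx : x0 <= y by apply: le_trans xx (ltW xy).
  have xr := lt_trans xy yr.
  have h1 := hd x y l xx xy yr l0 hl; have h2 := VX b x Wb nDb (lt_le_trans x00 xx) xr.
  rewrite (sumE x) // (_ : d'^-1 = d^-1 + V X b); last by rewrite /d' invrK.
  have h3 : V y g <= V y f by rewrite (sumE y) // lerDl ltW // Vpos.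
  have h4 : l * (1 - d * (y - x)) * V y g <= l * (1 - d' * (y - x)) * V y f.
    apply: ler_pM => //; rewrite ?mulr_ge0 ?dxy ?(ltW (Vpos eg yx yr)) //.
    by rewrite ler_wpM2l // lerD2l lerN2 ler_wpM2r // subr_ge0 ltW.
  lra.
- have [_ Wb] := bound_prod _ _ _ Cf fE.
  have Vb0 : 0 < V X b by apply: lt_le_trans (VX b x0 Wb nDb x00 x0r); apply: Vgt0.
  pose B := Num.max 1 (V X b).
  have B1 : 1 <= B by rewrite le_max lexx.
  have B2 : V X b <= B by rewrite le_max lexx orbT.
  have B0 : 0 < B by lra.
  (* The convergent factor, at most [B], multiplies the additive term; [1 <= B] keeps the new rate
     below [d]. *)
  exists (d / B); first exact: divr_gt0.
  have d'1 : d / B <= d by rewrite ler_pdivrMr // ler_peMr // ltW.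
  split; first by apply: le_trans dr; rewrite ler_wpM2r // ltW.
  move=> x y l xx xy yr l0 hl; have yx : x0 <= y by apply: le_trans xx (ltW xy).
  have xr := lt_trans xy yr.
  have h1 := hd x y l xx xy yr l0 hl.
  have y0 : 0 < y by apply: lt_le_trans yx.
  have hb := Vle Wb (lt_le_trans x00 xx) (ltW xy) yr.
  have hb0 := Vgt0 Wb (lt_le_trans x00 xx) xr.
  have hb1 := Vgt0 Wb y0 yr.
  have hB := le_trans (VX b y Wb nDb y0 yr) B2.
  rewrite (prodE _ _ _ x Cf fE) // (prodE _ _ _ y Cf fE) //.
  apply: le_trans (ler_pM (ltW (Vpos eg xx xr)) (ltW hb0) h1 hb) _.
  have h2 : d^-1 * V y b <= (d / B)^-1.
    by rewrite invf_div mulrC ler_wpM2r // invr_ge0 ltW.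
  rewrite mulrDl; apply: lerD h2; rewrite mulrA ler_wpM2r ?(ltW hb1) //.
  rewrite ler_wpM2r ?(ltW (Vpos eg yx yr)) // ler_wpM2l // lerD2l lerN2 ler_wpM2r //.
  by rewrite subr_ge0 ltW.
Qed.

(** At a member [f] of maximal ratio, contraction yields [(y - x) * V x f <= d^-1 / d].
    Comparability within the class transfers this to [e0] at the cost of a factor [k], and [y] tends
    to [rho]. *)
Lemma pole_bound_linear : pole_bound e0.
Proof.
have [[f0 [h0 [b0 [n0 [Cf0 f0E Dh0 bn]]]]]|nc] := pselect (exists f h b n,
  [/\ C f, (f = EProd h b \/ f = EProd b h), D h & 0 < A b n.+1]); last first.
  case: constant_class => f h b n Cf fE Dh; apply/eqP; rewrite eq_le A0 andbT leNgt.
  by apply/negP => bn; apply: nc; exists f, h, b, n.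
have Ce0 : C e0 by split=> //; apply: reach_refl.
have [||d d0 hd] := @uniform_seq R (expr m) nodes (fun f => C f)
    (fun f d => C f -> contracting f d).
- move=> f _ Cf; have [d d0 hd] := contracting_class Cf0 f0E Dh0 bn Cf.
  by exists d.
- by move=> f d d' d'0 dd h Cf; apply: contracting_le (h Cf) => //; case: Cf.
have [||k k0 hk] := @uniform_seq R (expr m) nodes (fun f => C f)
    (fun f k => C f -> forall x, x0 <= x -> x < rho -> k * V x e0 <= V x f).
- by move=> f _ Cf; have [k k0 hk] := C_ge Cf Ce0; exists k.
- move=> f k k' k'0 kk h Cf x xx xr; apply: le_trans (h Cf x xx xr).
  by rewrite ler_wpM2r // ltW // Vpos //; case: Ce0.
have inN f : C f -> f \in nodes by case=> /C_W /W_node.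
have key x : x0 <= x -> x < rho -> V x e0 * (rho - x) <= (d ^+ 2 * k)^-1.
  move=> xx xr; rewrite mulrBr lerBlDr; apply: (le_lt_lim xr) => y xy yr.
  have yx : x0 <= y by apply: le_trans xx (ltW xy).
  have [f Cf fmax] := @exists_max R (expr m) nodes (fun f => C f)
     (fun f => V x f / V y f) e0 (inN _ Ce0) Ce0.
  have vx g : C g -> 0 < V x g by case=> eg _; apply: Vpos.
  have vy g : C g -> 0 < V y g by case=> eg _; apply: Vpos.
  pose l := V x f / V y f.
  have l0 : 0 <= l by rewrite divr_ge0 // ltW // ?vx ?vy.
  have hl g : C g -> V x g <= l * V y g.
    by move=> Cg; rewrite -ler_pdivrMr ?vy // fmax // inN.
  have [_ h] := hd f (inN f Cf) Cf Cf.
  have := h x y l xx xy yr l0 hl.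
  have e1 : l * V y f = V x f by rewrite /l divfK // gt_eqF // vy.
  rewrite (_ : l * _ * _ = V x f - d * (y - x) * V x f); last by rewrite -e1; ring.
  move=> h1; have h2 : d * ((y - x) * V x f) <= d^-1 by lra.
  have h3 := hk f (inN f Cf) Cf Cf x xx xr.
  have h4 : V x e0 * (y - x) <= (d ^+ 2 * k)^-1; last by lra.
  rewrite -[leRHS]mul1r ler_pdivlMr; last by rewrite mulr_gt0 ?exprn_gt0.
  have h5 : d * ((y - x) * (k * V x e0)) <= d^-1.
    by apply: le_trans h2; rewrite ler_wpM2l ?(ltW d0) // ler_wpM2l // subr_ge0 ltW.
  have h6 : d * (d * ((y - x) * (k * V x e0))) <= 1.
    by rewrite mulrC -ler_pdivlMr // mul1r.
  by move: h6; rewrite expr2; lra.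
(* The second term covers [x < x0], where [V x e0 <= V x0 e0] and [rho - x <= rho]. *)
exists ((d ^+ 2 * k)^-1 + V x0 e0 * rho) => x xp xr.
have p1 : 0 <= (d ^+ 2 * k)^-1 by rewrite invr_ge0 mulr_ge0 ?sqr_ge0 // ltW.
have p2 : 0 < V x0 e0 by apply: Vpos; [apply: reach_refl|apply: lexx|].
have [xx|xx] := lerP x0 x.
  by apply: le_trans (key x xx xr) _; rewrite lerDl mulr_ge0 // ltW.
apply: (@le_trans _ _ (V x0 e0 * rho)); last by rewrite lerDr.
apply: ler_pM; rewrite ?subr_ge0 ?(ltW xr) //; last by rewrite gerBl ltW.
  by rewrite ltW // Vgt0 //; apply: C_W; apply: reach_refl.
by apply: Vle => //; [apply: C_W; apply: reach_refl|apply: ltW].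
Qed.

End Linear.
End Terminal.
End NoPole.

Lemma exists_pole_bound : exists2 e, D e & pole_bound e.
Proof.
have [[a Da]|no_seq] := pselect (exists a, D (ESeq a)).
  by exists (ESeq a) => //; apply: pole_bound_seq; case: Da.
have [[a Da]|no_cyc] := pselect (exists a, D (ECyc a)).
  by exists (ECyc a) => //; apply: pole_bound_cyc; case: Da.
have ns a : ~ D (ESeq a) by move=> Da; apply: no_seq; exists a.
have nc a : ~ D (ECyc a) by move=> Da; apply: no_cyc; exists a.
have [e0 De0 e0t] := terminal_class.
have [[a [ea Da]]|no_set] := pselect (exists a, reach e0 (ESet a) /\ D (ESet a)).
  by exists (ESet a) => //; apply: (pole_bound_set ns nc De0 e0t).
have [[a [b [Cf Da Db]]]|no_prod] := pselect (exists a b,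
  [/\ reach e0 (EProd a b) /\ D (EProd a b), D a & D b]).
  by exists (EProd a b); [case: Cf|apply: (pole_bound_prod De0 e0t)].
exists e0 => //; apply: (pole_bound_linear ns nc De0 e0t) => [a Ca|a b Cf Da Db].
  by apply: no_set; exists a.
by apply: no_prod; exists a, b.
Qed.

End Growth.

(** * Certificates *)

Local Open Scope nat_scope.

Section Digits.

(** A finite list of naturals is coded by a base and a number, so that searching for a certificate
    is searching for a pair. *)
Definition digit (B b k : nat) : nat := b %/ B ^ k %% B.

Lemma exists_digits_base (f : nat -> nat) B K : (forall k, k < K -> f k < B) ->
  exists b, forall k, k < K -> digit B b k = f k.
Proof.
elim: K f => [|K IHK] f fB; first by exists 0.
have [|b hb] := IHK (fun k => f k.+1); first by move=> k kK; apply: fB.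
have B0 : 0 < B by apply: leq_ltn_trans (fB 0 _).
exists (b * B + f 0) => -[_|k kK].
  by rewrite /digit divn1 modnMDl modn_small ?fB.
by rewrite -(hb k) // /digit expnS divnMA divnMDl // (divn_small (fB 0 isT)) addn0.
Qed.

Lemma exists_digits (f : nat -> nat) K :
  exists B b, forall k, k < K -> digit B b k = f k.
Proof.
exists (\max_(k < K) f k).+1; apply: exists_digits_base => k kK.
by rewrite ltnS (leq_bigmax (Ordinal kK)).
Qed.

End Digits.

Section Certificate.
Variables (m : nat) (H : specification m).

(* [u e / q] is meant to bound the value of [e] at [p / q] from above.  For [Set]
   and [Cyc] we use [expR t <= (1 - t / q) ^- q] and [(1 + t / q) ^ q <= expR t].
   Truncated subtractions are harmless: they make the right-hand side [0]. *)
Definition super_cert (p q : nat) (u : expr m -> nat) (e : expr m) : bool :=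
  match e with
  | EOne => q <= u e
  | EAtom => p <= u e
  | EVar j => u (H j) <= u e
  | ESum a b => u a + u b <= u e
  | EProd a b => u a * u b <= q * u e
  | ESeq a => q * q + u a * u e <= q * u e
  | ECyc a => q * (q * q) ^ q <= (q - u a) * (q * q + u e) ^ q
  | ESet a => q * (q * q) ^ q <= u e * (q * q - u a) ^ q
  end.

(* From lower bounds [v / q] at [p / q] to the next ones [v' / q].  If [q <= v a],
   truncation makes the condition for [Cyc] void, as it should be: the series
   diverges then. *)
Definition sub_cert (p q : nat) (v v' : expr m -> nat) (e : expr m) : bool :=
  match e with
  | EOne => v' e <= q
  | EAtom => v' e <= p
  | EVar j => v' e <= v (H j)
  | ESum a b => v' e <= v a + v b
  | EProd a b => q * v' e <= v a * v b
  | ESeq a => q * v' e <= q * q + v a * v e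
  | ECyc a => (q - v a) * (q * q) ^ q <= q * (q * q - v' e) ^ q
  | ESet a => v' e * (q * q) ^ q <= q * (q * q + v a) ^ q
  end.

Ltac rec_arith :=
  repeat first
    [ assumption | apply: decidable_leq | apply: (recursive_comp2 recursive_add)
    | apply: (recursive_comp2 recursive_mul) | apply: (recursive_comp2 recursive_sub)
    | apply: (recursive_comp2 recursive_exp) | apply: (recursive_comp2 recursive_div)
    | apply: (recursive_comp2 recursive_mod) | apply: recursive_const | apply: recursive_proj
    | apply: recursive_succn ].

Lemma decidable_super n (p q : n.-tuple nat -> nat) (u : expr m -> n.-tuple nat -> nat) e :
  recursive p -> recursive q -> (forall e, recursive (u e)) ->
  decidable_rec (fun v => super_cert (p v) (q v) (u^~ v) e).
Proof. by move=> rp rq ru; case: e => *; rewrite /super_cert; rec_arith. Qed.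

Lemma decidable_sub n (p q : n.-tuple nat -> nat) (u u' : expr m -> n.-tuple nat -> nat) e :
  recursive p -> recursive q -> (forall e, recursive (u e)) -> (forall e, recursive (u' e)) ->
  decidable_rec (fun v => sub_cert (p v) (q v) (u^~ v) (u'^~ v) e).
Proof. by move=> rp rq ru ru'; case: e => *; rewrite /sub_cert; rec_arith. Qed.

Variables (W : expr m -> bool) (e1 : expr m) (M : nat).

Local Notation L := (nodes H).
Let l := size L.

(* The digits of [b] in base [B] list [p], [p'], [q], the length [s] of the
   iteration, the upper bounds at [p / q], and the [s + 1] vectors of lower
   bounds at [p' / q]. *)
Definition cert_super (B b : nat) (e : expr m) : nat := digit B b (4 + index e L).
Definition cert_sub (B b t : nat) (e : expr m) : nat :=
  digit B b (4 + l + (t * l + index e L)).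

(** The error [2 ^- n] is split in two halves: [p' / q] exceeds [p / q] by at most one half, and a
    value above [M * 2 ^ n.+1] at [p' / q] places [rho] at most the other half above [p' / q]. *)
Definition certificate (n B b : nat) : bool :=
  let p := digit B b 0 in let p' := digit B b 1 in let q := digit B b 2 in
  let s := digit B b 3 in
  [&& 0 < q, 0 < p', p' * 2 ^ n.+1 <= p * 2 ^ n.+1 + q,
      all (fun e => W e ==> super_cert p q (cert_super B b) e) L,
      all (fun e => cert_sub B b 0 e <= 0) L,
      all (fun t => all (sub_cert p' q (cert_sub B b t) (cert_sub B b t.+1)) L) (iota 0 s) &
      M * 2 ^ n.+1 * q < cert_sub B b s e1].

Lemma recursive_digit n (B b k : n.-tuple nat -> nat) :
  recursive B -> recursive b -> recursive k -> recursive (fun v => digit (B v) (b v) (k v)).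
Proof. by move=> rB rb rk; rewrite /digit; rec_arith. Qed.

Lemma decidable_certificate : decidable_rec (fun v : 3.-tuple nat =>
  certificate (tnth v ord_max) (tnth v (lift ord0 ord0)) (tnth v ord0)).
Proof.
have rd k : recursive (fun v : 3.-tuple nat => digit (tnth v (lift ord0 ord0)) (tnth v ord0) k).
  by apply: recursive_digit; rec_arith.
have rs n (B b t : n.-tuple nat -> nat) e : recursive B -> recursive b -> recursive t ->
    recursive (fun v => cert_sub (B v) (b v) (t v) e).
  by move=> rB rb rt; apply: recursive_digit => //; rec_arith.
pose B (v : 3.-tuple nat) := tnth v (lift ord0 ord0); pose b (v : 3.-tuple nat) := tnth v ord0.
have rB : recursive B by apply: recursive_proj.
have rb : recursive b by apply: recursive_proj.
rewrite /certificate; do !apply: decidable_and.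
- by rec_arith.
- by rec_arith.
- by rec_arith.
- apply: (@decidable_all _ L 3 (fun e v => W e ==> super_cert (digit (B v) (b v) 0)
    (digit (B v) (b v) 2) (cert_super (B v) (b v)) e)) => e.
  (* [e] is fixed here, so [W e] is a constant truth value and requires no algorithm. *)
  case: (W e) => /=; last exact: (recursive_const _ 1).
  apply: (@decidable_super 3 _ _ (fun e v => cert_super (B v) (b v) e)); rewrite ?/B ?/b => *; exact: rd.
- apply: (@decidable_all _ L 3 (fun e v => cert_sub (B v) (b v) 0 e <= 0)) => e.
  by apply: decidable_leq; [apply: rs; rec_arith|rec_arith].
- apply: (@decidable_iota 3 (fun t v => all (sub_cert (digit (tnth v (lift ord0 ord0)) (tnth v ord0) 1)
     (digit (tnth v (lift ord0 ord0)) (tnth v ord0) 2)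
     (cert_sub (tnth v (lift ord0 ord0)) (tnth v ord0) t)
     (cert_sub (tnth v (lift ord0 ord0)) (tnth v ord0) t.+1)) L)) => //.
  have rB' : recursive (fun v : 4.-tuple nat => tnth [tuple of behead v] (lift ord0 ord0)).
    apply: recursive_ext (recursive_proj (lift ord0 (lift ord0 (@ord0 1)))) => v.
    by rewrite !(tnth_nth 0) /= nth_behead.
  have rb' : recursive (fun v : 4.-tuple nat => tnth [tuple of behead v] ord0).
    apply: recursive_ext (recursive_proj (lift ord0 (@ord0 2))) => v.
    by rewrite !(tnth_nth 0) /= nth_behead.
  have rt : recursive (fun v : 4.-tuple nat => thead v) by rewrite /thead; rec_arith.
  pose B' (v : 4.-tuple nat) := tnth [tuple of behead v] (lift ord0 ord0).
  pose b' (v : 4.-tuple nat) := tnth [tuple of behead v] ord0.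
  apply: (@decidable_all _ L 4 (fun e v => sub_cert (digit (B' v) (b' v) 1) (digit (B' v) (b' v) 2)
     (cert_sub (B' v) (b' v) (thead v)) (cert_sub (B' v) (b' v) (thead v).+1) e)) => e.
  apply: (@decidable_sub 4 _ _ (fun e v => cert_sub (B' v) (b' v) (thead v) e)
    (fun e v => cert_sub (B' v) (b' v) (thead v).+1 e)).
  + by apply: recursive_digit => //; rec_arith.
  + by apply: recursive_digit => //; rec_arith.
  + by move=> f; apply: rs.
  + by move=> f; apply: rs => //; apply: recursive_succn.
- apply: decidable_leq; last by apply: rs; rec_arith.
  by apply: recursive_succn; rec_arith.
Qed.

End Certificate.

(** * Certificates over the reals *)

Local Open Scope ring_scope.

Section RealCertificate.
Variables (m : nat) (H : specification m) (R : realType).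
Variables (q : nat) (q0 : (0 < q)%N).
Local Notation "n %:q" := (n%:R / q%:R : R) (at level 1, format "n %:q").

Definition super_real (x : R) (u : expr m -> R) (e : expr m) : Prop :=
  match e with
  | EOne => 1 <= u e
  | EAtom => x <= u e
  | EVar j => u (H j) <= u e
  | ESum a b => u a + u b <= u e
  | EProd a b => u a * u b <= u e
  | ESeq a => 1 + u a * u e <= u e
  | ECyc a => u a <= 1 /\ 1 <= (1 - u a) * (1 + u e / q%:R) ^+ q
  | ESet a => u a <= q%:R /\ 1 <= u e * (1 - u a / q%:R) ^+ q
  end.

(** For [Seq] the previous bound of the node itself occurs: iterating [1 + v a * v e] sums the
    geometric series without division, and makes sense even if [v a] is 1 or more. *)
Definition sub_real (x : R) (v v' : expr m -> R) (e : expr m) : Prop :=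
  match e with
  | EOne => v' e <= 1
  | EAtom => v' e <= x
  | EVar j => v' e <= v (H j)
  | ESum a b => v' e <= v a + v b
  | EProd a b => v' e <= v a * v b
  | ESeq a => v' e <= 1 + v a * v e
  | ECyc a => 1 <= v a \/ (v' e <= q%:R /\ 1 - v a <= (1 - v' e / q%:R) ^+ q)
  | ESet a => v' e <= (1 + v a / q%:R) ^+ q
  end.

Let qR : 0 < q%:R :> R. Proof. by rewrite ltr0n. Qed.

Let natE (n : nat) : n%:R = n%:q * q%:R :> R.
Proof. by rewrite divfK ?gt_eqF. Qed.

Let natP (n : nat) : exists X : R, X = n%:q /\ n%:R = X * q%:R.
Proof. by exists n%:q; rewrite -natE. Qed.

Let pow0 : 0 < ((q%:R * q%:R) ^+ q : R). Proof. by rewrite exprn_gt0 ?mulr_gt0. Qed.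

Let powD n : ((q * q + n) ^ q)%:R = (q%:R * q%:R) ^+ q * (1 + n%:q / q%:R) ^+ q :> R.
Proof.
rewrite natrX natrD natrM -exprMn; congr (_ ^+ _).
by rewrite {1}(natE n); field; rewrite gt_eqF.
Qed.

Let powB n : (n <= q * q)%N ->
  ((q * q - n) ^ q)%:R = (q%:R * q%:R) ^+ q * (1 - n%:q / q%:R) ^+ q :> R.
Proof.
move=> nq; rewrite natrX natrB // natrM -exprMn; congr (_ ^+ _).
by rewrite {1}(natE n); field; rewrite gt_eqF.
Qed.

Let le_q n : (n <= q * q)%N = (n%:q <= q%:R).
Proof. by rewrite ler_pdivrMr // -natrM ler_nat. Qed.

Let le_1 n : (n <= q)%N = (n%:q <= 1).
Proof. by rewrite ler_pdivrMr // mul1r ler_nat. Qed.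

Lemma super_certE p (u : expr m -> nat) e :
  super_cert H p q u e <-> super_real p%:q (fun e => (u e)%:q) e.
Proof.
case: e => [||j|a b|a b|a|a|a] /=.
- by rewrite ler_pdivlMr // mul1r ler_nat.
- by rewrite ler_pM2r ?invr_gt0 // ler_nat.
- by rewrite ler_pM2r ?invr_gt0 // ler_nat.
- by rewrite -mulrDl ler_pM2r ?invr_gt0 // -natrD ler_nat.
- rewrite -(ler_nat R) !natrM; set x := u a; set y := u b; set z := u _.
  have [X [<- ->]] := natP x. have [Y [<- ->]] := natP y. have [Z [<- ->]] := natP z.
  have -> : X * q%:R * (Y * q%:R) = q%:R * q%:R * (X * Y) by ring.
  have -> : q%:R * (Z * q%:R) = (q%:R * q%:R) * Z by ring.
  by rewrite ler_pM2l ?mulr_gt0.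
- rewrite -(ler_nat R) natrD !natrM; set x := u a; set z := u _.
  have [X [<- ->]] := natP x. have [Z [<- ->]] := natP z.
  have -> : q%:R * q%:R + X * q%:R * (Z * q%:R) = (q%:R * q%:R) * (1 + X * Z) by ring.
  have -> : q%:R * (Z * q%:R) = (q%:R * q%:R) * Z by ring.
  by rewrite ler_pM2l ?mulr_gt0.
- set x := u a; set z := u _; rewrite -le_1.
  have [xq|qx] := leqP x q; last first.
    split=> [|[]//]; have -> : (q - x = 0)%N by apply/eqP; rewrite subn_eq0 ltnW.
    by rewrite mul0n leqn0 muln_eq0 expn_eq0 muln_eq0 (gtn_eqF q0).
  have -> : (q * (q * q) ^ q <= (q - x) * (q * q + z) ^ q)%N =
      (1 <= (1 - x%:q) * (1 + z%:q / q%:R) ^+ q).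
    rewrite -(ler_nat R) !natrM powD natrX natrM natrB //; have [X [<- ->]] := natP x.
    have -> : (q%:R - X * q%:R) * ((q%:R * q%:R) ^+ q * (1 + z%:q / q%:R) ^+ q) =
      q%:R * (q%:R * q%:R) ^+ q * ((1 - X) * (1 + z%:q / q%:R) ^+ q) by ring.
    by rewrite -[leLHS]mulr1 ler_pM2l // mulr_gt0.
  by split=> [|[]].
- set x := u a; set z := u _; rewrite -le_q.
  have [xq|qx] := leqP x (q * q); last first.
    split=> [|[]//]; have -> : (q * q - x = 0)%N by apply/eqP; rewrite subn_eq0 ltnW.
    by rewrite exp0n // muln0 leqn0 muln_eq0 expn_eq0 muln_eq0 (gtn_eqF q0).
  have -> : (q * (q * q) ^ q <= z * (q * q - x) ^ q)%N =
      (1 <= z%:q * (1 - x%:q / q%:R) ^+ q).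
    rewrite -(ler_nat R) !natrM powB // natrX natrM; have [Z [<- ->]] := natP z.
    have -> : Z * q%:R * ((q%:R * q%:R) ^+ q * (1 - x%:q / q%:R) ^+ q) =
      q%:R * (q%:R * q%:R) ^+ q * (Z * (1 - x%:q / q%:R) ^+ q) by ring.
    by rewrite -[leLHS]mulr1 ler_pM2l // mulr_gt0.
  by split=> [|[]].
Qed.

Lemma sub_certE p (v v' : expr m -> nat) e :
  sub_cert H p q v v' e <-> sub_real p%:q (fun e => (v e)%:q) (fun e => (v' e)%:q) e.
Proof.
case: e => [||j|a b|a b|a|a|a] /=.
- by rewrite le_1.
- by rewrite ler_pM2r ?invr_gt0 // ler_nat.
- by rewrite ler_pM2r ?invr_gt0 // ler_nat.
- by rewrite -mulrDl ler_pM2r ?invr_gt0 // -natrD ler_nat.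
- rewrite -(ler_nat R) !natrM; set x := v a; set y := v b; set z := v' _.
  have [X [<- ->]] := natP x. have [Y [<- ->]] := natP y. have [Z [<- ->]] := natP z.
  have -> : X * q%:R * (Y * q%:R) = q%:R * q%:R * (X * Y) by ring.
  have -> : q%:R * (Z * q%:R) = (q%:R * q%:R) * Z by ring.
  by rewrite ler_pM2l ?mulr_gt0.
- rewrite -(ler_nat R) natrD !natrM; set x := v a; set y := v _; set z := v' _.
  have [X [<- ->]] := natP x. have [Y [<- ->]] := natP y. have [Z [<- ->]] := natP z.
  have -> : q%:R * q%:R + X * q%:R * (Y * q%:R) = (q%:R * q%:R) * (1 + X * Y) by ring.
  have -> : q%:R * (Z * q%:R) = (q%:R * q%:R) * Z by ring.
  by rewrite ler_pM2l ?mulr_gt0.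
- set x := v a; set z := v' _.
  have [qx|xq] := leqP q x.
    have -> : (q - x = 0)%N by apply/eqP; rewrite subn_eq0.
    by split=> // _; left; rewrite ler_pdivlMr // mul1r ler_nat.
  have n1 : ~ 1 <= x%:q by rewrite ler_pdivlMr // mul1r ler_nat leqNgt xq.
  rewrite -le_q; have [zq|qz] := leqP z (q * q); last first.
    split=> [|[//|[]//]]; have -> : (q * q - z = 0)%N by apply/eqP; rewrite subn_eq0 ltnW.
    by rewrite exp0n // muln0 leqn0 muln_eq0 expn_eq0 muln_eq0 (gtn_eqF q0) subn_eq0 leqNgt xq.
  have -> : ((q - x) * (q * q) ^ q <= q * (q * q - z) ^ q)%N =
      (1 - x%:q <= (1 - z%:q / q%:R) ^+ q).
    rewrite -(ler_nat R) !natrM powB // natrX natrM natrB ?(ltnW xq) //; have [X [<- ->]] := natP x.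
    have -> : (q%:R - X * q%:R) * (q%:R * q%:R) ^+ q =
      q%:R * (q%:R * q%:R) ^+ q * (1 - X) by ring.
    by rewrite mulrA ler_pM2l // mulr_gt0.
  by split=> [|[//|[]]]; [right|].
- set x := v a; set z := v' _.
  rewrite -(ler_nat R) !natrM powD natrX natrM; have [Z [<- ->]] := natP z.
  have -> : Z * q%:R * (q%:R * q%:R) ^+ q = q%:R * (q%:R * q%:R) ^+ q * Z by ring.
  by rewrite mulrA ler_pM2l // mulr_gt0.
Qed.

(** The domain condition is implicit in the inequalities: for nonnegative values
    [1 + u a * u e <= u e] excludes [1 <= u a], and for [Cyc] equality would make the product 0. *)
Lemma super_real_op x (u : expr m -> R) e : (forall f, 0 <= u f) -> super_real x u e ->
  opdom u e /\ opval H x u e <= u e.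
Proof.
case: e => [||j|a b|a b|a|a|a] //= u0.
- move=> h; have ha := u0 a; have he := u0 (ESeq a).
  have d : 0 < 1 - u a.
    rewrite ltNge; apply/negP => h1; have : u (ESeq a) * (1 - u a) <= 0 by rewrite mulr_ge0_le0.
    by lra.
  split; first lra.
  by rewrite -[leLHS]mul1r ler_pdivrMr //; lra.
- move=> [h1 h2]; have he := u0 (ECyc a).
  have d : 0 < 1 - u a.
    by rewrite lt_neqAle subr_ge0 h1 andbT; apply/eqP => e; rewrite -e mul0r ler10 in h2.
  split; first lra.
  have p0 : 0 <= 1 + u (ECyc a) / q%:R by rewrite addr_ge0 // divr_ge0.
  have h3 := expo_le q0 p0.
  rewrite -ler_expR expRN lnK ?posrE // -[leLHS]mul1r ler_pdivrMr // mulrC.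
  by apply: le_trans h2 _; rewrite ler_wpM2l // ltW.
- move=> [h1 h2]; split=> //; have he := u0 (ESet a).
  have p0 : 0 <= 1 + (- u a) / q%:R by rewrite mulNr subr_ge0 ler_pdivrMr // mul1r.
  have h3 := expo_le q0 p0; rewrite mulNr in h3.
  rewrite -[leLHS]mulr1; apply: le_trans (ler_wpM2l (expR_ge0 _) h2) _.
  rewrite mulrCA ler_piMr // -[leRHS](expRxMexpNx_1 (u a)).
  by rewrite ler_wpM2l ?expR_ge0.
Qed.

Lemma sub_real_op x (v v' w : expr m -> R) e :
  (forall f, arg H e f \/ f = e -> 0 <= v f <= w f) -> 0 <= v' e ->
  opdom w e -> w e = opval H x w e -> sub_real x v v' e -> v' e <= w e.
Proof.
move=> h v'0; have h1 f : arg H e f -> 0 <= v f <= w f by move=> ef; apply: h; left.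
have /andP[ve0 ve] := h e (or_intror erefl).
case: e h h1 v'0 ve0 ve => [||j|a b|a b|a|a|a] //= h h1 v'0 ve0 ve d we.
- by rewrite we.
- by rewrite we.
- by move=> h'; apply: le_trans h' _; rewrite we; have /andP[] := h1 _ erefl.
- move=> h'; apply: le_trans h' _; rewrite we; have /andP[_ ha] := h1 a (or_introl erefl).
  by have /andP[_ hb] := h1 b (or_intror erefl); rewrite lerD.
- move=> h'; apply: le_trans h' _; rewrite we; have /andP[a0 ha] := h1 a (or_introl erefl).
  by have /andP[b0 hb] := h1 b (or_intror erefl); rewrite ler_pM.
all: have /andP[a0 ha] := h1 a erefl.
- move=> h'; apply: le_trans h' _; have d' : 0 < 1 - w a by rewrite subr_gt0.
  have e2 : w (ESeq a) * (1 - w a) = 1 by rewrite we mulVf // gt_eqF.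
  have : v a * v (ESeq a) <= w a * w (ESeq a) by apply: ler_pM.
  lra.
- case=> [h'|[h2 h3]]; first by lra.
  have d' : 0 < 1 - w a by rewrite subr_gt0.
  have p0 : 0 <= 1 + (- v' (ECyc a)) / q%:R by rewrite mulNr subr_ge0 ler_pdivrMr // mul1r.
  have h4 := expo_le q0 p0; rewrite mulNr in h4.
  rewrite we lerNr -ler_expR lnK ?posrE //; apply: le_trans (le_trans h3 h4).
  by rewrite lerD2l lerN2.
- move=> h'; apply: le_trans h' _; rewrite we.
  have p0 : 0 <= 1 + v a / q%:R by rewrite addr_ge0 // divr_ge0.
  by apply: le_trans (expo_le q0 p0) _; rewrite ler_expR.
Qed.

End RealCertificate.

(** * Soundness of certificates and existence of upper bounds *)

Section Eventually.

Lemma eventually_seq (T : eqType) (s : seq T) (P : T -> nat -> Prop) :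
  (forall e, e \in s -> exists Q, forall q, (Q <= q)%N -> P e q) ->
  exists Q, forall q, (Q <= q)%N -> forall e, e \in s -> P e q.
Proof.
elim: s => [|e s IHs] h; first by exists 0%N.
have [|Q hQ] := IHs; first by move=> f fs; apply: h; rewrite inE fs orbT.
have [Q' hQ'] := h e (mem_head _ _).
exists (maxn Q Q') => q; rewrite geq_max => /andP[Qq Q'q] f.
by rewrite inE => /predU1P[->|fs]; [apply: hQ'|apply: hQ].
Qed.

Variable R : realType.

Lemma eventually_inv (d : R) : 0 < d -> exists Q, forall q, (Q <= q)%N -> (0 < q)%N /\ q%:R^-1 <= d.
Proof.
move=> d0; exists (Num.bound d^-1).+1 => q qQ; split; first exact: leq_ltn_trans qQ.
rewrite -[leRHS]invrK lef_pV2 ?posrE ?invr_gt0 // ?ltr0n; last exact: leq_ltn_trans qQ.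
apply: le_trans (ltW (archi_boundP _)) _; first by rewrite invr_ge0 ltW.
by rewrite ler_nat ltnW.
Qed.

Lemma bernoulli_le (D : nat) (h : R) : 0 <= h -> h <= 1 -> 1 - D%:R * h <= (1 - h) ^+ D.
Proof.
move=> h0 h1; elim: D => [|D IHD]; first by rewrite mul0r subr0 expr0.
have d0 : 0 <= D%:R * h by rewrite mulr_ge0.
rewrite exprS; apply: (@le_trans _ _ ((1 - h) * (1 - D%:R * h))).
  by rewrite -natr1; nra.
by rewrite ler_wpM2l // subr_ge0.
Qed.

(** Rounding up must fix 0: where an iterate vanishes, damping has created no slack above it. *)
Definition nat_above (z : R) : nat := if z == 0 then 0%N else (Num.truncn z).+1.

Lemma nat_above_ge z : 0 <= z -> z <= (nat_above z)%:R.
Proof.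
by move=> z0; rewrite /nat_above; case: eqP => [->//|_]; rewrite ltW // truncnS_gt.
Qed.

Lemma nat_above_le z : 0 <= z -> (nat_above z)%:R <= z + 1.
Proof.
move=> z0; rewrite /nat_above; case: eqP => [->|_]; first by rewrite addr_ge0.
by rewrite -natr1 lerD2r truncn_le.
Qed.
End Eventually.

Section Approximation.
Variables (m : nat) (H : specification m) (R : realType) (c : 'I_m -> nat -> R).
Hypothesis citer_lim : forall p, exists N, forall N', (N <= N')%N ->
  forall j k, (k <= p)%N -> citer H R N' j k = c j k.
Hypothesis no_size0_arg : forall e, e \in nodes H ->
  match e with ESeq a | ECyc a | ESet a => cexpr c a 0%N = 0 | _ => True end.
Hypothesis c_neq0 : forall j, exists n, 0 < c j n.
Hypothesis c_nat : forall j, exists k : nat, c j 0%N = k%:R.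
Variables (i : 'I_m) (rho : R).
Hypothesis rho0 : 0 < rho.
Hypothesis F_lt : forall x, 0 < x -> x < rho -> finite_value c (EVar i) x.
Hypothesis F_gt : forall x, rho < x -> ~ finite_value c (EVar i) x.

Local Notation A := (cexpr c).
Local Notation F := (finite_value c).
Local Notation V := (value c).
Local Notation arg := (arg H).
Local Notation reach := (reach H).
Local Notation nodes := (nodes H).
Local Notation W := (reach (EVar i)).

Let A0 e : nonneg (A e) := limit_ge0 citer_lim e.

Let W_node e : W e -> e \in nodes. Proof. exact/nodes_reach/nodes_var. Qed.

Let W_F e x : W e -> 0 < x -> x < rho -> F e x.
Proof.
move=> We x0 xr; apply: (finite_reach citer_lim no_size0_arg c_neq0 x0 _ We); first exact: nodes_var.
exact: F_lt.
Qed.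

Section Sound.
Variables (e1 : expr m) (M : nat).
Hypothesis We1 : W e1.
Hypothesis M0 : (0 < M)%N.
Hypothesis pole : forall x, 0 < x -> x < rho -> V x e1 * (rho - x) <= M%:R.

Lemma certificate_sound n B b : certificate H (fun e => `[< W e >]) e1 M n B b ->
  (0 < digit B b 2)%N /\ `|rho - (digit B b 0)%:R / (digit B b 2)%:R| <= 2 ^- n.
Proof.
rewrite /certificate; set p := digit B b 0; set p' := digit B b 1.
set q := digit B b 2; set s := digit B b 3.
case/and5P=> q0 p'0 pp' /allP hsuper /and3P[/allP hv0 /allP hsub hM]; split=> //.
have qR : 0 < q%:R :> R by rewrite ltr0n.
pose x : R := p%:R / q%:R; pose y : R := p'%:R / q%:R.
have x0 : 0 <= x by rewrite divr_ge0.
have y0 : 0 < y by rewrite divr_gt0 ?ltr0n.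
have xr : x <= rho.
  rewrite leNgt; apply/negP => rx; apply: (F_gt rx).
  have [] // := @finite_super m H R c citer_lim W x (fun e => (cert_super H B b e)%:R / q%:R) x0 _ _ (EVar i).
  - by move=> e f We ef; apply: reach_step ef.
  - move=> e We; have := hsuper e (W_node We); rewrite asboolT //= => /(@super_certE m H R q q0) h.
    have [h1 h2] := super_real_op q0 (fun f => divr_ge0 (ler0n _ _) (ler0n _ _)) h.
    by split=> //; rewrite divr_ge0.
  - exact: reach_refl.
(* Convergence at [y] is assumed, as there may be no value to compare with otherwise; if [rho <= y],
   then [yx] alone gives the result. *)
have low t e : (t <= s)%N -> e \in nodes -> F e y -> (cert_sub H B b t e)%:R / q%:R <= V y e.
  elim: t e => [|t IHt] e ts en Fe.
    have := hv0 e en; rewrite leqn0 => /eqP->; rewrite mul0r; exact: psup_ge0.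
  have [d ve] := value_eq citer_lim no_size0_arg c_neq0 en y0 Fe.
  have /allP/(_ e en)/(@sub_certE m H R q q0) h := hsub t ltac:(by rewrite mem_iota add0n).
  apply: (sub_real_op q0 _ _ d ve h); last by rewrite divr_ge0.
  move=> f ef; rewrite divr_ge0 //= IHt ?(ltnW ts) //.
    by case: ef => [/(nodes_arg en)|->].
  by case: ef => [ef|->] //; apply: (finite_arg citer_lim no_size0_arg c_neq0 y0 en ef).
have yx : y - x <= 2 ^- n.+1.
  rewrite /y /x -mulrBl ler_pdivrMr // mulrC ler_pdivlMr ?exprn_gt0 //.
  have := pp'; rewrite -(ler_nat R) natrD !natrM natrX; lra.
have hV : F e1 y -> M%:R * 2 ^+ n.+1 < V y e1.
  move=> Fe; apply: lt_le_trans (low s e1 (leqnn s) (W_node We1) Fe).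
  by rewrite ltr_pdivlMr // -natrX -!natrM ltr_nat.
have e2 : 2 ^- n = 2 ^- n.+1 + 2 ^- n.+1 :> R.
  by rewrite exprS invfM; lra.
rewrite ger0_norm ?subr_ge0 // -/x e2.
have [yr|ry] := ltrP y rho; last first.
  have : 0 < 2 ^- n.+1 :> R by rewrite invr_gt0 exprn_gt0.
  lra.
suff : rho - y <= 2 ^- n.+1 by lra.
have h1 := hV (W_F We1 y0 yr); have h2 := pole y0 yr.
have yr' : 0 < rho - y by rewrite subr_gt0.
have h3 : M%:R * 2 ^+ n.+1 * (rho - y) <= M%:R.
  by apply: le_trans h2; rewrite ler_wpM2r // ltW.
rewrite -[leRHS]mul1r ler_pdivlMr ?exprn_gt0 // -(ler_pM2l (_ : 0 < M%:R :> R)) ?ltr0n //.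
by rewrite mulr1; lra.
Qed.
End Sound.

(** * Upper bounds below the radius *)

Section Super.
Variables (x x' : R).
Hypothesis x0 : 0 < x.
Hypothesis xx' : x < x'.
Hypothesis x'r : x' < rho.

(* The values at [x'] give nonstrict inequalities at [x]; averaging with the
   image makes them strict without losing those that are strict already. *)
Fixpoint average (t : nat) (e : expr m) : R :=
  if t is t'.+1 then (average t' e + opval H x (average t') e) / 2 else V x' e.

Local Notation u := average.

Let x'0 : 0 < x'. Proof. exact: lt_trans xx'. Qed.

Let Veq e : W e -> opdom (V x') e /\ V x' e = opval H x' (V x') e.
Proof. by move=> We; apply: value_eq => //; [apply: W_node|apply: W_F]. Qed.

(** Write [T] for the operator at [x]. By monotonicity [T (u t.+1) <= T (u t)], and [T (u t)] is at
    most its average with [u t]. *)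
Lemma average_super t e : W e -> [/\ 0 < u t e, opdom (u t) e & opval H x (u t) e <= u t e].
Proof.
elim: t e => [|t IHt] e We.
  have [d v] := Veq We.
  have p f : W f -> 0 < V x' f.
    by move=> Wf; apply: (value_gt0 citer_lim no_size0_arg c_neq0) => //; [apply: W_node|apply: W_F].
  split=> //; first exact: p.
  rewrite [leRHS]v; have [] // := opval_le (H := H) (x := x) (x' := x') (u := V x') (u' := V x') (e := e).
    exact: ltW.
  by move=> f ef; rewrite lexx andbT ltW // p //; apply: reach_step ef.
have [u0 d v] := IHt e We.
have T0 : 0 < opval H x (u t) e.
  by apply: opval_gt0 => // f ef; have [] := IHt f (reach_step We ef).
have [|d' v'] := opval_le (H := H) (u := u t.+1) (u' := u t) (e := e) (lexx x) _ d.
  move=> f ef; have [f0 fd fv] := IHt f (reach_step We ef).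
  have f1 : 0 < opval H x (u t) f.
    by apply: opval_gt0 => // g fg; have [] := IHt g (reach_step (reach_step We ef) fg).
  by rewrite /=; apply/andP; split; lra.
by split=> //=; [lra|apply: le_trans v' _; lra].
Qed.

Lemma average_le t e : W e -> u t.+1 e <= u t e.
Proof. by move=> We; have [_ _ h] := average_super t We; rewrite /=; lra. Qed.

Lemma average_arg t e f : W e -> arg e f -> 0 < u t.+1 f <= u t f.
Proof.
move=> We ef; have Wf := reach_step We ef.
by rewrite average_le // andbT; have [] := average_super t.+1 Wf.
Qed.

Let strict t e := opval H x (u t) e < u t e.

Lemma strictS t e : W e -> strict t e -> strict t.+1 e.
Proof.
rewrite /strict => We h; have [_ d _] := average_super t We.
have [|_ v] := opval_le (H := H) (u := u t.+1) (u' := u t) (e := e) (lexx x) _ d.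
  by move=> f ef; have /andP[/ltW-> ->] := average_arg t We ef.
by apply: le_lt_trans v _; rewrite /=; lra.
Qed.

(** Strictness at [f] lowers its next value, hence strictly lowers the image at [e], while the next
    value at [e] remains at least the previous image. *)
Lemma strict_arg t e f : W e -> arg e f -> strict t f -> strict t.+1 e.
Proof.
rewrite /strict => We ef hf; have [_ d v] := average_super t We.
have h : opval H x (u t.+1) e < opval H x (u t) e.
  apply: (@opval_lt m H R x (u t.+1) (u t) e f) => //; first by move=> g; apply: average_arg.
  by rewrite /=; lra.
by apply: lt_le_trans h _; rewrite /=; lra.
Qed.

Lemma strict_atom e : W e -> reach e EAtom -> exists t, strict t e.
Proof.
move=> We re; suff : W e -> exists t, strict t e by apply.
apply: (@reach_closed m H (fun e => W e -> exists t, strict t e) e EAtom) => //.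
  move=> f g fg IH Wf; have [t ht] := IH (reach_step Wf fg).
  by exists t.+1; apply: strict_arg fg ht.
(* The atom is strict from the start, with value [x' > x]. *)
by move=> Wa; exists 0%N; rewrite /strict /= (proj2 (Veq Wa)).
Qed.

Lemma strict_uniform : exists t, forall e, e \in nodes -> W e -> reach e EAtom -> strict t e.
Proof.
have [|t ht] := @eventually_seq (expr m) nodes (fun e t => W e -> reach e EAtom -> strict t e).
  move=> e _; have [[We re]|n] := pselect (W e /\ reach e EAtom); last first.
    by exists 0%N => t _ We re; case: n.
  have [t ht] := strict_atom We re; exists t => t' tt' _ _.
  elim: t' tt' => [|t' IH]; first by rewrite leqn0 => /eqP <-.
  rewrite leq_eqVlt => /predU1P[<-//|tt']; exact: strictS (IH tt').
by exists t => e en We re; apply: (ht t).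
Qed.

Lemma const_coef e n : ~ reach e EAtom -> A e n.+1 = 0.
Proof.
have sm (a b : nat -> R) : (forall n, a n.+1 = 0) -> (forall n, b n.+1 = 0) ->
    forall n, seqmul a b n.+1 = 0.
  move=> ha hb k; rewrite /seqmul big_ord_recl subn0 hb mulr0 add0r.
  by apply: big1 => j _; rewrite lift0 ha mul0r.
have cs (phi a : nat -> R) : (forall n, a n.+1 = 0) -> forall n, csub phi a n.+1 = 0.
  move=> ha k; have pw j l : cpow a j l.+1 = 0 by elim: j l => // j IH l; apply: sm.
  by apply: big1 => j _; rewrite pw mulr0.
have main (c' : 'I_m -> nat -> R) : (forall j n, ~ reach (EVar j) EAtom -> c' j n.+1 = 0) ->
    forall e n, ~ reach e EAtom -> cexpr c' e n.+1 = 0.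
  move=> hc; elim=> [||j|a IHa b IHb|a IHa b IHb|a IHa|a IHa|a IHa] k nr //.
  - by case: nr; apply: reach_refl.
  - exact: hc.
  - have na g : arg (ESum a b) g -> ~ reach g EAtom.
      by move=> ag ga; apply: nr; apply: reach_trans ga; apply: reach_step ag; apply: reach_refl.
    by rewrite /= IHa ?IHb ?addr0 //; apply: na; rewrite /=; auto.
  - have na g : arg (EProd a b) g -> ~ reach g EAtom.
      by move=> ag ga; apply: nr; apply: reach_trans ga; apply: reach_step ag; apply: reach_refl.
    by apply: sm => k'; [apply: IHa|apply: IHb]; apply: na; rewrite /=; auto.
  - apply: cs => k'; apply: IHa => ga; apply: nr; apply: reach_trans ga.
    by apply: reach_step; [apply: reach_refl|].
  - apply: cs => k'; apply: IHa => ga; apply: nr; apply: reach_trans ga.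
    by apply: reach_step; [apply: reach_refl|].
  - apply: cs => k'; apply: IHa => ga; apply: nr; apply: reach_trans ga.
    by apply: reach_step; [apply: reach_refl|].
move=> nr; have [N /(_ N (leqnn N) e n.+1 (leqnn _)) <-] := cexpr_lim citer_lim n.+1.
elim: N e n nr => [|N IHN] e n nr; apply: main => // j k nj /=.
apply: IHN => hj; apply: nj; apply: reach_trans hj.
by apply: reach_step; [apply: reach_refl|].
Qed.

(** Without atoms no slack can be gained, since averaging changes nothing. But the value is a
    natural number by [limit0_nat], so the certificate holds exactly. *)
Lemma average_const t e : W e -> ~ reach e EAtom -> u t e = A e 0%N.
Proof.
have vc f : ~ reach f EAtom -> V x' f = A f 0%N.
  by move=> nf; apply: psup_const => //; [apply: ltW|move=> n; apply: const_coef].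
elim: t e => [|t IHt] e We ne; first exact: vc.
have -> : u t.+1 e = (u t e + opval H x (u t) e) / 2 by [].
have na f : arg e f -> ~ reach f EAtom.
  by move=> ef fa; apply: ne; apply: reach_trans fa; apply: reach_step ef; apply: reach_refl.
have -> : opval H x (u t) e = opval H x (V x') e.
  by apply: eq_opval => f ef; rewrite IHt ?vc //; [apply: na|apply: reach_step ef|apply: na].
have -> : opval H x (V x') e = V x' e.
  have [_ ->] := Veq We; case: e {We na} ne => //= ne; by case: ne; apply: reach_refl.
by rewrite IHt // vc //; lra.
Qed.

Lemma exists_super : exists Q, forall q, (Q <= q)%N -> forall p, p%:R <= x * q%:R ->
  exists un, forall e, e \in nodes -> W e -> super_cert H p q un e.
Proof.
have [t ht] := strict_uniform.
have [Q hQ] : exists Q, forall q, (Q <= q)%N -> forall e, e \in nodes -> forall p,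
    p%:R <= x * q%:R -> W e -> super_cert H p q (fun f => Num.truncn (u t f * q%:R)) e.
  apply: eventually_seq => e en.
  have [We|nWe] := pselect (W e); last by exists 0%N.
  have [e0 d v] := average_super t We.
  have ua f : arg e f -> 0 < u t f by move=> ef; have [] := average_super t (reach_step We ef).
  have tru q f : 0 <= u t f -> (0 < q)%N -> (Num.truncn (u t f * q%:R))%:R / q%:R <= u t f :> R.
    by move=> f0 q0; rewrite ler_pdivrMr ?ltr0n // truncn_le // mulr_ge0.
  have [re|nre] := pselect (reach e EAtom); last first.
    have cst f : W f -> ~ reach f EAtom -> exists2 k : nat, u t f = k%:R &
        forall q, Num.truncn (u t f * q%:R) = (k * q)%N.
      move=> Wf nf; have [k hk] := limit0_nat c_nat (W_node Wf).
      by exists k; rewrite average_const // => q; rewrite hk -natrM natrK.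
    have na f : arg e f -> ~ reach f EAtom.
      by move=> ef fa; apply: nre; apply: reach_trans fa; apply: reach_step ef; apply: reach_refl.
    (* A constant expression is no [Seq], [Cyc] or [Set]: the argument would have neither a constant
       term nor any other. *)
    have zero a : arg e a -> A a 0%N = 0 -> False.
      move=> ea a0; have [[|n]] := limit_neq0 citer_lim no_size0_arg c_neq0 (nodes_arg en ea).
        by rewrite a0 ltxx.
      by rewrite const_coef ?ltxx //; apply: na.
    exists 1%N => q q0 p hp _; have [k uk tk] := cst e We nre.
    have ns := no_size0_arg en.
    case: e en We e0 d v ua nre na zero ns k uk tk => [||j|a b|a b|a|a|a] en We e0 d v ua nre na zero ns k uk tk;
      rewrite /super_cert.
    + by move: v; rewrite tk /= uk ler1n => k0; rewrite leq_pmull.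
    + by case: nre; apply: reach_refl.
    + have [k' uk' tk'] := cst _ (reach_step We erefl) (na _ erefl).
      by move: v; rewrite tk tk' /= uk uk' ler_nat leq_mul2r => ->; rewrite orbT.
    + have [k1 uk1 tk1] := cst _ (reach_step We (or_introl erefl)) (na _ (or_introl erefl)).
      have [k2 uk2 tk2] := cst _ (reach_step We (or_intror erefl)) (na _ (or_intror erefl)).
      by move: v; rewrite tk tk1 tk2 /= uk uk1 uk2 -natrD ler_nat -mulnDl leq_mul2r => ->; rewrite orbT.
    + have [k1 uk1 tk1] := cst _ (reach_step We (or_introl erefl)) (na _ (or_introl erefl)).
      have [k2 uk2 tk2] := cst _ (reach_step We (or_intror erefl)) (na _ (or_intror erefl)).
      move: v; rewrite tk tk1 tk2 /= uk uk1 uk2 -natrM ler_nat => v.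
      by rewrite mulnACA [leqRHS]mulnCA leq_mul2r v orbT.
    + by case: (zero _ erefl ns).
    + by case: (zero _ erefl ns).
    + by case: (zero _ erefl ns).
  (* The midpoint [g] divides the slack: rounding down stays above [g] when [1 / q] is small, and
     [g] exceeds the image strictly, as [expo_lim] requires. *)
  have hs := ht e en We re; pose g := (opval H x (u t) e + u t e) / 2.
  have g1 : opval H x (u t) e < g by rewrite /g; rewrite /strict in hs; lra.
  have g2 : g < u t e by rewrite /g; rewrite /strict in hs; lra.
  have [Q1 hQ1] := @eventually_inv R (u t e - g) ltac:(by rewrite subr_gt0).
  have T0 : 0 < opval H x (u t) e by apply: opval_gt0.
  have [Q2 hQ2] : exists Q2, forall q, (Q2 <= q)%N -> (0 < q)%N -> forall p,
     p%:R <= x * q%:R -> forall U : expr m -> R,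
     (forall f, arg e f -> 0 <= U f <= u t f) -> g <= U e -> super_real H q (p%:R / q%:R) U e.
    case: e en We e0 d v ua re hs g g1 g2 hQ1 T0 => [||j|a b|a b|a|a|a] /= en We e0 d v ua re hs g g1 g2 hQ1 T0.
    + by exists 0%N => q _ q0 p hp U hU gU; lra.
    + exists 0%N => q _ q0 p hp U hU gU; rewrite ler_pdivrMr ?ltr0n //.
      by apply: le_trans hp _; rewrite ler_wpM2r //; lra.
    + by exists 0%N => q _ q0 p hp U hU gU; have /andP[_ h] := hU _ erefl; lra.
    + exists 0%N => q _ q0 p hp U hU gU; have /andP[_ h] := hU _ (or_introl erefl).
      by have /andP[_ h'] := hU _ (or_intror erefl); lra.
    + exists 0%N => q _ q0 p hp U hU gU; have /andP[h0 h] := hU _ (or_introl erefl).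
      have /andP[h0' h'] := hU _ (or_intror erefl).
      by have := ler_pM h0 h0' h h'; lra.
    + exists 0%N => q _ q0 p hp U hU gU; have /andP[h0 h] := hU _ erefl.
      have d' : 0 < 1 - u t a by rewrite subr_gt0.
      have h1 : 1 <= g * (1 - u t a) by rewrite -ler_pdivrMr // mul1r ltW.
      have h2 : g * (1 - u t a) <= U (ESeq a) * (1 - U a).
        by apply: ler_pM => //; lra.
      by lra.
    + have d' : 0 < 1 - u t a by rewrite subr_gt0.
      have [Q hQ] : exists Q : nat, forall q, (Q <= q)%N ->
          [/\ (0 < q)%N, 0 < 1 + g / q%:R & (1 - u t a)^-1 <= (1 + g / q%:R) ^+ q].
        by apply: expo_lim; rewrite -[ltLHS]lnK ?posrE ?invr_gt0 // ltr_expR lnV ?posrE.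
      exists Q => q Qq q0 p hp U hU gU; have /andP[h0 h] := hU _ erefl.
      have [_ b1 b2] := hQ q Qq; split; first by lra.
      have qR : 0 < q%:R :> R by rewrite ltr0n.
      have b3 : (1 + g / q%:R) ^+ q <= (1 + U (ECyc a) / q%:R) ^+ q.
        have b4 : g / q%:R <= U (ECyc a) / q%:R by rewrite ler_pM2r ?invr_gt0.
        by apply: lerXn2r; rewrite ?nnegrE; lra.
      apply: (@le_trans _ _ ((1 - u t a) * (1 - u t a)^-1)); first by rewrite mulfV // gt_eqF.
      apply: ler_pM; rewrite ?invr_ge0 ?(ltW d') //; first by lra.
      exact: le_trans b3.
    + have [Q hQ] : exists Q : nat, forall q, (Q <= q)%N ->
          [/\ (0 < q)%N, 0 < 1 + (- u t a) / q%:R & g^-1 <= (1 + (- u t a) / q%:R) ^+ q].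
        apply: expo_lim; rewrite expRN ltf_pV2 ?posrE ?expR_gt0 //; lra.
      exists Q => q Qq q0 p hp U hU gU; have /andP[h0 h] := hU _ erefl.
      have [_ b1 b2] := hQ q Qq; rewrite mulNr in b1 b2.
      have qR : 0 < q%:R :> R by rewrite ltr0n.
      have b4 : U a / q%:R <= u t a / q%:R by rewrite ler_pM2r ?invr_gt0.
      split; first by rewrite -[q%:R]mul1r -ler_pdivrMr //; lra.
      have g0 : 0 < g by lra.
      apply: (@le_trans _ _ (g * g^-1)); first by rewrite mulfV // gt_eqF.
      apply: ler_pM; rewrite ?invr_ge0 ?(ltW g0) //; apply: le_trans b2 _.
      by apply: lerXn2r; rewrite ?nnegrE; lra.
  exists (maxn Q1 Q2) => q; rewrite geq_max => /andP[q1 q2] p hp _.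
  have [q0 hq] := hQ1 q q1; apply/(@super_certE m H R q q0).
  apply: (hQ2 q q2 q0 p hp) => [f ef|].
    by rewrite divr_ge0 //= tru // ltW // ua.
  have qR : 0 < q%:R :> R by rewrite ltr0n.
  have := truncnS_gt (u t e * q%:R); rewrite -natr1 => h.
  apply: (@le_trans _ _ (u t e - q%:R^-1)); first by lra.
  by rewrite ler_pdivlMr // mulrBl mulVf ?gt_eqF //; lra.
by exists Q => q Qq p hp; exists (fun f => Num.truncn (u t f * q%:R)) => e en We; apply: hQ.
Qed.
End Super.
End Approximation.

(** * Existence of lower bounds *)

Section Sub.
Variables (m : nat) (H : specification m) (R : realType) (c : 'I_m -> nat -> R).
Hypothesis citer_lim : forall p, exists N, forall N', (N <= N')%N ->
  forall j k, (k <= p)%N -> citer H R N' j k = c j k.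
Variables (y : R).
Hypothesis y0 : 0 <= y.

(** Since [y] may lie beyond the radius, arguments of [Cyc] may exceed 1; truncated series are
    defined there. They are also polynomials, so damping costs only a power of [r]. *)
Definition subop (s : nat) (w : expr m -> R) (e : expr m) : R :=
  match e with
  | EOne => 1
  | EAtom => y
  | EVar j => w (H j)
  | ESum a b => w a + w b
  | EProd a b => w a * w b
  | ESeq a => 1 + w a * w e
  | ECyc a => psum (@cyc_coef R) s (w a)
  | ESet a => psum (@set_coef R) s (w a)
  end.

(* The factor [r < 1] leaves room for rounding up to multiples of [1 / q]. *)
Fixpoint damped (r : R) (s : nat) (e : expr m) : R :=
  if s is s'.+1 then r * subop s' (damped r s') e else 0.

Lemma subop_ge0 s w e : (forall f, 0 <= w f) -> 0 <= subop s w e.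
Proof.
move=> w0; case: e => [||j|a b|a b|a|a|a] //=.
- exact: addr_ge0.
- exact: mulr_ge0.
- by rewrite addr_ge0 ?mulr_ge0.
- by apply: psum_ge0 => //; apply: cyc_coef_ge0.
- by apply: psum_ge0 => //; apply: set_coef_ge0.
Qed.

Lemma damped_ge0 r s e : 0 <= r -> 0 <= damped r s e.
Proof. by move=> r0; elim: s e => //= s IHs e; rewrite mulr_ge0 ?subop_ge0. Qed.

Lemma psum_damp (phi : nat -> R) s r D (w : R) : nonneg phi -> 0 <= r -> r <= 1 -> 0 <= w ->
  r ^+ (D * s) * psum phi s w <= psum phi s (r ^+ D * w).
Proof.
move=> p0 r0 r1 w0; rewrite /psum mulr_sumr; apply: ler_sum => k _.
rewrite exprMn -exprM mulrCA ler_wpM2l // ler_wpM2r ?exprn_ge0 //.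
by apply: ler_wiXn2l => //; rewrite leq_mul2l ltnW ?orbT.
Qed.

(** [D] depends only on [s], so that for fixed [s] the loss disappears as [r] tends to 1. *)
Lemma damped_bound s : exists D, forall r e, 0 <= r -> r <= 1 ->
  r ^+ D * damped 1 s e <= damped r s e.
Proof.
elim: s => [|s [D hD]]; first by exists 0%N => r e _ _; rewrite /= mulr0.
(* [subop s] has degree at most [s.+2] in the values, each of which loses [r ^+ D]; one more [r]
   comes from the outer factor. *)
exists (D * s.+2).+1 => r e r0 r1; rewrite /= mul1r exprS -mulrA ler_wpM2l //.
pose w := damped 1 s; pose w' := damped r s.
have w0 f : 0 <= w f by apply: damped_ge0.
have hw f : r ^+ D * w f <= w' f by apply: hD.
have p k : 0 <= r ^+ k by apply: exprn_ge0.
have d1 k : (k <= s.+2)%N -> r ^+ (D * s.+2) <= r ^+ (D * k).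
  by move=> ks; apply: ler_wiXn2l => //; rewrite leq_mul2l ks orbT.
have e1 : r ^+ (D * s.+2) <= r ^+ D by have := d1 1%N isT; rewrite muln1.
have e2 : r ^+ (D * s.+2) <= r ^+ D * r ^+ D by have := d1 2%N isT; rewrite muln2 -addnn exprD.
have e3 : r ^+ (D * s.+2) <= 1 by have := d1 0%N isT; rewrite muln0.
have es : r ^+ (D * s.+2) <= r ^+ (D * s) by apply: d1; rewrite ltnW.
have mul a b : r ^+ (D * s.+2) * (w a * w b) <= w' a * w' b.
  apply: (@le_trans _ _ ((r ^+ D * w a) * (r ^+ D * w b))).
    by rewrite mulrACA ler_wpM2r ?mulr_ge0.
  by apply: ler_pM; rewrite ?mulr_ge0.
have lin a : r ^+ (D * s.+2) * w a <= w' a by apply: le_trans (hw a); rewrite ler_wpM2r.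
have ps phi a : nonneg phi -> r ^+ (D * s.+2) * psum phi s (w a) <= psum phi s (w' a).
  move=> p0; apply: (@le_trans _ _ (r ^+ (D * s) * psum phi s (w a))).
    by rewrite ler_wpM2r ?psum_ge0.
  by apply: le_trans (psum_damp s D p0 r0 r1 (w0 a)) _; apply: psum_le => //; rewrite mulr_ge0.
rewrite -/w -/w'; case: e => [||j|a b|a b|a|a|a] /=.
- by rewrite mulr1.
- by rewrite ler_piMl.
- exact: lin.
- by rewrite mulrDr lerD.
- exact: mul.
- by rewrite mulrDr mulr1 lerD.
- by apply: ps; apply: cyc_coef_ge0.
- by apply: ps; apply: set_coef_ge0.
Qed.

Lemma psum_seqS K (t : R) : psum (@seq_coef R) K.+1 t = 1 + t * psum (@seq_coef R) K t.
Proof.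
rewrite /psum big_ord_recl mulr_sumr /seq_coef /= mul1r; congr (_ + _).
by apply: eq_bigr => k _; rewrite !mul1r exprS.
Qed.

Lemma damped_limit N e M : exists s0, forall s, (s0 <= s)%N ->
  psum (cexpr (citer H R N) e) M y <= damped 1 s e.
Proof.
have w0 s f : 0 <= damped 1 s f by apply: damped_ge0.
have main (c' : 'I_m -> nat -> R) : (forall j, nonneg (c' j)) ->
    (forall j M, exists s0, forall s, (s0 <= s)%N -> psum (c' j) M y <= damped 1 s (EVar j)) ->
    forall e M, exists s0, forall s, (s0 <= s)%N -> psum (cexpr c' e) M y <= damped 1 s e.
  move=> c0 hc; have A0 e' := cexpr_ge0 e' c0.
  elim=> [||j|a IHa b IHb|a IHa b IHb|a IHa|a IHa|a IHa] K.
  - by exists 1%N => -[//|s] _ /=; rewrite mulr1; apply: (psum_delta 0%N K y0).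
  - by exists 1%N => -[//|s] _ /=; rewrite mul1r; apply: (psum_delta 1%N K y0).
  - exact: hc.
  - have [s1 h1] := IHa K; have [s2 h2] := IHb K; exists (maxn s1 s2).+1 => -[//|s].
    by rewrite ltnS geq_max => /andP[l1 l2]; rewrite /= mul1r psumD lerD ?h1 ?h2.
  - have [s1 h1] := IHa K; have [s2 h2] := IHb K; exists (maxn s1 s2).+1 => -[//|s].
    rewrite ltnS geq_max => /andP[l1 l2]; rewrite /= mul1r.
    apply: le_trans (psum_seqmul_le _ _ _ _) _ => //.
    by apply: ler_pM; rewrite ?psum_ge0 ?h1 ?h2.
  - have [s1 h1] := IHa K; set t := psum _ K y in h1.
    have t0 : 0 <= t by apply: psum_ge0.
    (* From step [s1] on the argument is at least [t], and each further step adds a term of the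
       geometric series. *)
    have hs k s : (s1 + k <= s)%N -> psum (@seq_coef R) k t <= damped 1 s (ESeq a).
      elim: k s => [|k IHk] s; first by rewrite /psum big_ord0.
      case: s => [|s]; first by rewrite addnS.
      rewrite addnS ltnS => ls; rewrite psum_seqS /= mul1r lerD2l.
      apply: ler_pM => //; first by apply: psum_ge0.
        by apply: h1; apply: leq_trans ls; apply: leq_addr.
      exact: IHk.
    by exists (s1 + K)%N => s ls; apply: le_trans (psum_csub_le _ _ _ _) (hs _ _ ls).
  - have [s1 h1] := IHa K; exists (maxn s1 K).+1 => -[//|s].
    rewrite ltnS geq_max => /andP[l1 l2]; rewrite /= mul1r.
    apply: le_trans (psum_csub_le _ (@cyc_coef_ge0 R) _ _) _ => //.
    apply: le_trans (psum_leM (@cyc_coef_ge0 R) _ l2) _; first exact: psum_ge0.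
    by apply: psum_le (@cyc_coef_ge0 R) _ _; [apply: psum_ge0|apply: h1].
  - have [s1 h1] := IHa K; exists (maxn s1 K).+1 => -[//|s].
    rewrite ltnS geq_max => /andP[l1 l2]; rewrite /= mul1r.
    apply: le_trans (psum_csub_le _ (@set_coef_ge0 R) _ _) _ => //.
    apply: le_trans (psum_leM (@set_coef_ge0 R) _ l2) _; first exact: psum_ge0.
    by apply: psum_le (@set_coef_ge0 R) _ _; [apply: psum_ge0|apply: h1].
elim: N e M => [|N IHN] e M; apply: main => [j|j K]; try exact: citer_ge0.
  by exists 0%N => s _; rewrite psum0.
have [s0 h] := IHN (H j) K; exists s0.+1 => -[//|s] ls.
by rewrite /= mul1r; apply: h.
Qed.

Lemma sub_cert_step r s (e : expr m) : 0 < r -> r < 1 ->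
  exists Q, forall q, (Q <= q)%N -> (0 < q)%N -> forall (p : nat) (v v' : expr m -> R),
    y <= p%:R / q%:R -> (forall f, damped r s f <= v f) -> 0 <= v' e ->
    (damped r s.+1 e = 0 -> v' e = 0) -> v' e <= damped r s.+1 e + q%:R^-1 ->
    sub_real H q (p%:R / q%:R) v v' e.
Proof.
move=> r0 r1; pose w := damped r s; pose T := subop s w e.
have w0 f : 0 <= w f by apply: damped_ge0; apply: ltW.
have T0 : 0 <= T by apply: subop_ge0.
have dE : damped r s.+1 e = r * T by [].
(* Where [T] vanishes there is no slack, but the lower bound 0 satisfies every condition. *)
have [Tz|Tn] := eqVneq T 0.
  exists 0%N => q _ q0 p v v' yp hv _ z _; have := z; rewrite dE Tz mulr0 => /(_ erefl) v'0.
  have v0 f : 0 <= v f by apply: le_trans (hv f).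
  have qR : 0 < q%:R :> R by rewrite ltr0n.
  case: e {T T0 dE Tz z} v'0 => [||j|a b|a b|a|a|a] /= ->.
  - exact: ler01.
  - exact: le_trans yp.
  - exact: v0.
  - exact: addr_ge0.
  - exact: mulr_ge0.
  - by rewrite addr_ge0 ?mulr_ge0.
  - have [|] := lerP 1 (v a); [by left|right].
    by rewrite mul0r subr0 expr1n ltW //= gerBl.
  - by rewrite exprn_ge0 // addr_ge0 // divr_ge0 // ltW.
have Tp : 0 < T by rewrite lt_neqAle eq_sym Tn.
(* Rounding up stays below [g], and [g < T] leaves room for replacing exponentials by powers. *)
pose g := (r * T + T) / 2.
have rT : r * T < T by rewrite gtr_pMl.
have g1 : r * T < g by rewrite /g; lra.
have g2 : g < T by rewrite /g; lra.
have g0 : 0 < g by apply: le_lt_trans g1; rewrite mulr_ge0 // ltW.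
have [Q1 hQ1] := @eventually_inv R (g - r * T) ltac:(by rewrite subr_gt0).
suff [Q2 hQ2] : exists Q2, forall q, (Q2 <= q)%N -> (0 < q)%N -> forall (p : nat) (v v' : expr m -> R),
    y <= p%:R / q%:R -> (forall f, w f <= v f) -> 0 <= v' e -> v' e <= g ->
    sub_real H q (p%:R / q%:R) v v' e.
  exists (maxn Q1 Q2) => q; rewrite geq_max => /andP[q1 q2] q0 p v v' yp hv v'0 _ hv'.
  apply: hQ2 => //; apply: le_trans hv' _; rewrite dE; have [_ h] := hQ1 q q1; lra.
clear Q1 hQ1 dE g1 rT Tn; move: g g0 g2 => g g0 g2.
case: e @T T0 Tp g2 => [||j|a b|a b|a|a|a] T T0 Tp g2; rewrite /T /= in g2.
- by exists 0%N => q _ _ p v v' yp hv v'0 /= h; lra.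
- by exists 0%N => q _ _ p v v' yp hv v'0 /= h; lra.
- by exists 0%N => q _ _ p v v' yp hv v'0 /= h; have := hv (H j); lra.
- by exists 0%N => q _ _ p v v' yp hv v'0 /= h; have := hv a; have := hv b; lra.
- exists 0%N => q _ _ p v v' yp hv v'0 /= h.
  by have := ler_pM (w0 a) (w0 b) (hv a) (hv b); lra.
- exists 0%N => q _ _ p v v' yp hv v'0 /= h.
  by have := ler_pM (w0 a) (w0 (ESeq a)) (hv a) (hv (ESeq a)); lra.
- have [wa|wa] := lerP 1 (w a).
    by exists 0%N => q _ _ p v v' yp hv v'0 /= h; left; apply: le_trans (hv a).
  have d : 0 < 1 - w a by rewrite subr_gt0.
  have [Q hQ] : exists Q : nat, forall q, (Q <= q)%N ->
      [/\ (0 < q)%N, 0 < 1 + (- g) / q%:R & 1 - w a <= (1 + (- g) / q%:R) ^+ q].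
    apply: expo_lim; rewrite -ltr_ln ?posrE ?expR_gt0 // expRK ltrNr.
    by apply: lt_le_trans g2 _; apply: psum_cyc_ln.
  exists Q => q Qq q0 p v v' yp hv v'0 /= h; right.
  have [_ b1 b2] := hQ q Qq; rewrite mulNr in b1 b2.
  have qR : 0 < q%:R :> R by rewrite ltr0n.
  have b3 : v' (ECyc a) / q%:R <= g / q%:R by rewrite ler_pM2r ?invr_gt0.
  split; first by rewrite -[q%:R]mul1r -ler_pdivrMr //; lra.
  apply: (@le_trans _ _ (1 - w a)); first by have := hv a; lra.
  by apply: le_trans b2 _; apply: lerXn2r; rewrite ?nnegrE; lra.
- have [Q hQ] : exists Q : nat, forall q, (Q <= q)%N ->
      [/\ (0 < q)%N, 0 < 1 + w a / q%:R & g <= (1 + w a / q%:R) ^+ q].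
    by apply: expo_lim; apply: lt_le_trans g2 _; apply: psum_set_le.
  exists Q => q Qq q0 p v v' yp hv v'0 /= h.
  have [_ b1 b2] := hQ q Qq; apply: le_trans h (le_trans b2 _).
  have qR : 0 < q%:R :> R by rewrite ltr0n.
  have b3 : w a / q%:R <= v a / q%:R by rewrite ler_pM2r ?invr_gt0.
  by apply: lerXn2r; rewrite ?nnegrE; lra.
Qed.

(** By divergence some partial sum exceeds [Bd]. This passes to a finite iterate, to [damped 1 s],
    to [damped r s] with [r] close to 1, and finally to multiples of [1 / q]. *)
Lemma exists_sub e1 (Bd : R) : ~ finite_value c e1 y -> 0 <= Bd ->
  exists s Q, forall q, (Q <= q)%N -> exists v : nat -> expr m -> nat,
    [/\ forall e, v 0%N e = 0%N,
        forall t e p, (t < s)%N -> e \in nodes H -> y * q%:R <= p%:R ->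
          sub_cert H p q (v t) (v t.+1) e &
        Bd * q%:R < (v s e1)%:R].
Proof.
move=> nF Bd0; have [M hM] : exists M, Bd < psum (cexpr c e1) M y.
  apply: contrapT => h; apply: nF; exists Bd => M; rewrite leNgt; apply/negP => hM.
  by apply: h; exists M.
have [N eN] := psum_lim citer_lim e1 M y; rewrite eN in hM.
have [s hs] := damped_limit N e1 M; have {}hs := lt_le_trans hM (hs s (leqnn s)).
have [D hD] := damped_bound s.
set z := damped 1 s e1 in hs hD; have z0 : 0 < z by apply: le_lt_trans hs.
have [r [r0 r1 hr]] : exists r, [/\ 0 < r, r < 1 & Bd < damped r s e1].
  have d0 : 0 < D.+1%:R :> R by rewrite ltr0n.
  (* By Bernoulli the loss at [r = 1 - h] is at most [D%:R * h * z], less than half of [z - Bd];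
     [D.+1] avoids a zero denominator and keeps [h <= 1 / 2]. *)
  pose h := (z - Bd) / (2 * z * D.+1%:R).
  have h0 : 0 < h by rewrite divr_gt0 ?mulr_gt0 ?subr_gt0.
  have h1 : h <= 1 / 2.
    rewrite /h ler_pdivrMr ?mulr_gt0 // -(natr1 D).
    have : 0 <= z * D%:R by rewrite mulr_ge0 // ltW.
    lra.
  exists (1 - h); split; [by lra|by lra|].
  apply: lt_le_trans (hD (1 - h) e1 ltac:(by lra) ltac:(by lra)).
  apply: (@lt_le_trans _ _ ((1 - D%:R * h) * z)); last first.
    by rewrite ler_pM2r // bernoulli_le ?(ltW h0) //; lra.
  have e2 : D.+1%:R * h * (2 * z) = z - Bd.
    by rewrite /h; field; rewrite !gt_eqF.
  have : 0 < h * z by rewrite mulr_gt0.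
  by rewrite -(natr1 D) in e2; lra.
have [Q hQ] : exists Q, forall q, (Q <= q)%N -> forall t, t \in iota 0 s -> forall e, e \in nodes H ->
    (0 < q)%N -> forall (p : nat) (v v' : expr m -> R),
    y <= p%:R / q%:R -> (forall f, damped r t f <= v f) -> 0 <= v' e ->
    (damped r t.+1 e = 0 -> v' e = 0) -> v' e <= damped r t.+1 e + q%:R^-1 ->
    sub_real H q (p%:R / q%:R) v v' e.
  by apply: eventually_seq => t _; apply: eventually_seq => e _; apply: sub_cert_step.
exists s, Q.+1 => q Qq; have q0 : (0 < q)%N by apply: leq_ltn_trans Qq.
have qR : 0 < q%:R :> R by rewrite ltr0n.
have d0 t e : 0 <= damped r t e by apply: damped_ge0; apply: ltW.
have dq t e : 0 <= damped r t e * q%:R by rewrite mulr_ge0.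
exists (fun t e => nat_above (damped r t e * q%:R)); split.
- by move=> e; rewrite /= mul0r /nat_above eqxx.
- move=> t e p ts en yp; apply/(@sub_certE m H R q q0).
  apply: (hQ q (ltnW Qq) t _ e en q0) => //.
  + by rewrite mem_iota add0n.
  + by rewrite ler_pdivlMr.
  + by move=> f; rewrite ler_pdivlMr // nat_above_ge.
  + by move=> z'; rewrite z' mul0r /nat_above eqxx mul0r.
  + by rewrite ler_pdivrMr // mulrDl mulVf ?gt_eqF // nat_above_le.
- by apply: lt_le_trans (nat_above_ge (dq _ _)); rewrite ltr_pM2r.
Qed.

End Sub.

(** * Existence of certificates *)

Section CertificateExists.
Variables (m : nat) (H : specification m).

Lemma eq_super_cert p q u u' e : u e = u' e -> (forall f, arg H e f -> u f = u' f) ->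
  super_cert H p q u e = super_cert H p q u' e.
Proof.
by move=> ue ua; case: e ue ua => [||j|a b|a b|a|a|a] /= ue ua; rewrite ?ue ?ua //; auto.
Qed.

Lemma eq_sub_cert p q v v' w w' e : v e = w e -> (forall f, arg H e f -> v f = w f) ->
  v' e = w' e -> sub_cert H p q v v' e = sub_cert H p q w w' e.
Proof.
by move=> ve va ve'; case: e ve va ve' => [||j|a b|a b|a|a|a] /= ve va ve';
  rewrite ?ve ?ve' ?va //; auto.
Qed.

Lemma certificate_intro (W : expr m -> bool) e1 M n p p' q s (u : expr m -> nat)
    (v : nat -> expr m -> nat) :
  (0 < q)%N -> (0 < p')%N -> (p' * 2 ^ n.+1 <= p * 2 ^ n.+1 + q)%N ->
  (forall e, e \in nodes H -> W e -> super_cert H p q u e) ->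
  (forall e, v 0%N e = 0%N) ->
  (forall t e, (t < s)%N -> e \in nodes H -> sub_cert H p' q (v t) (v t.+1) e) ->
  e1 \in nodes H -> (M * 2 ^ n.+1 * q < v s e1)%N ->
  exists B b, certificate H W e1 M n B b.
Proof.
move=> q0 p'0 pp hu v0 hv e1n hM; set L := nodes H; pose l := size L.
pose f k := if k is 0 then p else if k is 1 then p' else if k is 2 then q else
  if k is 3 then s else
  let k' := (k - 4)%N in if (k' < l)%N then u (nth EOne L k') else
  v ((k' - l) %/ l)%N (nth EOne L ((k' - l) %% l)%N).
have [B [b hB]] := exists_digits f (4 + l + s.+1 * l)%N.
have f4 k : f (4 + k)%N = if (k < l)%N then u (nth EOne L k) else
    v ((k - l) %/ l)%N (nth EOne L ((k - l) %% l)%N).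
  by rewrite add4n /f; have -> : (k.+4 - 4)%N = k by lia.
have hi e : e \in L -> (index e L < l)%N by rewrite index_mem.
have eu e : e \in L -> cert_super H B b e = u e.
  move=> en; rewrite /cert_super hB; last by have := hi e en; rewrite /L; lia.
  by rewrite f4 hi // nth_index.
have ev t e : (t <= s)%N -> e \in L -> cert_sub H B b t e = v t e.
  move=> ts en; have il := hi e en; have l0 : (0 < l)%N by apply: leq_ltn_trans il.
  rewrite /cert_sub -/L -/l hB; last first.
    rewrite ltn_add2l; apply: (@leq_trans (t * l + l)); first by rewrite ltn_add2l.
    by rewrite -mulSnr leq_mul2r ltnS ts orbT.
  rewrite -addnA f4 ltnNge leq_addr /= addKn.
  by rewrite divnMDl // modnMDl divn_small // modn_small // addn0 nth_index.
exists B, b; rewrite /certificate !hB ?addSn //=.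
rewrite q0 p'0 pp /=; apply/and4P; split.
- apply/allP => e en; apply/implyP => We.
  rewrite (@eq_super_cert p q _ u e) ?hu ?eu // => g eg.
  by rewrite eu //; apply: nodes_arg eg.
- by apply/allP => e en; rewrite ev ?v0.
- apply/allP => t; rewrite mem_iota add0n => /andP[_ ts]; apply/allP => e en.
  rewrite (@eq_sub_cert p' q _ _ (v t) (v t.+1) e) ?hv ?ev // ?(ltnW ts) // => g eg.
  by rewrite ev ?(ltnW ts) //; apply: nodes_arg eg.
- by rewrite ev.
Qed.

Variables (R : realType) (c : 'I_m -> nat -> R).
Hypothesis citer_lim : forall p, exists N, forall N', (N <= N')%N ->
  forall j k, (k <= p)%N -> citer H R N' j k = c j k.
Hypothesis no_size0_arg : forall e, e \in nodes H ->
  match e with ESeq a | ECyc a | ESet a => cexpr c a 0%N = 0 | _ => True end.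
Hypothesis c_neq0 : forall j, exists n, 0 < c j n.
Hypothesis c_nat : forall j, exists k : nat, c j 0%N = k%:R.
Variables (i : 'I_m) (rho : R).
Hypothesis rho0 : 0 < rho.
Hypothesis F_lt : forall x, 0 < x -> x < rho -> finite_value c (EVar i) x.
Hypothesis F_gt : forall x, rho < x -> ~ finite_value c (EVar i) x.

Lemma certificate_exists e1 M n : diverging H c i rho e1 ->
  exists B b, certificate H (fun e => `[< reach H (EVar i) e >]) e1 M n B b.
Proof.
move=> [We1 nF]; pose h : R := 2 ^- n.+1.
have h0 : 0 < h by rewrite invr_gt0 exprn_gt0.
(* The gap [h] is spent in quarters: one on each side of [rho], and one for each of the two
   roundings. The bound [rho / 2] keeps [rho - d] positive. *)
pose d := Num.min (h / 4) (rho / 2).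
have d0 : 0 < d by rewrite lt_min !divr_gt0.
have d1 : d <= h / 4 by rewrite ge_min lexx.
have d2 : d <= rho / 2 by rewrite ge_min lexx orbT.
have x0 : 0 < rho - d by lra.
have xx' : rho - d < rho - d / 2 by lra.
have x'r : rho - d / 2 < rho by lra.
have [Q1 hQ1] := exists_super citer_lim no_size0_arg c_neq0 c_nat F_lt x0 xx' x'r.
pose y := rho + h / 4; have y0 : 0 < y by rewrite /y; lra.
have [s [Q2 hQ2]] := @exists_sub m H R c citer_lim y (ltW y0) e1 (M * 2 ^ n.+1)%N%:R
  (nF y ltac:(by rewrite /y; lra)) (ler0n _ _).
have [Q3 hQ3] := @eventually_inv R (h / 4) ltac:(by rewrite divr_gt0).
pose q := maxn Q1 (maxn Q2 Q3).
have [q1 q2 q3] : [/\ Q1 <= q, Q2 <= q & Q3 <= q]%N.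
  by rewrite /q; split; rewrite !leq_max leqnn ?orbT.
have [q0 qh] := hQ3 q q3; have qR : 0 < q%:R :> R by rewrite ltr0n.
pose p := Num.truncn ((rho - d) * q%:R); pose p' := (Num.truncn (y * q%:R)).+1.
have xq0 : 0 <= (rho - d) * q%:R by rewrite mulr_ge0 // ltW.
have yq0 : 0 <= y * q%:R by rewrite mulr_ge0 // ltW.
have pl : p%:R <= (rho - d) * q%:R by rewrite truncn_le.
have pu : (rho - d) * q%:R < p%:R + 1 by rewrite natr1 truncnS_gt.
have pl' : y * q%:R <= p'%:R by rewrite ltW // truncnS_gt.
have pu' : p'%:R <= y * q%:R + 1 by rewrite -natr1 lerD2r truncn_le.
have [u hu] := hQ1 q q1 p pl; have [v [v0 hv hM]] := hQ2 q q2.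
apply: (@certificate_intro _ e1 M n p p' q s u v) => //.
- rewrite -(ler_nat R) natrD !natrM natrX.
  have q1h : 1 <= h / 4 * q%:R.
    by rewrite -ler_pdivrMr // mul1r.
  have : p'%:R - p%:R <= h * q%:R.
    have : d * q%:R <= h / 4 * q%:R by rewrite ler_pM2r.
    by rewrite /y mulrDl in pu'; rewrite mulrBl in pu; lra.
  by rewrite /h mulrC ler_pdivlMr ?exprn_gt0 //; lra.
- by move=> e en /asboolP; apply: hu.
- by move=> t e ts en; apply: hv.
- exact: (nodes_reach (nodes_var _ _) We1).
- by move: hM; rewrite -natrM ltr_nat.
Qed.

Lemma exists_certificates : exists B b : nat -> nat, [/\ recursive1 B, recursive1 b &
  forall n, (0 < digit (B n) (b n) 2)%N /\
    `|rho - (digit (B n) (b n) 0)%:R / (digit (B n) (b n) 2)%:R| <= 2 ^- n].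
Proof.
have [e1 De1 [C hC]] := exists_pole_bound citer_lim no_size0_arg c_neq0 c_nat rho0 F_lt F_gt.
pose M := (Num.truncn `|C|).+1.
have hM x : 0 < x -> x < rho -> value c x e1 * (rho - x) <= M%:R.
  move=> x0 xr; apply: le_trans (hC x x0 xr) (le_trans (ler_norm C) _).
  by rewrite ltW // truncnS_gt.
have [B [b [rB rb hBb]]] := recursive_search2
  (decidable_certificate H (fun e => `[< reach H (EVar i) e >]) e1 M)
  (fun n => certificate_exists M n De1).
exists B, b; split=> // n.
by apply: (certificate_sound citer_lim no_size0_arg c_neq0 F_lt F_gt _ _ hM (hBb n)); case: De1.
Qed.

End CertificateExists.

(** * From species to power series *)

Section Radius.
Variable a : nat -> R.
Hypothesis a0 : nonneg a.

Let absE n x : Rbasic_fun.Rabs (a n * Rpow_def.pow x n)%coqR = `|a n * x ^+ n|.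
Proof. by rewrite RabsE RmultE RpowE. Qed.

(** The radius is the least upper bound of the [r] for which [a n * r ^+ n] is bounded; such an
    [r > x] gives comparison with a geometric series of ratio [x / r]. *)
Lemma pfin_inside (rho x : R) : PSeries.CV_radius a = Rbar.Finite rho ->
  0 < x -> x < rho -> pfin a x.
Proof.
move=> arho x0 xr; have [_ lub] := PSeries.CV_radius_bounded a.
have [r xr' [M hM]] : exists2 r, x < r & exists M, forall n, `|a n * r ^+ n| <= M.
  apply: contrapT => h; move: xr; rewrite ltNge => /negP; apply.
  have : Rbar.Rbar_le (PSeries.CV_radius a) (Rbar.Finite x).
    apply: lub => r [M hM] /=; apply/RleP; rewrite leNgt; apply/negP => xr.
    by apply: h; exists r => //; exists M => n; rewrite -absE; apply/RleP.
  by rewrite arho /= => /RleP.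
have r0 : 0 < r by apply: lt_trans xr'.
have xr1 : x / r < 1 by rewrite ltr_pdivrMr // mul1r.
have x1 : 0 <= x / r by rewrite divr_ge0 // ltW.
have d : 0 < 1 - x / r by rewrite subr_gt0.
exists (M / (1 - x / r)) => N; rewrite ler_pdivlMr //.
have M0 : 0 <= M by apply: le_trans (hM 0%N).
have h : psum a N x <= M * psum (@seq_coef R) N (x / r).
  rewrite /psum mulr_sumr; apply: ler_sum => n _; rewrite /seq_coef mul1r.
  have := hM n; rewrite ger0_norm ?mulr_ge0 ?exprn_ge0 ?(ltW r0) // => hn.
  have -> : x ^+ n = r ^+ n * (x / r) ^+ n by rewrite -exprMn mulrCA mulfV ?gt_eqF // mulr1.
  by rewrite mulrA ler_wpM2r ?exprn_ge0.
apply: (@le_trans _ _ (M * psum (@seq_coef R) N (x / r) * (1 - x / r))).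
  by rewrite ler_wpM2r // ltW.
by rewrite -mulrA -[leRHS]mulr1 ler_wpM2l // psum_seq_le.
Qed.

Lemma pfin_outside (rho x : R) : PSeries.CV_radius a = Rbar.Finite rho ->
  0 <= rho -> rho < x -> ~ pfin a x.
Proof.
move=> arho r0 rx [y hy]; have [ub _] := PSeries.CV_radius_bounded a.
have x0 : 0 <= x by apply: le_trans (ltW rx).
have : Rbar.Rbar_le (Rbar.Finite x) (PSeries.CV_radius a).
  apply: ub; exists y => n; apply/RleP; rewrite absE ger0_norm ?mulr_ge0 ?exprn_ge0 //.
  apply: le_trans (hy n.+1); rewrite psumS lerDr; exact: psum_ge0.
by rewrite arho /= => /RleP; rewrite leNgt rx.
Qed.
End Radius.

Section Systems.
Variables (m : nat) (H : specification m).

Lemma egf_eval (Y : 'I_m -> species) e : eval_defined Y e ->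
  egf_coef (Defs.eval Y e) = cexpr (fun j => egf_coef (Y j)) e.
Proof.
elim: e => [||j|a IHa b IHb|a IHa b IHb|a IHa|a IHa|a IHa] //=.
- by move=> _; apply: funext => n; rewrite egf_card fact0 divr1.
- by move=> _; apply: funext => n; rewrite egf_card divr1.
- by case=> da db; apply: funext => n; rewrite egf_sum IHa ?IHb.
- by case=> da db; apply: funext => n; rewrite egf_prod IHa ?IHb.
- by case=> da na; apply: funext => n; rewrite egf_subst // IHa // (funext egf_lin).
- by case=> da na; apply: funext => n; rewrite egf_subst // IHa // (funext egf_cyc).
- by case=> da na; apply: funext => n; rewrite egf_subst // IHa // (funext egf_set).
Qed.

Lemma egf_iterate N j : iteration_defined H -> egf_coef (iterate H N j) = citer H R N j.
Proof.
move=> def; elim: N j => [|N IHN] j; first by apply: funext => n; apply: egf_zero.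
rewrite /= egf_eval; last exact: def.
by congr cexpr; apply: funext => k; apply: IHN.
Qed.

Lemma eval_defined_subs (Y : 'I_m -> species) e f : f \in subs e -> eval_defined Y e -> eval_defined Y f.
Proof.
elim: e => [||j|a IHa b IHb|a IHa b IHb|a IHa|a IHa|a IHa]; rewrite /= in_cons;
  case/predU1P=> [-> //|] //=; rewrite ?mem_cat.
- by case/orP=> hf [da db]; [apply: IHa|apply: IHb].
- by case/orP=> hf [da db]; [apply: IHa|apply: IHb].
- by move=> hf [da _]; apply: IHa.
- by move=> hf [da _]; apply: IHa.
- by move=> hf [da _]; apply: IHa.
Qed.

Lemma cexpr_le (R : realType) (c c' : 'I_m -> nat -> R) e n : (forall j, nonneg (c j)) ->
  (forall j k, c j k <= c' j k) -> cexpr c e n <= cexpr c' e n.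
Proof.
move=> c0 cc; have A0 f := cexpr_ge0 f c0.
elim: e n => [||j|a IHa b IHb|a IHa b IHb|a IHa|a IHa|a IHa] n //=.
- by rewrite lerD.
- exact: seqmul_le.
- exact: csub_le.
- by apply: csub_le => //; apply: cyc_coef_ge0.
- by apply: csub_le => //; apply: set_coef_ge0.
Qed.

(** Coefficients only grow along the iteration, so a structure in some iterate is never lost in the
    limit; this gives [c_neq0]. *)
Lemma citer_le (R : realType) N N' j n : (N <= N')%N -> citer H R N j n <= citer H R N' j n.
Proof.
elim: N N' j n => [|N IHN] [|N'] j n //=; first by move=> _; apply: cexpr_ge0 => k; apply: citer_ge0.
rewrite ltnS => NN; apply: cexpr_le => [k|k l]; [exact: citer_ge0|exact: IHN].
Qed.

Lemma no_size0_egf (F : species) : no_size0 F -> egf_coef F 0 = 0.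
Proof.
move=> F0; rewrite egf_coefE (_ : scount F 0 = 0%N) ?mul0r //.
by apply: eq_card0 => s; case: (F0 'I_0 _ s); rewrite card_ord.
Qed.

Variables (S : 'I_m -> species) (i : 'I_m) (rho : R).
Hypothesis Hc : constructive H.
Hypothesis HS : is_solution H S.
Hypothesis Hrho : PSeries.CV_radius (egf_coef (S i)) = Rbar.Finite rho.

Let c j := egf_coef (S j).

Let def : iteration_defined H. Proof. by case: Hc => -[]. Qed.

Let citer_lim p : exists N, forall N', (N <= N')%N ->
  forall j k, (k <= p)%N -> citer H R N' j k = c j k.
Proof.
have [N hN] := HS p; exists N => N' NN j k kp.
by rewrite -egf_iterate //; apply: contact_egf (hN N' j NN) _ kp.
Qed.

(** Definedness is assumed for the iterates only; it is transferred from one whose coefficients of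
    index 0 are already those of the limit. *)
Let no_size0_arg e : e \in nodes H ->
  match e with ESeq a | ECyc a | ESet a => cexpr c a 0%N = 0 | _ => True end.
Proof.
move=> en; have [N hN] := cexpr_lim citer_lim 0.
have key a : no_size0 (Defs.eval (iterate H N) a) -> eval_defined (iterate H N) a -> cexpr c a 0%N = 0.
  move=> na da; rewrite -(hN N) // -(no_size0_egf na) egf_eval //.
  by congr (cexpr _ _ _); apply: funext => j; rewrite egf_iterate.
case: (nodesP en) => [[j ->] //|[j ej]].
have := eval_defined_subs ej (def N j).
by case: (e) => //= a [da na]; apply: key.
Qed.

Let c_neq0 j : exists n, 0 < c j n.
Proof.
have [_ [N hN]] := Hc; have [U [s]] := hN j.
have : 0 < egf_coef (iterate H N j) #|U|.
  rewrite egf_coefE -card_str divr_gt0 // ltr0n ?fact_gt0 //.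
  by apply/card_gt0P; exists s.
rewrite egf_iterate // => h; exists #|U|.
have [N0 hN0] := citer_lim #|U|.
rewrite -(hN0 (maxn N N0)) ?leq_maxr //.
by apply: lt_le_trans h _; apply: citer_le; apply: leq_maxl.
Qed.

Let c_nat j : exists k : nat, c j 0%N = k%:R.
Proof. by exists (scount (S j) 0); rewrite /c egf_coefE fact0 divr1. Qed.

Lemma radius_computable : computable_real rho.
Proof.
have r0 : 0 <= rho.
  have := PSeries.CV_radius_ge_0 (egf_coef (S i)); rewrite Hrho /=.
  by move/RleP.
have rz : recursive1 (fun _ => 0%N) by apply: recursive_const.
(* A zero radius is computable at once, which spares a proof that the radius is positive. *)
have [rho0|rho0] := eqVneq rho 0.
  exists (fun _ => 0%N), (fun _ => 0%N), (fun _ => 0%N); split=> // n.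
  by rewrite rho0 subrr mul0r subr0 normr0 invr_ge0 exprn_ge0.
have {rho0 r0}rho0 : 0 < rho by rewrite lt_neqAle eq_sym rho0.
have nn : nonneg (c i) by move=> n; apply: egf_coef_ge0.
have F_lt x : 0 < x -> x < rho -> finite_value c (EVar i) x by apply: pfin_inside Hrho.
have F_gt x : rho < x -> ~ finite_value c (EVar i) x by apply: (pfin_outside _ Hrho) => //; apply: ltW.
have [B [b [rB rb hBb]]] := exists_certificates citer_lim no_size0_arg c_neq0 c_nat rho0 F_lt F_gt.
have rd k : recursive1 (fun n => digit (B n) (b n) k).
  by apply: recursive_digit => //; apply: recursive_const.
(* Denominators are represented as successors, hence the predecessor of [q]. *)
exists (fun n => digit (B n) (b n) 0), (fun _ => 0%N), (fun n => (digit (B n) (b n) 2).-1).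
split=> //; first exact: (recursive_comp1 recursive_pred (rd 2)).
by move=> n; have [q0 h] := hBb n; rewrite subr0 prednK.
Qed.

End Systems.

Theorem theorem3p14 (m : nat) (H : specification m) (S : 'I_m -> species)
    (i : 'I_m) (rho : R) :
  constructive H ->
  is_solution H S ->
  PSeries.CV_radius (egf_coef (S i)) = Rbar.Finite rho ->
  cyc_set_free H \/ schanuel_conjecture ->
  computable_real rho.
Proof. by move=> Hc HS Hrho _; apply: radius_computable Hc HS Hrho. Qed.
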